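(* Suppose $p\ge1$, $q>0$, $s>\max\{0,1-\frac qn\}$, and let $b=(b_1,\dots,b_n)\in\mathbb{B}$. Then there exist bounded linear operators $A_1,\dots,A_n$ on $\mathcal{N}(p,q,s)$ such that $$f(z)=\sum_{k=1}^n(z_k-b_k)A_kf(z),\qquad z\in\mathbb{B},$$ for all $f\in\mathcal{N}(p,q,s)$ with $f(b)=0$.
   Context: $\mathbb{B}$ is the open unit ball of $\mathbb{C}^n$, $H(\mathbb{B})$ is the space of holomorphic functions on $\mathbb{B}$, $dV$ is normalized volume measure on $\mathbb{B}$, and $d\lambda(z)=\frac{dV(z)}{(1-|z|^2)^{n+1}}$. For $a\in\mathbb{B}$, $\Phi_a(z)=\frac{a-P_az-s_aQ_az}{1-\langle z,a\rangle}$, where $s_a=\sqrt{1-|a|^2}$, $P_a$ is the orthogonal projection onto the span of $a$ and $Q_a=I-P_a$. For $p,q,s>0$, $\mathcal{N}(p,q,s)$ is the set of $f\in H(\mathbb{B})$ with $\|f\|^p=\sup_{a\in\mathbb{B}}\int_{\mathbb{B}}|f(z)|^p(1-|z|^2)^q(1-|\Phi_a(z)|^2)^{ns}d\lambda(z)<\infty$, normed by $\|\cdot\|$. *)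

(* Defs.v *)
From HB Require Import structures.
From mathcomp Require Import all_boot all_order all_algebra.
From mathcomp Require Import all_classical all_reals all_analysis.
From mathcomp Require Import complex spectral.

Set Implicit Arguments.
Unset Strict Implicit.
Unset Printing Implicit Defensive.

Import Order.TTheory GRing.Theory Num.Theory.
Import numFieldNormedType.Exports.

Local Open Scope classical_set_scope.
Local Open Scope ring_scope.

(* The n-fold product of a sigma-finite measure mu on T, as a sigma-finite
   measure on n.-tuple T. *)
Section tuple_measure.
Context d (T : measurableType d) (R : realType).
Variable mu : {sigma_finite_measure set T -> \bar R}.

Definition tuple_cons n (x : T * n.-tuple T) : n.+1.-tuple T :=
  [the n.+1.-tuple T of x.1 :: x.2].

Lemma measurable_tuple_cons n :
  measurable_fun [set: T * n.-tuple T] (@tuple_cons n).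
Proof. exact: measurable_cons. Qed.

HB.instance Definition _ n := isMeasurableFun.Build _ _ _ _ (@tuple_cons n)
  (@measurable_tuple_cons n).

Section tuple_measure_succ.
Variables (n : nat) (nu : {sigma_finite_measure set (n.-tuple T) -> \bar R}).

Definition tuple_measure_succ : set (n.+1.-tuple T) -> \bar R :=
  pushforward (mu \x nu)%E (@tuple_cons n).

Let tuple_measure_succ0 : tuple_measure_succ set0 = 0%E.
Proof. exact: measure0. Qed.

Let tuple_measure_succ_ge0 A : (0 <= tuple_measure_succ A)%E.
Proof. exact: measure_ge0. Qed.

Let tuple_measure_succ_sigma_additive :
  semi_sigma_additive tuple_measure_succ.
Proof. exact: measure_semi_sigma_additive. Qed.

HB.instance Definition _ := isMeasure.Build _ _ _ tuple_measure_succ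
  tuple_measure_succ0 tuple_measure_succ_ge0 tuple_measure_succ_sigma_additive.

Let tuple_measure_succ_sigma_finite : sigma_finite setT tuple_measure_succ.
Proof.
have /sigma_finiteP[F [TF ndF Foo]] := sigma_finiteT mu.
have /sigma_finiteP[G [TG ndG Goo]] := sigma_finiteT nu.
pose hd (t : n.+1.-tuple T) : T := thead t.
pose tl (t : n.+1.-tuple T) : n.-tuple T := [tuple of behead t].
have mhd : measurable_fun setT hd by exact: measurable_tnth.
have mtl : measurable_fun setT tl by exact: measurable_behead.
exists (fun k => hd @^-1` F k `&` tl @^-1` G k).
  apply/seteqP; split=> // t _.
  have [i _ Fi] : (\bigcup_k F k) (hd t) by rewrite -TF.
  have [j _ Gj] : (\bigcup_k G k) (tl t) by rewrite -TG.
  exists (maxn i j) => //; split.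
    by have /subsetPset := ndF _ _ (leq_maxl i j); apply.
  by have /subsetPset := ndG _ _ (leq_maxr i j); apply.
move=> k; have [mF Fk] := Foo k; have [mG Gk] := Goo k.
split.
  apply: measurableI; rewrite -[X in measurable X]setTI.
    exact: mhd.
  exact: mtl.
rewrite /tuple_measure_succ /pushforward.
rewrite (_ : _ @^-1` _ = F k `*` G k); last first.
  apply/seteqP; split=> -[x t] /=; rewrite /hd /tl theadE.
    by move=> [Fx]; rewrite (_ : [tuple of _] = t) //; apply: val_inj.
  by move=> [Fx Gt]; split => //; rewrite (_ : [tuple of _] = t) //; apply: val_inj.
by rewrite product_measure1E// lte_mul_pinfty// ge0_fin_numE.
Qed.

HB.instance Definition _ := Measure_isSigmaFinite.Build _ _ _
  tuple_measure_succ tuple_measure_succ_sigma_finite.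

End tuple_measure_succ.

Fixpoint tuple_measure n : {sigma_finite_measure set (n.-tuple T) -> \bar R} :=
  if n is m.+1 then tuple_measure_succ (tuple_measure m)
  else \d_([tuple] : 0.-tuple T).

End tuple_measure.

Section lebesgue_plane.
Variable R : realType.
Local Notation Rm := (measurableTypeR R).
Local Notation leb := (@lebesgue_measure R).

Definition lebesgue_plane : set (Rm * Rm)%type -> \bar R := (leb \x leb)%E.

HB.instance Definition _ := Measure.on lebesgue_plane.

Let lebesgue_plane_sigma_finite : sigma_finite setT lebesgue_plane.
Proof.
have /sigma_finiteP[F [TF ndF Foo]] := sigma_finiteT leb.
exists (fun k => F k `*` F k).
  apply/seteqP; split=> // -[x y] _.
  have [i _ Fi] : (\bigcup_k F k) x by rewrite -TF.
  have [j _ Fj] : (\bigcup_k F k) y by rewrite -TF.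
  exists (maxn i j) => //; split.
    by have /subsetPset := ndF _ _ (leq_maxl i j); apply.
  by have /subsetPset := ndF _ _ (leq_maxr i j); apply.
move=> k; have [mF Fk] := Foo k; split; first exact: measurableX.
by rewrite /lebesgue_plane product_measure1E// lte_mul_pinfty// ge0_fin_numE.
Qed.

HB.instance Definition _ := Measure_isSigmaFinite.Build _ _ _
  lebesgue_plane lebesgue_plane_sigma_finite.

End lebesgue_plane.

Section lebesgue_Cn.
Variables (R : realType) (n : nat).
Local Notation Rm := (measurableTypeR R).
Implicit Types z : 'rV[R[i]]_n.

(* Real coordinates: C^n is identified with (R * R)^n. *)
Definition of_real_coords (t : n.-tuple (Rm * Rm)) : 'rV[R[i]]_n :=
  \row_k Complex (tnth t k).1 (tnth t k).2.

Definition real_coords z : n.-tuple (Rm * Rm) :=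
  [tuple (complex.Re (z 0 k), complex.Im (z 0 k)) | k < n].

Lemma of_real_coordsK : cancel of_real_coords real_coords.
Proof.
move=> t; apply: eq_from_tnth => k; rewrite tnth_mktuple !mxE /=.
by case: (tnth t k).
Qed.

Lemma real_coordsK : cancel real_coords of_real_coords.
Proof.
by move=> z; apply/rowP => k; rewrite !mxE tnth_mktuple /=; case: (z 0 k).
Qed.

(* C^n with the sigma-algebra transported from (R * R)^n. *)
Definition measCn := @g_sigma_algebra_preimageType _
  ('rV[R[i]]_n : normedModType R[i]) _ real_coords.

Lemma measurable_of_real_coords :
  measurable_fun [set: n.-tuple (Rm * Rm)] (of_real_coords : _ -> measCn).
Proof.
move=> _ _ [B mB <-]; rewrite !setTI.
rewrite (_ : _ @^-1` _ = B)//; apply/seteqP.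
by split=> t /=; rewrite of_real_coordsK.
Qed.

HB.instance Definition _ := isMeasurableFun.Build _ _ _ _
  (of_real_coords : _ -> measCn) measurable_of_real_coords.


Definition lebesgue_Cn : set measCn -> \bar R :=
  pushforward (tuple_measure (@lebesgue_plane R) n)
    (of_real_coords : _ -> measCn).

Let lebesgue_Cn0 : lebesgue_Cn set0 = 0%E.
Proof. exact: measure0. Qed.

Let lebesgue_Cn_ge0 A : (0 <= lebesgue_Cn A)%E.
Proof. exact: measure_ge0. Qed.

Let lebesgue_Cn_sigma_additive : semi_sigma_additive lebesgue_Cn.
Proof. exact: measure_semi_sigma_additive. Qed.

HB.instance Definition _ := isMeasure.Build _ _ _ lebesgue_Cn
  lebesgue_Cn0 lebesgue_Cn_ge0 lebesgue_Cn_sigma_additive.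

End lebesgue_Cn.

Section ball.
Variables (R : realType) (n : nat).
Implicit Types (z a : 'rV[R[i]]_n) (f g : 'rV[R[i]]_n -> R[i]).

(* dotmx is linear in its first argument and conjugate-linear in its second. *)
Definition sqnorm z : R := complex.Re (dotmx z z).

Definition unit_ball : set 'rV[R[i]]_n := [set z | sqnorm z < 1].

Lemma ball_volume_inv_ge0 : 0 <= (fine (@lebesgue_Cn R n unit_ball))^-1.
Proof. by rewrite invr_ge0 fine_ge0 // measure_ge0. Qed.

Definition dV : {measure set measCn R n -> \bar R} :=
  mscale (NngNum ball_volume_inv_ge0) (@lebesgue_Cn R n).

(* Density of d lambda with respect to dV. *)
Definition lambda_density z : R := ((1 - sqnorm z) ^+ n.+1)^-1.

Definition Phi a z : 'rV[R[i]]_n :=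
  let P := z *m proj_ortho a in
  let s := real_complex R (Num.sqrt (1 - sqnorm a)) in
  (1 - dotmx z a)^-1 *: (a - P - s *: (z - P)).

(* Functions on the ball are represented by total functions on C^n, only their
   values on the ball being relevant; R[i]^o makes differentiability complex. *)
Definition holomorphic_on_ball f : Prop :=
  forall z : ('rV[R[i]]_n : normedModType R[i]),
    unit_ball z -> differentiable (f : 'rV[R[i]]_n -> R[i]^o) z.

Section space.
Variables p q s : R.

Definition Npow f : \bar R := ereal_sup [set
  (\int[dV]_(z in unit_ball)
     (Normc.normc (f z) `^ p * (1 - sqnorm z) `^ q
      * (1 - sqnorm (Phi a z)) `^ (n%:R * s) * lambda_density z)%:E)%E
  | a in unit_ball].

Definition Nnorm f : \bar R := (Npow f `^ p^-1)%E.

Definition Nspace : set ('rV[R[i]]_n -> R[i]) :=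
  [set f | holomorphic_on_ball f /\ (Npow f < +oo)%E].

(* The second clause makes A act on functions on the ball, i.e. modulo values
   outside it. *)
Definition bounded_linear_operator
    (A : ('rV[R[i]]_n -> R[i]) -> 'rV[R[i]]_n -> R[i]) : Prop :=
  [/\ forall f, Nspace f -> Nspace (A f),
      forall f g, Nspace f -> Nspace g ->
        (forall z, unit_ball z -> f z = g z) ->
        forall z, unit_ball z -> A f z = A g z,
      forall (c : R[i]) f g, Nspace f -> Nspace g ->
        forall z, unit_ball z -> A (fun w => c * f w + g w) z = c * A f z + A g z
    & exists M : R, forall f, Nspace f -> (Nnorm (A f) <= M%:E * Nnorm f)%E].

End space.
End ball.

(* Main.v *)
Require Import Defs.
From HB Require Import structures.
From mathcomp Require Import all_boot all_order all_algebra.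
From mathcomp Require Import all_classical all_reals all_analysis.
From mathcomp Require Import measurable_realfun complex sesquilinear spectral ring lra.

Set Implicit Arguments.
Unset Strict Implicit.
Unset Printing Implicit Defensive.

Import Order.TTheory GRing.Theory Num.Theory.
Import numFieldNormedType.Exports.

Local Open Scope classical_set_scope.
Local Open Scope ring_scope.

(** Put [A_k f(z)] equal to the integral over [0 <= t <= 1] of the partial
    derivative [d_k f] at [b + t (z - b)].  Along the segment from [b] to [z]
    the derivative of [f] is the sum of the [(z_k - b_k) d_k f], so the
    fundamental theorem of calculus gives
    [f(z) - f(b) = sum_k (z_k - b_k) A_k f(z)] ([gleason_identity]).  What has
    to be proved is that [A_k] is bounded on the space.

    Write [delta z = 1 - |z|^2], [gap z a = |1 - <z,a>|], [N] for the complex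
    dimension and [m = N s].  Since
    [1 - |Phi_a z|^2 = delta a * delta z / gap z a ^ 2] ([Phi_identity]), the
    integrand of the norm is [|f|^p] times the weight
    [delta z ^ be * delta a ^ m * gap z a ^ (-2m)] with [be = q + m - N - 1],
    and the hypothesis on [s] says that [m > 0] and [be > -1].

    Holomorphic functions enter through the mean value property on circles,
    which is deduced from Goursat's lemma ([mean_value_circle]).  It gives
    Cauchy estimates, the holomorphy of [d_k f] and of [A_k f], and, after
    averaging over rotations, the inequality
    [V(O) |f(u)|^p <= 2^p * (integral of |f|^p over u + O)] for circular sets
    [O] ([area_mean_value]).  With [O] a polydisc adapted to the weight this
    yields the growth bound [|f(u)|^p <= K ||f||^p delta u ^ (-q)] ([growth]).
    The volumes which occur are computed by comparison with boxes, after
    unitary changes of variables and dilations; that these act on Lebesgue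
    measure as expected follows from the uniqueness of the translation
    invariant measure ([haar_unique]).

    Let [w] be the point of parameter [t] on the segment, [tau = 1 - t] and
    [d = tau + delta z]; then [delta w] is at least a multiple of [d].  If
    [tau <= gap z a], the mean value inequality on a ball around [w] bounds
    [|d_k f(w)|] by [d ^ (-1 - k/p) Y ^ (1/p)], where [Y] is an integral of
    [|f|^p delta ^ (k - 2N)] over a region around [z] on which [gap] is at most
    ten times [gap z a] ([partial_near]).  If [tau > gap z a], the growth bound
    suffices ([partial_far]).  Integrating in [t],
    [|A_k f(z)|^p <= K (delta z ^ (-k) Y + ||f||^p gap z a ^ (-q))]
    ([gleason_pointwise]).  The exponent [k > 0] is chosen such that
    [-1 < be - k < 0].  Against the weight, the first term is integrated with
    Tonelli's theorem and [boundary_ball_integral], the second one with the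
    Forelli-Rudin estimate ([forelli_rudin]); both integrals are at most a
    constant times [||f||^p], uniformly in [a] ([gleason_norm]). *)

(** * Complex-valued functions of a real variable *)
Arguments Normc.normc : simpl never.

Section cplx.
Variable R : realType.
Local Notation C := R[i].
Implicit Types (x y z : C).
Local Notation nc := (@Normc.normc R).

Lemma ncE z : nc z = Num.sqrt (complex.Re z ^+ 2 + complex.Im z ^+ 2).
Proof. by case: z. Qed.

Lemma nc_ge0 z : 0 <= nc z. Proof. by rewrite ncE sqrtr_ge0. Qed.

Lemma ler_ncD x y : nc (x + y) <= nc x + nc y.
Proof. exact: le_normcD. Qed.

Lemma ncN x : nc (- x) = nc x. Proof. exact: normcN. Qed.

Lemma ler_ncB x y : nc (x - y) <= nc x + nc y.
Proof. by rewrite (le_trans (ler_ncD _ _))// ncN. Qed.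

Lemma ler_nc_Re z : `|complex.Re z| <= nc z.
Proof.
by rewrite ncE -sqrtr_sqr ler_sqrt ?lerDl ?sqr_ge0// addr_ge0 ?sqr_ge0.
Qed.

Lemma ler_nc_Im z : `|complex.Im z| <= nc z.
Proof.
by rewrite ncE -sqrtr_sqr ler_sqrt ?lerDr ?sqr_ge0// addr_ge0 ?sqr_ge0.
Qed.

Lemma ler_nc_ReIm z : nc z <= `|complex.Re z| + `|complex.Im z|.
Proof.
rewrite ncE -[leRHS]ger0_norm ?addr_ge0// -sqrtr_sqr ler_sqrt ?sqr_ge0//.
rewrite sqrrD !real_normK ?num_real// -addrA (addrC (_ *+ _)) addrA lerDl.
by rewrite mulrn_wge0// mulr_ge0.
Qed.

Lemma nc_norm z : (nc z)%:C%C = `|z|.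
Proof. by rewrite normc_def ncE. Qed.

Lemma nc_real (r : R) : nc r%:C%C = `|r|.
Proof. by rewrite ncE /= expr0n /= addr0 sqrtr_sqr. Qed.

Lemma cReD x y : complex.Re (x + y) = complex.Re x + complex.Re y.
Proof. by case: x; case: y. Qed.
Lemma cImD x y : complex.Im (x + y) = complex.Im x + complex.Im y.
Proof. by case: x; case: y. Qed.
Lemma cReN x : complex.Re (- x) = - complex.Re x. Proof. by case: x. Qed.
Lemma cImN x : complex.Im (- x) = - complex.Im x. Proof. by case: x. Qed.
Lemma cReM x y : complex.Re (x * y) =
  complex.Re x * complex.Re y - complex.Im x * complex.Im y.
Proof. by case: x; case: y. Qed.
Lemma cImM x y : complex.Im (x * y) =
  complex.Re x * complex.Im y + complex.Im x * complex.Re y.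
Proof. by case: x; case: y. Qed.
Definition cReImE := (cReD, cImD, cReN, cImN, cReM, cImM).

Lemma complex_ext x y : complex.Re x = complex.Re y ->
  complex.Im x = complex.Im y -> x = y.
Proof. by case: x y => [a b] [c d] /= -> ->. Qed.

(** Continuity at a point is required of both coordinates, the form in which
    real integration theory takes it; [ccontP] is the metric form. *)
Definition ccont (g : R -> C) (t : R) :=
  {for t, continuous (fun s : R => complex.Re (g s))} /\ {for t, continuous (fun s => complex.Im (g s))}.

Lemma ccontP g t : ccont g t <-> forall e : R, 0 < e ->
  exists2 d : R, 0 < d & forall t', `|t' - t| < d -> nc (g t' - g t) < e.
Proof.
split.
  move=> [/cvgrPdist_lt hR /cvgrPdist_lt hI] e e0.
  have e20 : 0 < e / 2 by rewrite divr_gt0.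
  have /nbhs_ballP[d1 /= d10 h1] := hR _ e20.
  have /nbhs_ballP[d2 /= d20 h2] := hI _ e20.
  exists (Num.min d1 d2); first by rewrite lt_min d10.
  move=> t'; rewrite lt_min => /andP[td1 td2].
  rewrite (le_lt_trans (ler_nc_ReIm _))// (splitr e) ltrD// !cReImE distrC.
    by apply: h1; rewrite /ball/= distrC.
  by apply: h2; rewrite /ball/= distrC.
move=> h; split; apply/cvgrPdist_lt => e e0; have [d d0 hd] := h _ e0;
  apply/nbhs_ballP; exists d => //= t'; rewrite /ball/= distrC => /hd;
  apply: le_lt_trans; rewrite distrC.
  by have := ler_nc_Re (g t' - g t); rewrite !cReImE.
by have := ler_nc_Im (g t' - g t); rewrite !cReImE.
Qed.

Lemma ccont_cst (c : C) t : ccont (fun=> c) t.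
Proof. by split; apply: cvg_cst. Qed.

Lemma ccontD g h t : ccont g t -> ccont h t -> ccont (fun s => g s + h s) t.
Proof.
move=> [g1 g2] [h1 h2]; split.
  have -> : (fun s => complex.Re (g s + h s)) =
      (fun s => complex.Re (g s)) + (fun s => complex.Re (h s)).
    by apply/funext => s; rewrite cReD.
  exact: continuousD.
have -> : (fun s => complex.Im (g s + h s)) =
    (fun s => complex.Im (g s)) + (fun s => complex.Im (h s)).
  by apply/funext => s; rewrite cImD.
exact: continuousD.
Qed.

Lemma ccontM g h t : ccont g t -> ccont h t -> ccont (fun s => g s * h s) t.
Proof.
move=> [g1 g2] [h1 h2]; split.
  have -> : (fun s => complex.Re (g s * h s)) =
      (fun s => complex.Re (g s)) * (fun s => complex.Re (h s)) -
      (fun s => complex.Im (g s)) * (fun s => complex.Im (h s)).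
    by apply/funext => s; rewrite cReM.
  by apply: continuousB; apply: continuousM.
have -> : (fun s => complex.Im (g s * h s)) =
    (fun s => complex.Re (g s)) * (fun s => complex.Im (h s)) +
    (fun s => complex.Im (g s)) * (fun s => complex.Re (h s)).
  by apply/funext => s; rewrite cImM.
by apply: continuousD; apply: continuousM.
Qed.

Lemma ccontB g h t : ccont g t -> ccont h t -> ccont (fun s => g s - h s) t.
Proof.
move=> hg hh; have -> : (fun s => g s - h s) = (fun s => g s + (-1) * h s).
  by apply/funext => s; rewrite mulN1r.
exact: ccontD hg (ccontM (ccont_cst (-1) t) hh).
Qed.

Local Notation mu := (@lebesgue_measure R).

(** The integral of a complex function over a segment is taken coordinate by
    coordinate. *)
Definition cint (a b : R) (g : R -> C) : C :=
  Complex (\int[mu]_(t in `[a, b]) complex.Re (g t))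
          (\int[mu]_(t in `[a, b]) complex.Im (g t)).

Definition ccont_on a b g := forall t, a <= t <= b -> ccont g t.

Lemma ccont_on_integrable a b g : ccont_on a b g ->
  mu.-integrable `[a, b] (EFin \o (fun s => complex.Re (g s))) /\
  mu.-integrable `[a, b] (EFin \o (fun s => complex.Im (g s))).
Proof.
move=> h; split; apply: continuous_compact_integrable;
  do ?exact: segment_compact; apply: continuous_in_subspaceT => t;
  rewrite inE/= in_itv/= => /h[]//.
Qed.

Lemma cintD a b g h : ccont_on a b g -> ccont_on a b h ->
  cint a b (fun t => g t + h t) = cint a b g + cint a b h.
Proof.
move=> /ccont_on_integrable[g1 g2] /ccont_on_integrable[h1 h2].
apply: complex_ext; rewrite !cReImE /=.
  by under eq_Rintegral do rewrite cReD; rewrite RintegralD.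
by under eq_Rintegral do rewrite cImD; rewrite RintegralD.
Qed.

Lemma cintZ a b (c : C) g : ccont_on a b g ->
  cint a b (fun t => c * g t) = c * cint a b g.
Proof.
move=> /ccont_on_integrable[g1 g2].
have i1 r : mu.-integrable `[a, b] (EFin \o (fun t => r * complex.Re (g t))).
  by have := @integrableZl _ _ _ mu `[a, b] (measurable_itv _) r _ g1; apply: eq_integrable.
have i2 r : mu.-integrable `[a, b] (EFin \o (fun t => r * complex.Im (g t))).
  by have := @integrableZl _ _ _ mu `[a, b] (measurable_itv _) r _ g2; apply: eq_integrable.
apply: complex_ext; rewrite !cReImE /=.
  under eq_Rintegral do rewrite cReM.
  by rewrite RintegralB// !RintegralZl.
under eq_Rintegral do rewrite cImM.
by rewrite RintegralD// !RintegralZl.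
Qed.

Lemma eq_cint a b g h : (forall t, a <= t <= b -> g t = h t) ->
  cint a b g = cint a b h.
Proof.
move=> e; apply: complex_ext => /=; apply: eq_Rintegral => t;
  by rewrite inE/= in_itv/= => /e ->.
Qed.

Lemma cintB a b g h : ccont_on a b g -> ccont_on a b h ->
  cint a b (fun t => g t - h t) = cint a b g - cint a b h.
Proof.
move=> hg hh; rewrite -[in RHS](mulN1r (cint a b h)) -(cintZ (-1) hh) -cintD//.
  by apply: eq_cint => t _; rewrite mulN1r.
by move=> t /hh; apply: ccontM (ccont_cst (-1) t).
Qed.

Lemma cint_cst a b (c : C) : a <= b -> cint a b (fun=> c) = (b - a)%:C%C * c.
Proof.
move=> ab; have m : fine (mu `[a, b]) = b - a.
  rewrite lebesgue_measure_itv/= lte_fin.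
  by case: ltgtP ab => // -> _; rewrite subrr.
by apply: complex_ext; rewrite !cReImE/= !Rintegral_cst//= m; ring.
Qed.

Lemma cint_split a b c g : a <= b -> b <= c -> ccont_on a c g ->
  cint a c g = cint a b g + cint b c g.
Proof.
move=> ab bc /ccont_on_integrable[g1 g2].
have H (u : R -> R) : mu.-integrable `[a, c] (EFin \o u) ->
    \int[mu]_(t in `[a, c]) u t =
    \int[mu]_(t in `[a, b]) u t + \int[mu]_(t in `[b, c]) u t.
  move=> iu; rewrite -[X in _ + X]Rintegral_itv_obnd_cbnd; last first.
    apply: integrableS iu => //.
    by apply: subset_itv; rewrite bnd_simp.
  rewrite -(@Rintegral_itvB _ u (BLeft a) (BRight c) b)//; first by ring.
apply: complex_ext; rewrite !cReImE/=; exact: H.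
Qed.

(** Bounding the real and the imaginary part separately costs the factor 2,
    which is harmless in everything that follows. *)
Lemma ler_nc_cint a b g M : a <= b -> ccont_on a b g ->
  (forall t, a <= t <= b -> nc (g t) <= M) -> nc (cint a b g) <= 2 * M * (b - a).
Proof.
move=> ab /ccont_on_integrable[g1 g2] gM.
have H (u : R -> R) : mu.-integrable `[a, b] (EFin \o u) ->
    (forall t, a <= t <= b -> `|u t| <= M) ->
    `| \int[mu]_(t in `[a, b]) u t| <= M * (b - a).
  move=> iu uM; apply: (le_trans (le_normr_Rintegral _ iu)) => //.
  have -> : M * (b - a) = \int[mu]_(t in `[a, b]) M.
    rewrite Rintegral_cst//= lebesgue_measure_itv/= lte_fin.
    by case: ltgtP ab => // -> _; rewrite subrr.
  apply: le_Rintegral => //.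
  - by apply/integrable_norm : iu.
  - apply: continuous_compact_integrable; first exact: segment_compact.
    by apply: continuous_in_subspaceT => ? _; apply: cvg_cst.
rewrite (le_trans (ler_nc_ReIm _))// -mulrA mulr2n mulrDl mul1r lerD//=.
- by apply: H g1 _ => t /gM; apply/le_trans/ler_nc_Re.
- by apply: H g2 _ => t /gM; apply/le_trans/ler_nc_Im.
Qed.
End cplx.
Arguments cint : simpl never.

(** * Goursat's lemma on rectangles *)
Section goursat.
Variable R : realType.
Local Notation C := R[i].
Local Notation nc := (@Normc.normc R).
Implicit Types (g : R -> R -> C).

(** Complex differentiability of [g] as a function of [x + i y]; the error is
    measured by the equivalent norm [|dx| + |dy|]. *)
Definition gdiff g (x y : R) := exists c : C, forall e : R, 0 < e ->
  exists2 d : R, 0 < d & forall x' y', `|x' - x| < d -> `|y' - y| < d ->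
    nc (g x' y' - g x y - c * Complex (x' - x) (y' - y)) <=
      e * (`|x' - x| + `|y' - y|).

Lemma gdiff_cont g x y : gdiff g x y -> forall e : R, 0 < e ->
  exists2 d : R, 0 < d & forall x' y', `|x' - x| < d -> `|y' - y| < d ->
    nc (g x' y' - g x y) < e.
Proof.
move=> [c /(_ 1 ltr01)[d d0 H]] e e0.
pose K := 4 * (nc c + 1).
have K0 : 0 < K by have := nc_ge0 c; rewrite /K; lra.
exists (Num.min d (e / K)); first by rewrite lt_min d0 divr_gt0.
move=> x' y'; rewrite !lt_min => /andP[xd xe] /andP[yd ye].
have h1 := H _ _ xd yd.
have h2 : nc (c * Complex (x' - x) (y' - y)) <=
    nc c * (`|x' - x| + `|y' - y|).
  by rewrite Normc.normcM ler_wpM2l ?nc_ge0//; exact: ler_nc_ReIm.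
have := ler_ncD (g x' y' - g x y - c * Complex (x' - x) (y' - y))
  (c * Complex (x' - x) (y' - y)); rewrite subrK => h3.
apply: (le_lt_trans h3).
move: xe ye; rewrite !ltr_pdivlMr// /K => xe ye.
have := nc_ge0 c; have := normr_ge0 (x' - x); have := normr_ge0 (y' - y).
nra.
Qed.

Lemma gdiff_ccont1 g x y : gdiff g x y -> ccont (fun s => g s y) x.
Proof.
move=> h; apply/ccontP => e e0; have [d d0 H] := gdiff_cont h e0.
by exists d => // t td; apply: H; rewrite ?subrr ?normr0.
Qed.

Lemma gdiff_ccont2 g x y : gdiff g x y -> ccont (g x) y.
Proof.
move=> h; apply/ccontP => e e0; have [d d0 H] := gdiff_cont h e0.
by exists d => // t td; apply: H; rewrite ?subrr ?normr0.
Qed.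

(** The contour integral of [g] along the boundary of the rectangle [[a, b] x
    [c, d]]. *)
Definition rect_int g (a b c d : R) : C :=
  'i%C * cint c d (fun y => g b y - g a y) - cint a b (fun x => g x d - g x c).
Arguments rect_int : simpl never.

Definition gdiff_on g a b c d :=
  forall x y, a <= x <= b -> c <= y <= d -> gdiff g x y.

Lemma gdiff_on_sub g a b c d a' b' c' d' : a <= a' -> b' <= b -> c <= c' ->
  d' <= d -> gdiff_on g a b c d -> gdiff_on g a' b' c' d'.
Proof.
move=> aa bb cc dd h x y /andP[h1 h2] /andP[h3 h4]; apply: h.
  by rewrite (le_trans aa)// (le_trans h2).
by rewrite (le_trans cc)// (le_trans h4).
Qed.

Lemma gdiff_on_ccont1 g a b c d y : gdiff_on g a b c d -> c <= y <= d ->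
  ccont_on a b (fun x => g x y).
Proof. by move=> h hy x hx; apply: gdiff_ccont1; apply: h. Qed.

Lemma gdiff_on_ccont2 g a b c d x : gdiff_on g a b c d -> a <= x <= b ->
  ccont_on c d (g x).
Proof. by move=> h hx y hy; apply: gdiff_ccont2; apply: h. Qed.

Lemma rect_int_splitx g a m b c d : a <= m -> m <= b -> c <= d ->
  gdiff_on g a b c d ->
  rect_int g a b c d = rect_int g a m c d + rect_int g m b c d.
Proof.
move=> am mb cd h; have ab := le_trans am mb; rewrite /rect_int.
have hc x : a <= x <= b -> ccont_on c d (g x).
  by move=> hx; apply: gdiff_on_ccont2 h hx.
have ha : ccont_on c d (g a) by apply: hc; rewrite lexx ab.
have hm : ccont_on c d (g m) by apply: hc; rewrite am mb.
have hb : ccont_on c d (g b) by apply: hc; rewrite lexx ab.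
rewrite (cintB hb ha) (cintB hm ha) (cintB hb hm).
rewrite (cint_split am mb); last first.
  move=> x hx; apply: ccontB; apply: gdiff_on_ccont1 h _ _ hx;
    by rewrite lexx cd.
by ring.
Qed.

Lemma rect_int_splity g a b c m d : a <= b -> c <= m -> m <= d ->
  gdiff_on g a b c d ->
  rect_int g a b c d = rect_int g a b c m + rect_int g a b m d.
Proof.
move=> ab cm md h; have cd := le_trans cm md; rewrite /rect_int.
have hc y : c <= y <= d -> ccont_on a b (fun x => g x y).
  by move=> hx; apply: gdiff_on_ccont1 h hx.
have ha : ccont_on a b (fun x => g x c) by apply: hc; rewrite lexx cd.
have hm : ccont_on a b (fun x => g x m) by apply: hc; rewrite cm md.
have hb : ccont_on a b (fun x => g x d) by apply: hc; rewrite lexx cd.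
rewrite (cintB hb ha) (cintB hm ha) (cintB hb hm).
rewrite (cint_split cm md); last first.
  move=> x hx; apply: ccontB; apply: gdiff_on_ccont2 h _ _ hx;
    by rewrite lexx ab.
by ring.
Qed.

(** An affine function has zero contour integral, so only the error in the
    affine approximation of [g] contributes. *)
Lemma rect_int_small g a b c d x y k e : a <= x <= b -> c <= y <= d -> 0 <= e ->
  gdiff_on g a b c d ->
  (forall x' y', a <= x' <= b -> c <= y' <= d ->
    nc (g x' y' - g x y - k * Complex (x' - x) (y' - y)) <=
      e * (`|x' - x| + `|y' - y|)) ->
  nc (rect_int g a b c d) <= 4 * e * ((b - a) + (d - c)) ^+ 2.
Proof.
move=> axb cyd e0 h H.
have ab : a <= b by case/andP: axb => [/le_trans] h1 /h1.
have cd : c <= d by case/andP: cyd => [/le_trans] h1 /h1.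
have aab : a <= a <= b by rewrite lexx ab.
have bab : a <= b <= b by rewrite lexx ab.
have ccd : c <= c <= d by rewrite lexx cd.
have dcd : c <= d <= d by rewrite lexx cd.
set s := b - a; set t := d - c.
have H' x' y' : a <= x' <= b -> c <= y' <= d ->
    nc (g x' y' - g x y - k * Complex (x' - x) (y' - y)) <= e * (s + t).
  move=> h1 h2; apply: (le_trans (H _ _ h1 h2)); rewrite ler_wpM2l// lerD//.
    rewrite ler_norml /s; move: axb h1 => /andP[? ?] /andP[? ?]; apply/andP; split; lra.
  rewrite ler_norml /t; move: cyd h2 => /andP[? ?] /andP[? ?]; apply/andP; split; lra.
pose r1 y' := (g b y' - g a y') - k * s%:C%C.
pose r2 x' := (g x' d - g x' c) - k * (Complex 0 t).
have cr1 : ccont_on c d r1.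
  move=> y' hy'; apply: ccontB (ccont_cst _ _); apply: ccontB;
    exact: gdiff_on_ccont2 h _ _ hy'.
have cr2 : ccont_on a b r2.
  move=> y' hy'; apply: ccontB (ccont_cst _ _); apply: ccontB.
    exact: gdiff_on_ccont1 h dcd _ hy'.
  exact: gdiff_on_ccont1 h ccd _ hy'.
have b1 y' : c <= y' <= d -> nc (r1 y') <= 2 * (e * (s + t)).
  move=> hy'.
  have -> : r1 y' = (g b y' - g x y - k * Complex (b - x) (y' - y)) -
      (g a y' - g x y - k * Complex (a - x) (y' - y)).
    have -> : Complex (b - x) (y' - y) = Complex (a - x) (y' - y) + s%:C%C.
      by apply: complex_ext; rewrite !cReImE /= /s; ring.
    by rewrite /r1; ring.
  by rewrite (le_trans (ler_ncB _ _))// mulr2n mulrDl !mul1r lerD// H'.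
have b2 x' : a <= x' <= b -> nc (r2 x') <= 2 * (e * (s + t)).
  move=> hx'.
  have -> : r2 x' = (g x' d - g x y - k * Complex (x' - x) (d - y)) -
      (g x' c - g x y - k * Complex (x' - x) (c - y)).
    have -> : Complex (x' - x) (d - y) = Complex (x' - x) (c - y) + Complex 0 t.
      by apply: complex_ext; rewrite !cReImE /= /t; ring.
    by rewrite /r2; ring.
  by rewrite (le_trans (ler_ncB _ _))// mulr2n mulrDl !mul1r lerD// H'.
have -> : rect_int g a b c d = 'i%C * cint c d r1 - cint a b r2.
  rewrite /rect_int.
  rewrite [in LHS](@eq_cint _ c d _ (fun y' => k * s%:C%C + r1 y')); last first.
    by move=> y' _; rewrite /r1; ring.
  rewrite [in LHS](@eq_cint _ a b _ (fun y' => k * (Complex 0 t) + r2 y')); last first.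
    by move=> y' _; rewrite /r2; ring.
  have cc1 : ccont_on c d (fun=> k * s%:C%C) by move=> u _; exact: ccont_cst.
  have cc2 : ccont_on a b (fun=> k * Complex 0 t) by move=> u _; exact: ccont_cst.
  rewrite (cintD cc1 cr1) (cintD cc2 cr2) (cint_cst _ cd) (cint_cst _ ab) -/s -/t.
  have -> : Complex 0 t = 'i%C * t%:C%C :> C.
    by apply: complex_ext; rewrite !cReImE/=; ring.
  by ring.
rewrite (le_trans (ler_ncB _ _))// Normc.normcM.
have -> : nc 'i%C = 1 by rewrite ncE /= expr0n/= expr1n add0r sqrtr1.
rewrite mul1r (le_trans (lerD (ler_nc_cint cd cr1 b1) (ler_nc_cint ab cr2 b2)))//.
rewrite -/s -/t le_eqVlt; apply/orP; left; apply/eqP; ring.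
Qed.

Lemma expn2_gt (r : R) : exists k : nat, r < 2 ^+ k.
Proof.
exists (Num.truncn `|r|).+1; apply: (le_lt_trans (ler_norm _)).
apply: (lt_le_trans (truncnS_gt _)).
by rewrite -natrX ler_nat ltnW// ltn_expl.
Qed.

(** Quarter the rectangle, keeping at each step a quarter that carries at
    least a fourth of the integral. At the common point of the nested
    rectangles differentiability bounds the integral by a small multiple of
    the area, which contradicts the lower bound unless the integral vanishes.
    *)
Lemma goursat g a b c d : a <= b -> c <= d -> gdiff_on g a b c d ->
  rect_int g a b c d = 0.
Proof.
move=> ab cd hg; apply/eqP; apply: contrapT => /negP J0.
pose eta := nc (rect_int g a b c d).
have eta0 : 0 < eta.
  rewrite lt_neqAle nc_ge0 andbT eq_sym; apply: contra J0 => /eqP e0.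
  by apply/eqP; apply: Normc.eq0_normc.
pose s k := (b - a) / 2 ^+ k; pose t k := (d - c) / 2 ^+ k.
have s0 k : 0 <= s k by rewrite /s divr_ge0// subr_ge0.
have t0 k : 0 <= t k by rewrite /t divr_ge0// subr_ge0.
have sS k : s k = s k.+1 + s k.+1 by rewrite /s exprS invfM; field; rewrite expf_neq0.
have tS k : t k = t k.+1 + t k.+1 by rewrite /t exprS invfM; field; rewrite expf_neq0.
pose P (k : nat) (z : R * R) := [/\ a <= z.1, z.1 + s k <= b, c <= z.2, z.2 + t k <= d
  & eta / 4 ^+ k <= nc (rect_int g z.1 (z.1 + s k) z.2 (z.2 + t k))].
have step (kz : nat * (R * R)) : exists z' : R * R, P kz.1 kz.2 ->
  [/\ P kz.1.+1 z', kz.2.1 <= z'.1, z'.1 + s kz.1.+1 <= kz.2.1 + s kz.1,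
      kz.2.2 <= z'.2 & z'.2 + t kz.1.+1 <= kz.2.2 + t kz.1].
  case: kz => k [x y] /=.
  have [Pk|nP] := pselect (P k (x, y)); last by exists (x, y) => /nP.
  case: (Pk) => /= ax xb cy yd hJ.
  have sk := s0 k.+1; have tk := t0 k.+1.
  set x1 := x + s k.+1; set y1 := y + t k.+1.
  have ex : x + s k = x1 + s k.+1 by rewrite sS addrA.
  have ey : y + t k = y1 + t k.+1 by rewrite tS addrA.
  have xx1 : x <= x1 by rewrite lerDl.
  have yy1 : y <= y1 by rewrite lerDl.
  have x1x : x1 <= x + s k by rewrite ex lerDl.
  have y1y : y1 <= y + t k by rewrite ey lerDl.
  have hg' := gdiff_on_sub ax xb cy yd hg.
  have := hJ; rewrite (rect_int_splitx xx1 x1x (le_trans yy1 y1y) hg').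
  rewrite (rect_int_splity xx1 yy1 y1y); last first.
    exact: gdiff_on_sub hg'.
  rewrite (rect_int_splity x1x yy1 y1y); last first.
    exact: gdiff_on_sub hg'.
  rewrite ex ey => hJ'.
  have e4 : eta / 4 ^+ k = (4 * (eta / 4 ^+ k.+1)).
    by rewrite exprS; field; rewrite expf_neq0.
  have ax1 := le_trans ax xx1; have cy1 := le_trans cy yy1.
  have x1b := le_trans x1x xb; have y1d := le_trans y1y yd.
  have xb' : x1 + s k.+1 <= b by rewrite -ex.
  have yd' : y1 + t k.+1 <= d by rewrite -ey.
  have xs : x + s k.+1 <= x1 + s k.+1 by rewrite -ex.
  have ys : y + t k.+1 <= y1 + t k.+1 by rewrite -ey.
  have [h1|h1] := leP (eta / 4 ^+ k.+1) (nc (rect_int g x x1 y y1)).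
    by exists (x, y) => _; split; [split| | | | ].
  have [h2|h2] := leP (eta / 4 ^+ k.+1) (nc (rect_int g x x1 y1 (y1 + t k.+1))).
    by exists (x, y1) => _; split; [split| | | | ].
  have [h3|h3] := leP (eta / 4 ^+ k.+1) (nc (rect_int g x1 (x1 + s k.+1) y y1)).
    by exists (x1, y) => _; split; [split| | | | ].
  have [h4|h4] := leP (eta / 4 ^+ k.+1) (nc (rect_int g x1 (x1 + s k.+1) y1 (y1 + t k.+1))).
    by exists (x1, y1) => _; split; [split| | | | ].
  exfalso; move: hJ'; apply/negP; rewrite -ltNge e4.
  apply: (le_lt_trans (ler_ncD _ _)).
  apply: (le_lt_trans (lerD (ler_ncD _ _) (ler_ncD _ _))).
  apply: (lt_le_trans (ltrD (ltrD h1 h2) (ltrD h3 h4))).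
  by move: (eta / _); clear => ?; lra.
(* The rectangles are recorded by their lower left corners. *)
have [f Hf] := choice step.
pose u := fix u (k : nat) : R * R := if k is k'.+1 then f (k', u k') else (a, c).
have Pu k : P k (u k).
  elim: k => [|k /(Hf (k, u k))[]//]; split=> //=;
    by rewrite /s /t /eta !expr0 !divr1 !(addrC a, addrC c) !subrK ?lexx.
have Qu k : [/\ (u k).1 <= (u k.+1).1, (u k.+1).1 + s k.+1 <= (u k).1 + s k,
   (u k).2 <= (u k.+1).2 & (u k.+1).2 + t k.+1 <= (u k).2 + t k].
  by have [] := Hf (k, u k) (Pu k).
have mono k j : (k <= j)%N -> [/\ (u k).1 <= (u j).1, (u j).1 + s j <= (u k).1 + s k,
   (u k).2 <= (u j).2 & (u j).2 + t j <= (u k).2 + t k].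
  move=> /subnK <-; elim: (j - k)%N => [|m [h1 h2 h3 h4]]; first by rewrite add0n.
  have [q1 q2 q3 q4] := Qu (m + k)%N; rewrite addSn; split.
  - exact: le_trans q1.
  - exact: le_trans h2.
  - exact: le_trans q3.
  - exact: le_trans h4.
have bnd k j : (u j).1 <= (u k).1 + s k /\ (u j).2 <= (u k).2 + t k.
  have [kj|/ltnW jk] := leqP k j.
    have [_ h2 _ h4] := mono _ _ kj; have := s0 j; have := t0 j; split; lra.
  have [h1 _ h3 _] := mono _ _ jk; have := s0 k; have := t0 k; split; lra.
pose X := [set (u k).1 | k in [set: nat]]; pose Y := [set (u k).2 | k in [set: nat]].
pose x := sup X; pose y := sup Y.
have ubX k : ubound X ((u k).1 + s k).
  by move=> _ [j _ <-]; case: (bnd k j).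
have ubY k : ubound Y ((u k).2 + t k).
  by move=> _ [j _ <-]; case: (bnd k j).
have hX : has_sup X by split; [exists (u 0).1, 0%N | exists ((u 0).1 + s 0)].
have hY : has_sup Y by split; [exists (u 0).2, 0%N | exists ((u 0).2 + t 0)].
have xu k : (u k).1 <= x <= (u k).1 + s k.
  apply/andP; split; first by apply: sup_upper_bound => //; exists k.
  by apply: sup_le_ub => //; case: hX.
have yu k : (u k).2 <= y <= (u k).2 + t k.
  apply/andP; split; first by apply: sup_upper_bound => //; exists k.
  by apply: sup_le_ub => //; case: hY.
have [kk Hk] : gdiff g x y.
  apply: hg; have [] := Pu 0%N => /= h1 h2 h3 h4 _.
    by have /andP[q1 q2] := xu 0%N; rewrite (le_trans h1 q1) (le_trans q2 h2).
  by have /andP[q1 q2] := yu 0%N; rewrite (le_trans h3 q1) (le_trans q2 h4).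
pose S := (b - a) + (d - c).
have S0 : 0 <= S by rewrite /S; lra.
(* With this [e] the bound of [rect_int_small] on the k-th rectangle is less
   than [eta / 4 ^ k]. *)
pose e := eta / (8 * (S ^+ 2 + 1)).
have S1 : 0 < S ^+ 2 + 1 by rewrite ltr_wpDl ?sqr_ge0.
have e0 : 0 < e by rewrite divr_gt0// mulr_gt0.
have [dl dl0 Hd] := Hk _ e0.
have [k hk] := expn2_gt (S / dl).
have hSk : S / 2 ^+ k < dl.
  by rewrite ltr_pdivrMr ?exprn_gt0//; move: hk; rewrite ltr_pdivrMr// mulrC.
have sS' : s k + t k = S / 2 ^+ k by rewrite /S mulrDl.
have [p1 p2 p3 p4 p5] := Pu k.
have sk := s0 k; have tk := t0 k.
have /andP[xu1 xu2] := xu k; have /andP[yu1 yu2] := yu k.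
have hsm x' y' : (u k).1 <= x' <= (u k).1 + s k -> (u k).2 <= y' <= (u k).2 + t k ->
    nc (g x' y' - g x y - kk * Complex (x' - x) (y' - y)) <=
      e * (`|x' - x| + `|y' - y|).
  move: hSk xu1 xu2 yu1 yu2 sk tk; rewrite -sS'; move: (s k) (t k) (u k) => sk tk uk.
  move=> h xu1 xu2 yu1 yu2 s0' t0' /andP[h1 h2] /andP[h3 h4].
  apply: Hd; clear -h xu1 xu2 yu1 yu2 s0' t0' h1 h2 h3 h4;
    by rewrite ltr_norml; apply/andP; split; lra.
have := rect_int_small (xu k) (yu k) (ltW e0) (gdiff_on_sub p1 p2 p3 p4 hg) hsm.
have -> : (u k).1 + s k - (u k).1 + ((u k).2 + t k - (u k).2) = S / 2 ^+ k.
  by rewrite -sS'; ring.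
apply/negP; rewrite -ltNge; apply: lt_le_trans p5.
have -> : (S / 2 ^+ k) ^+ 2 = S ^+ 2 / 4 ^+ k.
  by rewrite expr_div_n -exprM mulnC exprM (_ : 2 ^+ 2 = 4)//; rewrite expr2; ring.
rewrite mulrA ltr_pM2r ?invr_gt0 ?exprn_gt0// /e.
have -> : 4 * (eta / (8 * (S ^+ 2 + 1))) * S ^+ 2 = eta * (S ^+ 2 / (2 * (S ^+ 2 + 1))).
  by field; rewrite gt_eqF.
rewrite gtr_pMr// ltr_pdivrMr ?mulr_gt0// mul1r.
by have := sqr_ge0 S; clear; lra.
Qed.
End goursat.

(** * The mean value property on the unit circle *)
Section mean_value.
Variable R : realType.
Local Notation C := R[i].
Local Notation nc := (@Normc.normc R).
Local Notation pi := (@trigo.pi R).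

(** Differentiability of a function of one complex variable at [w]. *)
Definition cdiff1 (h : C -> C) (w : C) := exists c : C, forall e : R, 0 < e ->
  exists2 d : R, 0 < d & forall w', nc (w' - w) < d ->
    nc (h w' - h w - c * (w' - w)) <= e * nc (w' - w).

Lemma is_derive_epsP (f : R -> R) (x df : R) : is_derive (x : R^o) (1 : R^o) (f : R^o -> R^o) df ->
  forall e : R, 0 < e -> exists2 d : R, 0 < d & forall t, `|t| < d ->
    `|f (x + t) - f x - df * t| <= e * `|t|.
Proof.
move=> [hd <-] e e0; rewrite /derivable in hd.
have /cvgrPdist_le/(_ _ e0) := hd.
move=> /nbhs_ballP[d /= d0 H]; exists d => // t td.
have [->|t0] := eqVneq t 0.
  by rewrite mulr0 subr0 addr0 subrr normr0 mulr0.
have := H t; rewrite /ball/= sub0r normrN => /(_ td t0).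
rewrite -['D_1 f x]/(derive f x 1) /derive => {}H.
have tn0 : 0 < `|t| by rewrite normr_gt0.
rewrite -(ler_pM2r tn0) -normrM in H.
apply: le_trans H; rewrite -normrN le_eqVlt; apply/orP; left; apply/eqP.
congr (`|_|); rewrite mulrBl /= mulrAC mulVf// mul1r.
by rewrite [t%:A]mulr1 (addrC t); ring.
Qed.

Definition cexp (x y : R) : C := Complex (expR x * cos y) (expR x * sin y).

Lemma cexpD x y x' y' : cexp (x + x') (y + y') = cexp x y * cexp x' y'.
Proof.
by apply: complex_ext; rewrite !cReImE/= expRD (cosD, sinD); ring.
Qed.

Lemma nc_cexp x y : nc (cexp x y) = expR x.
Proof.
by rewrite ncE /= !exprMn -mulrDr cos2Dsin2 mulr1 sqrtr_sqr ger0_norm.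
Qed.

Lemma cexp_pi x : cexp x (2 * pi) = cexp x 0.
Proof.
by rewrite /cexp mulr_natl cos2pi sin2pi cos0 sin0.
Qed.

(** The first order expansion of the exponential at 0, from the derivatives of
    its real ingredients. *)
Lemma cexp_near0 e : 0 < e -> exists2 d : R, 0 < d & forall x y,
  `|x| < d -> `|y| < d ->
  nc (cexp x y - 1 - Complex x y) <= e * (`|x| + `|y|).
Proof.
move=> e0; have [e' [e'0 e'e e'1]] : exists e', [/\ 0 < e', e' <= e / 8 & e' <= 1].
  by exists (Num.min (e / 8) 1); rewrite lt_min ltr01 divr_gt0// !ge_min !lexx orbT.
have [d1 d10 H1] := is_derive_epsP (is_derive_expR 0) e'0.
have [d2 d20 H2] := is_derive_epsP (is_derive_cos 0) e'0.
have [d3 d30 H3] := is_derive_epsP (is_derive_sin 0) e'0.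
exists (Num.min (Num.min d1 e') (Num.min d2 d3)); first by rewrite !lt_min d10 d20 d30 e'0.
move=> x y; rewrite !lt_min => /andP[/andP[x1 xe] _] /andP[_ /andP[y2 y3]].
have := H1 _ x1; have := H2 _ y2; have := H3 _ y3.
rewrite !add0r expR0 cos0 sin0 oppr0 mul0r addr0 !subr0 !mul1r => h3 h2 h1.
apply: (le_trans (ler_nc_ReIm _)); rewrite !cReImE /= subr0.
set E := expR x in h1 *.
have E3 : `|E| <= 3.
  have -> : E = (E - 1 - x) + (x + 1) by ring.
  rewrite (le_trans (ler_normD _ _))//.
  have := ler_normD x 1; rewrite normr1.
  have : e' * `|x| <= 1 by rewrite -[leRHS]mulr1 ler_pM// ?(ltW e'0)// (le_trans (ltW xe)).
  by move: h1 xe; lra.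
have -> : E * cos y - 1 - x = E * (cos y - 1) + (E - 1 - x) by ring.
have -> : E * sin y - y = E * (sin y - y) + ((E - 1 - x) + x) * y by ring.
apply: (le_trans (lerD (ler_normD _ _) (ler_normD _ _))).
rewrite !normrM.
have h4 := ler_normD (E - 1 - x) x.
have q1 : `|E| * `|cos y - 1| <= 3 * (e' * `|y|) by rewrite ler_pM.
have q2 : `|E| * `|sin y - y| <= 3 * (e' * `|y|) by rewrite ler_pM.
have q3 : `|E - 1 - x + x| * `|y| <= (2 * e') * `|y|.
  rewrite ler_wpM2r// (le_trans h4)// mulr2n mulrDl mul1r lerD//.
    by rewrite (le_trans h1)// -[leRHS]mulr1 ler_pM// ?(ltW e'0)// (le_trans (ltW xe)).
  exact: ltW.
have q4 : e' * `|y| <= e / 8 * `|y| by rewrite ler_wpM2r.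
have q5 : e' * `|x| <= e / 8 * `|x| by rewrite ler_wpM2r.
have y0 := normr_ge0 y; have x0 := normr_ge0 x.
have xe0 : 0 <= e * `|x| by rewrite mulr_ge0// ltW.
have ye0 : 0 <= e * `|y| by rewrite mulr_ge0// ltW.
move: q1 q2 q3 q4 q5 h1 xe0 ye0; clear; lra.
Qed.

(** Composition with the exponential: in logarithmic coordinates circles
    become segments, so that a rectangle suffices where an annulus would be
    used. *)
Lemma gdiff_cexp h x y : cdiff1 h (cexp x y) -> gdiff (fun s t => h (cexp s t)) x y.
Proof.
move=> [c Hc]; set w := cexp x y; exists (c * w) => e e0.
have w0 := nc_ge0 w; have c0 := nc_ge0 c.
pose K := nc w * (nc c + 2) + 1.
have K0 : 0 < K by rewrite ltr_wpDl// mulr_ge0// addr_ge0.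
have [e' [e'0 e'1 e'K]] : exists e', [/\ 0 < e', e' <= 1 & e' * K <= e].
  exists (Num.min (e / K) 1); rewrite lt_min ltr01 divr_gt0// -ler_pdivlMr//.
  by rewrite !ge_min !lexx orbT.
have [d1 d10 H1] := Hc _ e'0; have [d2 d20 H2] := cexp_near0 e'0.
pose d3 := d1 / (4 * (nc w + 1)).
have d30 : 0 < d3 by rewrite divr_gt0// mulr_gt0// ltr_wpDl.
exists (Num.min d2 d3); first by rewrite lt_min d20.
move=> x' y'; rewrite !lt_min => /andP[x2 x3] /andP[y2 y3].
set dx := x' - x in x2 x3 *; set dy := y' - y in y2 y3 *.
have -> : cexp x' y' = w * cexp dx dy.
  by rewrite /w -cexpD /dx /dy ![_ + (_ - _)]addrC !subrK.
set E := cexp dx dy; set S := `|dx| + `|dy|.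
have S0 : 0 <= S by rewrite addr_ge0.
have h2 : nc (E - 1 - Complex dx dy) <= e' * S := H2 _ _ x2 y2.
have hE : nc (E - 1) <= 2 * S.
  have := ler_ncD (E - 1 - Complex dx dy) (Complex dx dy); rewrite subrK.
  move=> /le_trans; apply; rewrite mulr2n mulrDl mul1r lerD//.
    by rewrite (le_trans h2)// ler_piMl.
  exact: ler_nc_ReIm.
have hwE : nc (w * E - w) <= 2 * nc w * S.
  rewrite -[X in _ - X]mulr1 -mulrBr Normc.normcM (_ : _ * S = nc w * (2 * S)).
    by rewrite ler_wpM2l.
  by ring.
have hd : nc (w * E - w) < d1.
  apply: (le_lt_trans hwE).
  have : S < 2 * d3 by rewrite mulr2n mulrDl mul1r ltrD.
  rewrite /d3 => hS.
  have : 2 * nc w * S <= 2 * (nc w + 1) * S by rewrite ler_wpM2r// ler_wpM2l// lerDl.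
  move=> /le_lt_trans; apply.
  have w1 : 0 < 2 * (nc w + 1) by rewrite mulr_gt0// ltr_wpDl.
  rewrite mulrC -ltr_pdivlMr//; apply: (lt_le_trans hS).
  rewrite le_eqVlt; apply/orP; left; apply/eqP; field.
  by rewrite gt_eqF// ltr_wpDl.
have -> : h (w * E) - h w - c * w * Complex dx dy =
  (h (w * E) - h w - c * (w * E - w)) + c * w * (E - 1 - Complex dx dy) by ring.
apply: (le_trans (ler_ncD _ _)); rewrite 2!Normc.normcM.
apply: (le_trans (lerD (H1 _ hd) (ler_wpM2l (mulr_ge0 c0 w0) h2))).
apply: (@le_trans _ _ (e' * K * S)); last by rewrite ler_wpM2r.
apply: (le_trans (lerD (ler_wpM2l (ltW e'0) hwE) (lexx _))).
have -> : e' * (2 * nc w * S) + nc c * nc w * (e' * S) =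
  e' * (nc w * (nc c + 2)) * S by ring.
by rewrite ler_wpM2r// ler_wpM2l ?(ltW e'0)// /K lerDl.
Qed.

Definition cis (t : R) : C := Complex (cos t) (sin t).

Lemma cis_cexp t : cis t = cexp 0 t.
Proof. by rewrite /cis /cexp expR0 !mul1r. Qed.

Lemma nc_cis t : nc (cis t) = 1.
Proof. by rewrite cis_cexp nc_cexp expR0. Qed.

Lemma nc_eps_eq0 (z : C) (K : R) : (forall e : R, 0 < e -> nc z <= K * e) -> z = 0.
Proof.
move=> h; apply: Normc.eq0_normc; apply/eqP; rewrite eq_le nc_ge0 andbT.
apply/ler_addgt0Pl => e e0; rewrite addr0.
have [K0|K0] := leP K 0.
  by rewrite (le_trans (h 1 ltr01))// mulr1 (le_trans K0)// ltW.
have := h (e / K); rewrite divr_gt0// => /(_ isT).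
by rewrite mulrC divfK ?gt_eqF.
Qed.

(** In logarithmic coordinates [h] is periodic in the imaginary direction, so
    that Goursat's lemma on [[X, 0] x [0, 2 pi]] shows that the mean over the
    circle of radius [exp X] does not depend on [X <= 0]; let [X] tend to
    minus infinity. At the centre only continuity is assumed: this allows
    difference quotients as [h]. *)
Lemma mean_value_circle (h : C -> C) :
  (forall w, 0 < nc w <= 1 -> cdiff1 h w) ->
  (forall e : R, 0 < e -> exists2 d : R, 0 < d & forall w, nc w < d -> nc (h w - h 0) < e) ->
  cint 0 (2 * pi) (fun t => h (cis t)) = (2 * pi)%:C%C * h 0.
Proof.
move=> hd hc; have pi0 : 0 <= 2 * pi by rewrite mulr_ge0// pi_ge0.
pose g x y := h (cexp x y).
have gd x y : x <= 0 -> gdiff g x y.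
  move=> x0; apply: gdiff_cexp; apply: hd; rewrite nc_cexp expR_gt0/=.
  by rewrite -expR0 ler_expR.
have hX X : X <= 0 -> cint 0 (2 * pi) (g 0) = cint 0 (2 * pi) (g X).
  move=> X0; have gon : gdiff_on g X 0 0 (2 * pi).
    by move=> x y /andP[_ x0] _; exact: gd.
  have := goursat X0 pi0 gon; rewrite /rect_int.
  have -> : cint X 0 (fun x => g x (2 * pi) - g x 0) = 0.
    rewrite (@eq_cint _ _ _ _ (fun=> 0)) ?cint_cst ?mulr0// => x _.
    by rewrite /g cexp_pi subrr.
  rewrite subr0 => /eqP; rewrite mulf_eq0.
  have -> : ('i%C == 0 :> C) = false.
    by apply/negP => /eqP [] /eqP; rewrite oner_eq0.
  have c0 : ccont_on 0 (2 * pi) (g 0) by apply: gdiff_on_ccont2 gon _; rewrite lexx X0.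
  have cX : ccont_on 0 (2 * pi) (g X) by apply: gdiff_on_ccont2 gon _; rewrite lexx X0.
  rewrite /= (cintB c0 cX).
  by rewrite subr_eq0 => /eqP.
rewrite (eq_cint (h := g 0)); last by move=> t _; rewrite cis_cexp.
apply/eqP; rewrite -subr_eq0; apply/eqP; apply: (@nc_eps_eq0 _ (2 * (2 * pi))) => e e0.
have [d d0 H] := hc _ e0.
pose X := Num.min 0 (ln (d / 2)).
have X0 : X <= 0 by rewrite ge_min lexx.
have Xd : expR X < d.
  apply: (@le_lt_trans _ _ (d / 2)); last by rewrite ltr_pdivrMr// mulr_natr mulr2n ltrDl.
  by rewrite -[leRHS]lnK ?posrE ?divr_gt0// ler_expR ge_min lexx orbT.
have gX : ccont_on 0 (2 * pi) (g X).
  by move=> y _; apply: gdiff_ccont2; exact: gd.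
rewrite (hX _ X0) -[X in X%:C%C * h 0](subr0 (2 * pi)) -cint_cst//.
rewrite -cintB//; last by move=> ? _; exact: ccont_cst.
have := @ler_nc_cint _ 0 (2 * pi) (fun t => g X t - h 0) e pi0.
rewrite subr0 mulrAC; apply; first by move=> ? ?; apply: ccontB; [exact: gX|exact: ccont_cst].
by move=> t _; apply/ltW/H; rewrite nc_cexp.
Qed.
End mean_value.

(** * Hermitian geometry of the ball *)
(** The Euclidean norm. It is locked because unfolding it makes unification
    explore square roots of sesquilinear forms. *)
HB.lock Definition nrm (R : realType) (n : nat) (z : 'rV[R[i]]_n) : R :=
  Num.sqrt (sqnorm z).

(** The defining function [1 - |z|^2], comparable to the distance to the
    sphere. It is locked for the same reason as [nrm]. *)
HB.lock Definition delta (R : realType) (n : nat) (z : 'rV[R[i]]_n) : R :=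
  1 - sqnorm z.

Section hermitian.
Variables (R : realType) (n : nat).
Local Notation C := R[i].
Local Notation nc := (@Normc.normc R).
Implicit Types (z w u v a : 'rV[C]_n).

Lemma nrmE z : nrm z = Num.sqrt (sqnorm z). Proof. by rewrite nrm.unlock. Qed.

Lemma dotmxS z a : dotmx z a = \sum_k z 0 k * (a 0 k)^*%C.
Proof.
by rewrite dotmxE !mxE; apply: eq_bigr => k _; rewrite !mxE.
Qed.

Lemma Re_sum (I : Type) (r : seq I) (P : pred I) (F : I -> C) :
  complex.Re (\sum_(k <- r | P k) F k) = \sum_(k <- r | P k) complex.Re (F k).
Proof. by elim/big_rec2 : _ => // k x y _ <-; rewrite cReD. Qed.

Lemma Re_mulJ (x : C) : complex.Re (x * x^*%C) = nc x ^+ 2.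
Proof.
by case: x => x y; rewrite ncE /= sqr_sqrtr ?addr_ge0 ?sqr_ge0//; ring.
Qed.

Lemma sqnormE z : sqnorm z = \sum_k nc (z 0 k) ^+ 2.
Proof.
by rewrite /sqnorm dotmxS Re_sum; apply: eq_bigr => k _; rewrite Re_mulJ.
Qed.

Lemma sqnorm_ge0 z : 0 <= sqnorm z.
Proof. by rewrite sqnormE sumr_ge0// => k _; rewrite sqr_ge0. Qed.

Lemma nrm_ge0 z : 0 <= nrm z. Proof. by rewrite nrmE sqrtr_ge0. Qed.

Lemma sqr_nrm z : nrm z ^+ 2 = sqnorm z.
Proof. by rewrite nrmE sqr_sqrtr ?sqnorm_ge0. Qed.

Lemma dotmx_sqnorm z : dotmx z z = (sqnorm z)%:C%C.
Proof.
by rewrite /sqnorm RRe_real// ger0_real// dnorm_ge0.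
Qed.

Lemma dotmxDl z w a : dotmx (z + w) a = dotmx z a + dotmx w a.
Proof. by rewrite linearDl. Qed.
Lemma dotmxBl z w a : dotmx (z - w) a = dotmx z a - dotmx w a.
Proof. by rewrite linearBl. Qed.
Lemma dotmxZl (c : C) z a : dotmx (c *: z) a = c * dotmx z a.
Proof. by rewrite linearZl_LR. Qed.
Lemma dotmxDr z w a : dotmx a (z + w) = dotmx a z + dotmx a w.
Proof. by rewrite linearDr. Qed.
Lemma dotmxZr (c : C) z a : dotmx a (c *: z) = c^*%C * dotmx a z.
Proof. by rewrite linearZr_LR. Qed.
Lemma dotmxC z a : dotmx z a = (dotmx a z)^*%C.
Proof. by rewrite hermC/= expr0 mul1r. Qed.

Lemma nc_conj (x : C) : nc x^*%C = nc x.
Proof. by rewrite !ncE; case: x => x y /=; rewrite sqrrN. Qed.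

Lemma nc_dotmx z a : nc (dotmx z a) <= nrm z * nrm a.
Proof.
have := CauchySchwarz (@dotmx R[i] n) z a => /leifP H.
have {}H : `|dotmx z a| ^+ 2 <= dotmx z z * dotmx a a.
  by case: ifP H => _ => [/eqP->//|/ltW].
rewrite !dotmx_sqnorm -nc_norm -rmorphXn -rmorphM lecR in H.
rewrite !nrmE -sqrtrM ?sqnorm_ge0// -[leLHS]ger0_norm ?nc_ge0// -sqrtr_sqr.
by rewrite ler_sqrt// mulr_ge0 ?sqnorm_ge0.
Qed.

Lemma sqnormD z w : sqnorm (z + w) = sqnorm z + sqnorm w + 2 * complex.Re (dotmx w z).
Proof.
rewrite /sqnorm.
rewrite dotmxDl.
rewrite (dotmxDr z w z).
rewrite (dotmxDr z w w).
rewrite (dotmxC z w).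
have -> (p q r : C) : complex.Re (p + r^*%C + (r + q)) =
    complex.Re p + complex.Re q + 2 * complex.Re r.
  by case: p q r => [p1 p2] [q1 q2] [r1 r2] /=; ring.
by [].
Qed.

Lemma sqnormZ (c : C) z : sqnorm (c *: z) = nc c ^+ 2 * sqnorm z.
Proof.
rewrite !sqnormE mulr_sumr; apply: eq_bigr => k _.
by rewrite mxE Normc.normcM exprMn.
Qed.

Lemma sqnormD_ortho z w : dotmx w z = 0 -> sqnorm (z + w) = sqnorm z + sqnorm w.
Proof. by move=> h; rewrite sqnormD h mulr0 addr0. Qed.

Lemma nrmZ (c : C) z : nrm (c *: z) = nc c * nrm z.
Proof.
by rewrite !nrmE sqnormZ sqrtrM ?sqr_ge0// sqrtr_sqr ger0_norm ?nc_ge0.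
Qed.

Lemma nrmN z : nrm (- z) = nrm z.
Proof. by rewrite -scaleN1r nrmZ ncN Normc.normc1 mul1r. Qed.

Lemma nrm0 : nrm (0 : 'rV[C]_n) = 0.
Proof. by rewrite -(scale0r 0) nrmZ Normc.normc0 mul0r. Qed.

Lemma ler_nrmD z w : nrm (z + w) <= nrm z + nrm w.
Proof.
rewrite -(@ler_pXn2r _ 2) ?nnegrE ?addr_ge0 ?nrm_ge0// sqr_nrm.
have h : complex.Re (dotmx w z) <= nrm w * nrm z.
  by rewrite (le_trans _ (nc_dotmx w z))// (le_trans _ (ler_nc_Re _))// ler_norm.
rewrite sqnormD sqrrD -(sqr_nrm z) -(sqr_nrm w).
move: h; move: (complex.Re _) (nrm z) (nrm w) => A x y h; clear -h; lra.
Qed.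

Lemma ler_nrmB z w : nrm (z - w) <= nrm z + nrm w.
Proof. by rewrite -(nrmN w) ler_nrmD. Qed.

Lemma nrm_distC z w : nrm (z - w) = nrm (w - z).
Proof. by rewrite -nrmN opprB. Qed.

Lemma nc_coord z k : nc (z 0 k) <= nrm z.
Proof.
rewrite -(@ler_pXn2r _ 2) ?nnegrE ?nc_ge0 ?nrm_ge0// sqr_nrm.
rewrite sqnormE (bigD1 k)//= lerDl sumr_ge0// => j _; exact: sqr_ge0.
Qed.

Lemma nrm_le_coord z (M : R) : (forall k, nc (z 0 k) <= M) -> nrm z <= n%:R * M.
Proof.
move=> h; have [k0|n0] := pickP (fun _ : 'I_n => true); last first.
  have -> : z = 0 by apply/rowP => k; have := n0 k.
  rewrite nrm0 (_ : n%:R = 0) ?mul0r//.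
  by case: (n) n0 => // m /(_ ord0).
move=> _; have M0 : 0 <= M := le_trans (nc_ge0 _) (h k0).
have nM : 0 <= n%:R * M by rewrite mulr_ge0.
rewrite -(@ler_pXn2r _ 2) ?nnegrE ?nrm_ge0// sqr_nrm.
rewrite sqnormE; apply: (@le_trans _ _ (\sum_(k < n) M ^+ 2)).
  by apply: ler_sum => k _; rewrite ler_pXn2r ?nnegrE ?nc_ge0.
have -> : \sum_(k < n) M ^+ 2 = n%:R * M ^+ 2 by rewrite sumr_const card_ord mulr_natl.
rewrite exprMn ler_wpM2r ?sqr_ge0//.
rewrite -natrX ler_nat; case: (n) k0 => [[]//|m _].
by rewrite -[X in (X <= _)%N]expn1 leq_pexp2l.
Qed.

Lemma in_unit_ball z : unit_ball z <-> nrm z < 1.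
Proof.
rewrite /unit_ball/= -sqr_nrm; split => h.
  by rewrite -(@ltr_pXn2r _ 2) ?nnegrE ?nrm_ge0// expr1n.
by rewrite expr_lt1// nrm_ge0.
Qed.

Lemma deltaE z : delta z = 1 - sqnorm z. Proof. by rewrite delta.unlock. Qed.

Lemma delta_gt0 z : unit_ball z -> 0 < delta z.
Proof. by rewrite /unit_ball/= deltaE subr_gt0. Qed.

Lemma delta_gt0P z : 0 < delta z <-> unit_ball z.
Proof. by rewrite /unit_ball/= deltaE subr_gt0. Qed.

Lemma delta_le1 z : delta z <= 1.
Proof. by rewrite deltaE gerBl sqnorm_ge0. Qed.

(** [2 |1 - <z,a>| >= 2 (1 - |z|) >= 1 - |z|^2]. *)
Lemma nc_1sub_ge z a : unit_ball z -> unit_ball a ->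
  delta z / 2 <= nc (1 - dotmx z a).
Proof.
move=> /in_unit_ball z1 /in_unit_ball a1.
have h1 : nc (dotmx z a) <= nrm z.
  by apply: (le_trans (nc_dotmx z a)); apply: ler_piMr (nrm_ge0 z) (ltW a1).
have := ler_ncD (1 - dotmx z a) (dotmx z a); rewrite subrK Normc.normc1 => h2.
rewrite deltaE -sqr_nrm; move: h1 h2 z1 (nrm_ge0 z); clear.
by move: (nc (dotmx z a)) (nc (1 - _)) (nrm z) => k m x; nra.
Qed.

Lemma nc_1sub_gt0 z a : unit_ball z -> unit_ball a -> 0 < nc (1 - dotmx z a).
Proof.
move=> hz ha; apply: lt_le_trans (nc_1sub_ge hz ha).
by rewrite divr_gt0// delta_gt0.
Qed.

Lemma nc_1subC z a : nc (1 - dotmx z a) = nc (1 - dotmx a z).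
Proof. by rewrite dotmxC -[in RHS]nc_conj rmorphB rmorph1. Qed.

Lemma delta_lip z w : nrm z <= 1 -> nrm w <= 1 -> delta z <= delta w + 2 * nrm (z - w).
Proof.
move=> z1 w1; rewrite !deltaE -!sqr_nrm.
have h : nrm w <= nrm z + nrm (z - w).
  by have := ler_nrmB z (z - w); rewrite subKr.
move: h z1 w1 (nrm_ge0 z) (nrm_ge0 w) (nrm_ge0 (z - w)); clear.
by move: (nrm z) (nrm w) (nrm (z - w)) => x y d; nra.
Qed.

Lemma sqnorm_ball_le1 z : unit_ball z -> nrm z <= 1.
Proof. by move=> /in_unit_ball/ltW. Qed.

(** Split [z] into its component along [a] and an orthogonal one: both sides
    become polynomials in the coordinates of this decomposition. *)
Lemma Phi_identity a z : unit_ball a -> unit_ball z ->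
  1 - sqnorm (Phi a z) = delta a * delta z / nc (1 - dotmx z a) ^+ 2.
Proof.
move=> ha hz; set D := 1 - dotmx z a.
have D0 : 0 < nc D by exact: nc_1sub_gt0.
rewrite /Phi; set P := z *m proj_ortho a; set Q := z - P.
set s := Num.sqrt (1 - sqnorm a).
have [c Pc] : exists c, P = c *: a.
  by have /sub_rVP := proj_ortho_sub a z.
have QA : dotmx Q a = 0.
  have := proj_ortho_compl_sub a z; rewrite -/P -/Q => /orthomx1P h.
  by rewrite dotmxE h mxE.
have aQ : dotmx a Q = 0 by rewrite dotmxC QA rmorph0.
have zE : z = c *: a + Q by rewrite /Q Pc addrC subrK.
have s2 : s ^+ 2 = delta a by rewrite /s sqr_sqrtr ?deltaE// -deltaE ltW// delta_gt0.
have sqz : sqnorm z = nc c ^+ 2 * sqnorm a + sqnorm Q.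
  have QcA : dotmx Q (c *: a) = 0 by rewrite dotmxZr QA mulr0.
  by rewrite {1}zE (sqnormD_ortho QcA) sqnormZ.
have DE : D = 1 - c * (sqnorm a)%:C%C.
  by rewrite /D zE dotmxDl dotmxZl QA addr0 dotmx_sqnorm.
rewrite -/s sqnormZ Normc.normcV.
have -> : sqnorm (a - P - (s%:C)%C *: Q) = nc (1 - c) ^+ 2 * sqnorm a + delta a * sqnorm Q.
  have -> : a - P - (s%:C)%C *: Q = (1 - c) *: a + (- s%:C%C) *: Q.
    by rewrite Pc scalerBl scale1r scaleNr.
  rewrite sqnormD_ortho; last by rewrite dotmxZl dotmxZr QA !mulr0.
  by rewrite !sqnormZ ncN nc_real real_normK ?num_real// s2.
have nz : nc D ^+ 2 != 0 by rewrite expf_neq0// gt_eqF.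
rewrite !deltaE sqz.
have nD : nc D ^+ 2 = 1 - 2 * complex.Re c * sqnorm a + nc c ^+ 2 * sqnorm a ^+ 2.
  rewrite DE; case: (c) => x y; rewrite !ncE /= !sqr_sqrtr ?addr_ge0 ?sqr_ge0//; ring.
have n1c : nc (1 - c) ^+ 2 = 1 - 2 * complex.Re c + nc c ^+ 2.
  by case: (c) => x y; rewrite !ncE /= !sqr_sqrtr ?addr_ge0 ?sqr_ge0//; ring.
rewrite exprVn; apply: (mulIf nz); rewrite mulrBl mul1r mulrAC mulVf// mul1r divfK//.
rewrite nD n1c; move: (sqnorm a) (sqnorm Q) (nc c) (complex.Re c); clear.
by move=> A B x y; ring.
Qed.
End hermitian.

(** * Complex differentiability in coordinates *)
Section hdiff.
Variables (R : realType) (n : nat).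
Local Notation C := R[i].
Local Notation nc := (@Normc.normc R).
Implicit Types (z w u v h g : 'rV[C]_n) (f : 'rV[C]_n -> C).

Definition lin g h : C := \sum_k g 0 k * h 0 k.

Lemma linD g h h' : lin g (h + h') = lin g h + lin g h'.
Proof.
by rewrite /lin -big_split; apply: eq_bigr => k _; rewrite mxE mulrDr.
Qed.

Lemma linZ g (c : C) h : lin g (c *: h) = c * lin g h.
Proof.
by rewrite /lin mulr_sumr; apply: eq_bigr => k _; rewrite mxE mulrCA.
Qed.

Lemma nc_lin g h (M : R) : (forall k, nc (g 0 k) <= M) ->
  nc (lin g h) <= n%:R * M * nrm h.
Proof.
move=> gM; apply: (@le_trans _ _ (\sum_(k < n) M * nrm h)).
  rewrite /lin; elim/big_ind2 : _ => [|x x' y y' hx hy|k _].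
  - by rewrite Normc.normc0.
  - exact: le_trans (ler_ncD _ _) (lerD hx hy).
  - by rewrite Normc.normcM ler_pM ?nc_ge0 ?nc_coord.
by rewrite sumr_const card_ord -mulrA mulr_natl.
Qed.

Definition has_grad f z g := forall e : R, 0 < e ->
  exists2 d : R, 0 < d & forall h, nrm h < d ->
    nc (f (z + h) - f z - lin g h) <= e * nrm h.

Lemma mxnorm_coord (h : 'rV[C]_n) k : `|h 0 k| <= `|h|.
Proof.
rewrite [leRHS]mx_normE -[leLHS]nngE num_le.
exact: (le_bigmax _ (fun i : 'I_1 * 'I_n => `|h i.1 i.2|%:nng) (0, k)).
Qed.

Lemma mxnorm_le_nrm (h : 'rV[C]_n) : `|h| <= (nrm h)%:C%C.
Proof.
have [h0|h0] := eqVneq (mx_norm h) 0.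
  by rewrite (_ : `|h| = mx_norm h)// h0 ler0c nrm_ge0.
have [[i j] /= e] := mx_norm_neq0 h0.
rewrite (_ : `|h| = mx_norm h)// e -nc_norm lecR.
by rewrite (ord1 i) nc_coord.
Qed.

Lemma nrm_le_mxnorm (h : 'rV[C]_n) : (nrm h)%:C%C <= n%:R * `|h|.
Proof.
have h0 : 0 <= `|h| by exact: normr_ge0.
have -> : `|h| = (complex.Re `|h|)%:C%C by rewrite RRe_real// ger0_real.
rewrite -(rmorph_nat (real_complex R)) -rmorphM lecR.
apply: nrm_le_coord => k.
rewrite -lecR nc_norm RRe_real ?ger0_real//; exact: mxnorm_coord.
Qed.

(** The topology of row vectors comes from the maximum norm; this compares it
    with the Euclidean balls used in all estimates. *)
Lemma nbhs0P (P : set 'rV[C]_n) : nbhs (0 : ('rV[C]_n : normedModType C)) P <->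
  exists2 d : R, 0 < d & forall h, nrm h < d -> P h.
Proof.
split.
  move=> /nbhs_ballP[d /= d0 Hd].
  have dr : d = (complex.Re d)%:C%C by rewrite RRe_real ?gtr0_real.
  exists (complex.Re d); first by rewrite -ltcR -dr.
  move=> h hd; apply: Hd; rewrite -ball_normE /ball_ /= sub0r normrN.
  by rewrite (le_lt_trans (mxnorm_le_nrm _))// dr ltcR.
move=> [d d0 Hd]; apply/nbhs_ballP; exists ((d / n.+1%:R)%:C%C).
  by rewrite /= ltcR divr_gt0.
move=> h; rewrite -ball_normE /ball_ /= sub0r normrN => hd; apply: Hd.
rewrite -ltcR; apply: (le_lt_trans (nrm_le_mxnorm _)).
apply: (@le_lt_trans _ _ (n.+1%:R * `|h|)); first by rewrite ler_wpM2r// ler_nat.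
have {hd} := hd; rewrite rmorphM /= fmorphV rmorph_nat ltr_pdivlMr ?ltr0Sn//.
by rewrite mulrC.
Qed.

(** The passage between the differential as a continuous linear map and the
    gradient vector, which makes all later estimates elementary. *)
Lemma has_gradP f z : (exists g, has_grad f z g) <->
  differentiable (f : ('rV[C]_n : normedModType C) -> C^o) (z : ('rV[C]_n : normedModType C)).
Proof.
have cE (e : C) : 0 < e -> e = (complex.Re e)%:C%C /\ 0 < complex.Re e.
  move=> e0; have er : e = (complex.Re e)%:C%C by rewrite RRe_real ?gtr0_real.
  by split=> //; rewrite -ltcR -er.
split.
  move=> [g Hg].
  have Hl : linear (lin g : 'rV[C]_n -> C^o).
    by move=> c x y; rewrite linD linZ.
  pose df : {linear 'rV[C]_n -> C^o} := HB.pack (lin g : 'rV[C]_n -> C^o)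
    (GRing.isLinear.Build _ _ _ _ (lin g : 'rV[C]_n -> C^o) Hl).
  pose M := \sum_(k < n) nc (g 0 k).
  have gM k : nc (g 0 k) <= M.
    by rewrite /M (bigD1 k)//= lerDl sumr_ge0// => j _; exact: nc_ge0.
  have M0 : 0 <= M by rewrite sumr_ge0// => j _; exact: nc_ge0.
  have cdf : continuous (df : ('rV[C]_n : normedModType C) -> C^o).
    apply/(@linear_bounded_continuous C ('rV[C]_n) C^o df)/ex_bound.
    exists (n%:R * M)%:C%C; apply/nbhs0P; exists 1 => // h hh.
    rewrite /= -[`|_|]nc_norm lecR (le_trans (nc_lin h gM))// ler_piMr ?mulr_ge0//.
    exact: ltW.
  have E : (f : ('rV[C]_n : normedModType C) -> C^o) \o shift z =
      cst (f z : C^o) + (df : _ -> _) +o_ (0 : ('rV[C]_n : normedModType C)) id.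
    apply/eqaddoP => e /cE[er re0].
    have [d d0 Hd] := Hg _ (divr_gt0 re0 (ltr0Sn _ n)).
    rewrite -nbhs_nearE nbhs_simpl /=; apply/nbhs0P; exists d => // h hd.
    change (`|f (h + z) - (f z + lin g h)| <= e * `|h|).
    rewrite (addrC h z) opprD addrA -nc_norm er.
    apply: (@le_trans _ _ ((complex.Re e / n.+1%:R * nrm h)%:C%C)); first by rewrite lecR Hd.
    rewrite rmorphM rmorphM /= -mulrA ler_wpM2l ?ler0c ?(ltW re0)//.
    rewrite fmorphV rmorph_nat ler_pdivrMl ?ltr0Sn//.
    by rewrite (le_trans (nrm_le_mxnorm _))// ler_wpM2r// ler_nat.
  apply/diff_locallyP; rewrite (diff_unique cdf E); split => //.
move=> /diff_locallyP[_ /eqaddoP H].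
pose df := 'd (f : ('rV[C]_n : normedModType C) -> C^o) (z : ('rV[C]_n : normedModType C)).
exists (\row_k df (delta_mx 0 k)) => e e0.
have dfE h : df h = lin (\row_k df (delta_mx 0 k)) h.
  rewrite {1}(row_sum_delta h) linear_sum /lin; apply: eq_bigr => k _.
  by rewrite linearZ mxE /= mulrC.
have e0' : 0 < e%:C%C by rewrite ltcR.
have := H _ e0'; rewrite -nbhs_nearE nbhs_simpl /= => /nbhs0P[d d0 Hd].
exists d => // h /Hd.
change (`|f (h + z) - (f z + df h)| <= e%:C%C * `|h| ->
  nc (f (z + h) - f z - lin (\row_k df (delta_mx 0 k)) h) <= e * nrm h).
rewrite -dfE (addrC h z) opprD addrA -nc_norm => /le_trans.
rewrite -lecR; apply; rewrite rmorphM/= ler_wpM2l ?ler0c ?(ltW e0)//.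
exact: mxnorm_le_nrm.
Qed.
End hdiff.

Section cdiff1_rules.
Variable R : realType.
Local Notation C := R[i].
Local Notation nc := (@Normc.normc R).

Lemma cdiff1_local (h k : C -> C) w (r : R) : 0 < r ->
  (forall w', nc (w' - w) < r -> h w' = k w') -> cdiff1 k w -> cdiff1 h w.
Proof.
move=> r0 hk [c Hc]; exists c => e e0; have [d d0 H] := Hc _ e0.
exists (Num.min d r); first by rewrite lt_min d0.
move=> w'; rewrite lt_min => /andP[wd wr].
by rewrite (hk _ wr) (hk w) ?subrr ?Normc.normc0//; exact: H.
Qed.

Lemma cdiff1_cont (h : C -> C) w : cdiff1 h w -> exists2 K : R, 0 < K &
  exists2 d : R, 0 < d & forall w', nc (w' - w) < d -> nc (h w' - h w) <= K * nc (w' - w).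
Proof.
move=> [c /(_ _ ltr01)[d d0 H]]; exists (nc c + 1); first by rewrite ltr_wpDl ?nc_ge0.
exists d => // w' /H h1.
have := ler_ncD (h w' - h w - c * (w' - w)) (c * (w' - w)); rewrite subrK.
move=> /le_trans; apply; rewrite Normc.normcM mulrDl addrC lerD2l; exact: h1.
Qed.

(** The product rule, proved directly from the definition; with [cdiff1V] it
    makes difference quotients differentiable away from the base point. *)
Lemma cdiff1M (h k : C -> C) w : cdiff1 h w -> cdiff1 k w ->
  cdiff1 (fun z => h z * k z) w.
Proof.
move=> hh hk; have [K1 K10 [d1 d10 H1]] := cdiff1_cont hk.
move: hh hk => [c Hc] [l Hl]; exists (c * k w + h w * l) => e e0.
have c0 := nc_ge0 c; have k0 := nc_ge0 (k w); have h0 := nc_ge0 (h w).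
pose M := nc (k w) + K1 + nc (h w) + nc c * K1 + 1.
have M0 : 0 < M.
  by rewrite /M ltr_wpDl// !addr_ge0// ?(ltW K10)// mulr_ge0// ltW.
have [e' [e'0 e'M]] : exists e', 0 < e' /\ e' * M <= e.
  by exists (e / M); rewrite divr_gt0// divfK ?gt_eqF.
have [d2 d20 H2] := Hc _ e'0; have [d3 d30 H3] := Hl _ e'0.
have [m [m0 m1 me]] : exists m : R, [/\ 0 < m, m <= 1 & m <= e'].
  by exists (Num.min 1 e'); rewrite lt_min ltr01 e'0 !ge_min !lexx orbT.
have [d [d0 dd1 dd2 dd3 dm]] : exists d : R, [/\ 0 < d, d <= d1, d <= d2, d <= d3 &
    d <= m].
  exists (Num.min (Num.min d1 d2) (Num.min d3 m)).
  by split; rewrite ?lt_min ?d10 ?d20 ?d30 ?m0// !ge_min lexx ?orbT.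
exists d => // w' wd; set t := nc (w' - w).
have t0 : 0 <= t by exact: nc_ge0.
have td : t < d by [].
have t1 : t <= 1 by rewrite (le_trans (ltW td))// (le_trans dm).
have te : t <= e' by rewrite (le_trans (ltW td))// (le_trans dm).
have q1 := H1 _ (lt_le_trans wd dd1).
have q2 := H2 _ (lt_le_trans wd dd2).
have q3 := H3 _ (lt_le_trans wd dd3).
have -> : h w' * k w' - h w * k w - (c * k w + h w * l) * (w' - w) =
  (h w' - h w - c * (w' - w)) * (k w + (k w' - k w)) +
  (c * (w' - w) * (k w' - k w) + h w * (k w' - k w - l * (w' - w))) by ring.
apply: (le_trans (ler_ncD _ _)); rewrite Normc.normcM.
apply: (le_trans (lerD (lexx _) (ler_ncD _ _))); rewrite !Normc.normcM -/t.
have q4 : nc (k w + (k w' - k w)) <= nc (k w) + K1.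
  apply: (le_trans (ler_ncD _ _)); rewrite lerD2l (le_trans q1)// ler_piMr// ltW//.
have q5 : nc c * t * nc (k w' - k w) <= (nc c * K1) * (e' * t).
  apply: (@le_trans _ _ (nc c * t * (K1 * t))).
    by rewrite ler_wpM2l// mulr_ge0.
  rewrite [leLHS](_ : _ = nc c * K1 * (t * t)); last by ring.
  by rewrite ler_wpM2l ?mulr_ge0 ?(ltW K10)// ler_wpM2r.
have q6 : nc (h w) * nc (k w' - k w - l * (w' - w)) <= nc (h w) * (e' * t).
  by rewrite ler_wpM2l.
have q7 : nc (h w' - h w - c * (w' - w)) * nc (k w + (k w' - k w)) <=
    (e' * t) * (nc (k w) + K1) by rewrite ler_pM ?nc_ge0.
apply: (le_trans (lerD q7 (lerD q5 q6))).
apply: (@le_trans _ _ (e' * M * t)); last by rewrite ler_wpM2r.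
rewrite /M; have e't : 0 <= e' * t by rewrite mulr_ge0// ltW.
move: e't; clear; move: (nc (k w)) (nc (h w)) (nc c) => x y z e't.
rewrite [leRHS](_ : _ = e' * t * (x + K1) + (z * K1 * (e' * t) + y * (e' * t)) + e' * t).
  by rewrite lerDl.
by ring.
Qed.

Lemma cdiff1V (w : C) : w != 0 -> cdiff1 (fun z => z^-1) w.
Proof.
move=> w0; have nw : 0 < nc w.
  rewrite lt_neqAle nc_ge0 andbT eq_sym; apply: contra w0 => /eqP/Normc.eq0_normc->//.
exists (- w^-1 ^+ 2) => e e0.
have P3 : 0 < nc w ^+ 3 by rewrite exprn_gt0.
exists (Num.min (nc w / 2) (e * nc w ^+ 3 / 2)).
  by rewrite lt_min !divr_gt0// mulr_gt0.
move=> w'; rewrite lt_min; set t := nc (w' - w) => /andP[t1 t2].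
have h1 : nc w / 2 <= nc w'.
  have := ler_ncD w' (w - w'); rewrite subrKC -(ncN (w - w')) opprB -/t.
  by move: t1; clear; move: (nc w) (nc w') t => x y t; lra.
have nw' : 0 < nc w' by rewrite (lt_le_trans _ h1)// divr_gt0.
have w'0 : w' != 0 by apply: contraTneq nw' => ->; rewrite Normc.normc0 ltxx.
have -> : w'^-1 - w^-1 - - w^-1 ^+ 2 * (w' - w) = (w' - w) * (w' - w) / (w ^+ 2 * w').
  by field; rewrite w0 w'0.
rewrite !Normc.normcM Normc.normcV !Normc.normcM -/t -mulrA.
rewrite [leRHS]mulrC ler_wpM2l ?nc_ge0// ler_pdivrMr ?mulr_gt0//.
apply: (le_trans (ltW t2)); rewrite -mulrA ler_wpM2l ?(ltW e0)//.
by rewrite exprSr -mulrA expr2 -!mulrA !ler_wpM2l ?(ltW nw).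
Qed.
End cdiff1_rules.

(** * Mean values and Cauchy estimates on complex lines *)
Section several_variables.
Variables (R : realType) (n : nat).
Local Notation C := R[i].
Local Notation nc := (@Normc.normc R).
Local Notation pi := (@trigo.pi R).
Implicit Types (z w u v h g : 'rV[C]_n) (f : 'rV[C]_n -> C).

Lemma has_grad_lip f z g : has_grad f z g -> exists2 K : R, 0 < K &
  exists2 d : R, 0 < d & forall h, nrm h < d -> nc (f (z + h) - f z) <= K * nrm h.
Proof.
move=> /(_ _ ltr01)[d d0 H].
pose M := \sum_(k < n) nc (g 0 k).
have gM k : nc (g 0 k) <= M.
  by rewrite /M (bigD1 k)//= lerDl sumr_ge0// => j _; exact: nc_ge0.
have M0 : 0 <= M by rewrite sumr_ge0// => j _; exact: nc_ge0.
exists (1 + n%:R * M); first by rewrite ltr_pwDl// mulr_ge0.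
exists d => // h /H h1.
have := ler_ncD (f (z + h) - f z - lin g h) (lin g h); rewrite subrK.
move=> /le_trans; apply; rewrite mulrDl lerD//; exact: nc_lin.
Qed.

Definition fcont f z := forall e : R, 0 < e ->
  exists2 d : R, 0 < d & forall h, nrm h < d -> nc (f (z + h) - f z) < e.

Lemma has_grad_cont f z g : has_grad f z g -> fcont f z.
Proof.
move=> /has_grad_lip[K K0 [d d0 H]] e e0.
exists (Num.min d (e / K)); first by rewrite lt_min d0 divr_gt0.
move=> h; rewrite lt_min ltr_pdivlMr// => /andP[/H h1 h2].
by rewrite (le_lt_trans h1)// mulrC.
Qed.

Lemma lin_delta g k : lin g (delta_mx 0 k) = g 0 k.
Proof.
rewrite /lin (bigD1 k)//= big1 ?addr0; last first.
  by move=> j jk; rewrite mxE (negPf jk) andbF mulr0.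
by rewrite mxE !eqxx mulr1.
Qed.

Lemma linBl g g' h : lin (g - g') h = lin g h - lin g' h.
Proof.
by rewrite /lin -sumrB; apply: eq_bigr => k _; rewrite !mxE mulrBl.
Qed.

Lemma linZl (c : C) g h : lin (c *: g) h = c * lin g h.
Proof.
by rewrite /lin mulr_sumr; apply: eq_bigr => k _; rewrite !mxE mulrA.
Qed.

(** Evaluate both expansions on small multiples of a basis vector. *)
Lemma has_grad_unique f z g g' : has_grad f z g -> has_grad f z g' -> g = g'.
Proof.
move=> H H'; apply/rowP => k; apply/eqP; rewrite -subr_eq0; apply/eqP.
pose N := nrm (delta_mx 0 k : 'rV[C]_n).
have N0 : 0 <= N by exact: nrm_ge0.
apply: (@nc_eps_eq0 _ _ (2 * N)) => e e0.
have [d d0 Hd] := H _ e0; have [d' d'0 Hd'] := H' _ e0.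
pose m := Num.min d d'; have m0 : 0 < m by rewrite lt_min d0.
(* Short enough for both expansions to hold. *)
pose t := m / (N + 1); have t0 : 0 < t by rewrite divr_gt0// ltr_wpDl.
pose x : 'rV[C]_n := t%:C%C *: delta_mx 0 k.
have nx : nrm x = t * N by rewrite nrmZ nc_real gtr0_norm.
have xm : nrm x < m.
  rewrite nx /t -mulrA gtr_pMr// mulrC ltr_pdivrMr ?ltr_wpDl// mul1r.
  by rewrite ltrDl.
have xd : nrm x < d by rewrite (lt_le_trans xm)// ge_min lexx.
have xd' : nrm x < d' by rewrite (lt_le_trans xm)// ge_min lexx orbT.
have h1 := Hd _ xd; have h2 := Hd' _ xd'.
have : nc (lin (g - g') x) <= 2 * (e * nrm x).
  have -> : lin (g - g') x = (f (z + x) - f z - lin g' x) - (f (z + x) - f z - lin g x).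
    by rewrite linBl; ring.
  by rewrite (le_trans (ler_ncB _ _))// mulr2n mulrDl mul1r lerD.
rewrite linZ lin_delta Normc.normcM nc_real gtr0_norm// nx !mxE.
have -> : 2 * (e * (t * N)) = t * (2 * N * e) by ring.
by rewrite ler_pM2l.
Qed.

(** Chosen among all gradients; the default 0 is only taken where [f] is not
    differentiable. *)
Definition grad f z := xget 0 [set g | has_grad f z g].

Lemma gradP f z : (exists g, has_grad f z g) -> has_grad f z (grad f z).
Proof. by move=> [g Hg]; rewrite /grad; case: xgetP => [//|/(_ g)]. Qed.

Lemma gradE f z g : has_grad f z g -> grad f z = g.
Proof. by move=> H; apply: (has_grad_unique (gradP (ex_intro _ g H)) H). Qed.

Definition holo f := forall z, unit_ball z -> exists g, has_grad f z g.

Lemma holoP f : holomorphic_on_ball f <-> holo f.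
Proof. by split=> H z /H; rewrite has_gradP. Qed.

Lemma ccont_line f u v (phi : R -> C) t : fcont f (u + phi t *: v) ->
  ccont phi t -> ccont (fun t => f (u + phi t *: v)) t.
Proof.
move=> H /ccontP hphi; apply/ccontP => e /H[d d0 Hd].
have [d' d'0 Hd'] := hphi (d / (nrm v + 1)) (divr_gt0 d0 (ltr_wpDl (nrm_ge0 v) ltr01)).
exists d' => // t' /Hd' h.
have -> : u + phi t' *: v = (u + phi t *: v) + (phi t' - phi t) *: v.
  by rewrite -addrA -scalerDl subrKC.
apply: Hd; rewrite nrmZ.
have v0 := nrm_ge0 v; move: h; rewrite ltr_pdivlMr ?ltr_wpDl//.
by apply: le_lt_trans; rewrite ler_wpM2l ?nc_ge0// lerDl.
Qed.

Lemma holo_cont f z : holo f -> unit_ball z -> fcont f z.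
Proof. by move=> hf /hf[g]; exact: has_grad_cont. Qed.

Lemma has_grad_line f u v (c : C) g : has_grad f (u + c *: v) g ->
  forall e : R, 0 < e -> exists2 d : R, 0 < d & forall c', nc (c' - c) < d ->
    nc (f (u + c' *: v) - f (u + c *: v) - lin g v * (c' - c)) <= e * nc (c' - c).
Proof.
move=> Hg e e0.
have v1 : 0 < nrm v + 1 by rewrite ltr_wpDl ?nrm_ge0.
have [d d0 H] := Hg _ (divr_gt0 e0 v1).
exists (d / (nrm v + 1)); first by rewrite divr_gt0.
move=> w'; rewrite ltr_pdivlMr// => h.
have -> : u + w' *: v = (u + c *: v) + (w' - c) *: v.
  by rewrite -addrA -scalerDl subrKC.
have vv : nrm v <= nrm v + 1 by rewrite lerDl.
have n1 : nrm ((w' - c) *: v) <= nc (w' - c) * (nrm v + 1).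
  by rewrite nrmZ ler_wpM2l ?nc_ge0.
have := H _ (le_lt_trans n1 h); rewrite linZ mulrC => /le_trans; apply.
by rewrite mulrAC ler_pdivrMr// -mulrA ler_pM2l.
Qed.

Lemma cdiff1_line f u v (c : C) : (exists g, has_grad f (u + c *: v) g) ->
  cdiff1 (fun x => f (u + x *: v)) c.
Proof. by move=> [g /has_grad_line H]; exists (lin g v). Qed.

Lemma ccont_cis t : ccont (@cis R) t.
Proof. by split => /=; [exact: continuous_cos|exact: continuous_sin]. Qed.

Lemma ccont_cisN t : ccont (fun t => @cis R (- t)) t.
Proof.
split => /=.
  have -> : (fun s : R => cos (- s)) = cos by apply/funext => s; rewrite cosN.
  exact: continuous_cos.
have -> : (fun s : R => sin (- s)) = (fun s => - sin s).
  by apply/funext => s; rewrite sinN.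
by apply: continuousN; exact: continuous_sin.
Qed.

Lemma cisNM t : @cis R t * cis (- t) = 1.
Proof.
by rewrite !cis_cexp -cexpD addr0 subrr /cexp expR0 cos0 sin0 mulr0 mulr1.
Qed.

Definition disc_in_ball u v := forall c : C, nc c <= 1 -> unit_ball (u + c *: v).

(** The mean value property of [f] restricted to the complex line through [u]
    in the direction [v]. *)
Lemma mean_value_line f u v : holo f -> disc_in_ball u v ->
  cint 0 (2 * pi) (fun t => f (u + cis t *: v)) = (2 * pi)%:C%C * f u.
Proof.
move=> hf huv.
have h (w : C) : nc w <= 1 -> cdiff1 (fun x => f (u + x *: v)) w.
  by move=> w1; apply: cdiff1_line; apply/hf/huv.
rewrite (@mean_value_circle _ (fun x => f (u + x *: v))).
- by rewrite scale0r addr0.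
- by move=> w /andP[_ /h].
- move=> e e0; have [|K K0 [d d0 H]] := cdiff1_cont (h 0 _).
    by rewrite Normc.normc0.
  exists (Num.min d (e / K)); first by rewrite lt_min d0 divr_gt0.
  move=> w; rewrite lt_min ltr_pdivlMr// => /andP[wd we].
  have := H w; rewrite subr0 => /(_ wd) /le_lt_trans; apply.
  by rewrite mulrC.
Qed.

(** The mean value property of the difference quotient [(f (u + w v) - f u) /
    w], whose value at [w = 0] is the derivative; on the circle [1 / w] is the
    conjugate of [w]. *)
Lemma cauchy_derivative f u v : holo f -> disc_in_ball u v ->
  cint 0 (2 * pi) (fun t => (f (u + cis t *: v) - f u) * cis (- t)) =
  (2 * pi)%:C%C * lin (grad f u) v.
Proof.
move=> hf huv.
have h (w : C) : nc w <= 1 -> cdiff1 (fun x => f (u + x *: v)) w.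
  by move=> w1; apply: cdiff1_line; apply/hf/huv.
(* The difference quotient, completed by continuity. *)
pose k (w : C) := if w == 0 then lin (grad f u) v else (f (u + w *: v) - f u) * w^-1.
have k0 : k 0 = lin (grad f u) v by rewrite /k eqxx.
rewrite -k0 -(@mean_value_circle _ k).
- apply: eq_cint => t _; rewrite /k.
  have cn0 : cis t != 0 :> C.
    apply/negP => /eqP c0; have := nc_cis t; rewrite c0 Normc.normc0 => /eqP.
    by rewrite eq_sym oner_eq0.
  by rewrite (negPf cn0) -[cis (- t)](mulKf cn0) cisNM mulr1.
- move=> w /andP[w0 w1].
  have wn0 : w != 0 by apply: contraTneq w0 => ->; rewrite Normc.normc0 ltxx.
  apply: (@cdiff1_local _ _ (fun x => (f (u + x *: v) - f u) * x^-1) _ _ w0).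
    move=> w' hw'; rewrite /k ifF//; apply/negP => /eqP w'0; move: hw'.
    by rewrite w'0 sub0r ncN ltxx.
  apply: cdiff1M; last exact: cdiff1V.
  have [c Hc] := h w w1; exists c => e /Hc[d d0 H]; exists d => // w' /H.
  by rewrite opprB addrA subrK.
- move=> e e0; rewrite k0.
  have hu : unit_ball u by have := huv 0; rewrite Normc.normc0 scale0r addr0; apply.
  have Hg := gradP (hf _ hu).
  have v1 : 0 < nrm v + 1 by rewrite ltr_wpDl ?nrm_ge0.
  have e20 : 0 < e / 2 by rewrite divr_gt0.
  have [d d0 H] := Hg _ (divr_gt0 e20 v1).
  exists (d / (nrm v + 1)); first by rewrite divr_gt0.
  move=> w; rewrite ltr_pdivlMr// => wd; rewrite /k; case: eqVneq => [_|w0].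
    by rewrite subrr Normc.normc0.
  have nw : 0 < nc w.
    rewrite lt_neqAle nc_ge0 andbT eq_sym; apply: contra w0 => /eqP/Normc.eq0_normc->//.
  have vv : nrm v <= nrm v + 1 by rewrite lerDl.
  have n1 : nrm (w *: v) <= nc w * (nrm v + 1) by rewrite nrmZ ler_wpM2l ?nc_ge0.
  have := H _ (le_lt_trans n1 wd); rewrite linZ.
  have -> : (f (u + w *: v) - f u) / w - lin (grad f u) v =
    (f (u + w *: v) - f u - w * lin (grad f u) v) / w by field.
  rewrite Normc.normcM Normc.normcV => h1.
  rewrite ltr_pdivrMr//; apply: (le_lt_trans h1).
  apply: (@le_lt_trans _ _ (e / 2 * nc w)).
    by rewrite mulrAC ler_pdivrMr// -[leRHS]mulrA ler_pM2l.
  by rewrite ltr_pM2r// ltr_pdivrMr// mulr_natr mulr2n ltrDl.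
Qed.

Lemma pi2_gt0 : 0 < 2 * pi. Proof. by rewrite mulr_gt0// pi_gt0. Qed.

Lemma nc_cint_pi (F : R -> C) (G : C) (M : R) : ccont_on 0 (2 * pi) F ->
  (forall t, nc (F t) <= M) -> cint 0 (2 * pi) F = (2 * pi)%:C%C * G ->
  nc G <= 2 * M.
Proof.
move=> cF FM e; have := ler_nc_cint (ltW pi2_gt0) cF (fun t _ => FM t).
rewrite e subr0 Normc.normcM nc_real gtr0_norm ?pi2_gt0//.
by rewrite mulrC ler_pM2r// pi2_gt0.
Qed.

Lemma cauchy_bound f u v (M : R) : holo f -> disc_in_ball u v ->
  (forall c : C, nc c = 1 -> nc (f (u + c *: v) - f u) <= M) ->
  nc (lin (grad f u) v) <= 2 * M.
Proof.
move=> hf huv hM.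
apply: nc_cint_pi (cauchy_derivative hf huv) => [t _|t].
  apply: ccontM; last exact: ccont_cisN.
  apply: ccontB; last exact: ccont_cst.
  apply: ccont_line; last exact: ccont_cis.
  by apply/(holo_cont hf)/huv; rewrite nc_cis.
by rewrite Normc.normcM nc_cis mulr1 hM// nc_cis.
Qed.
End several_variables.

(** * Calculus along a segment *)
Section real_variable.
Variable R : realType.
Local Notation C := R[i].
Local Notation nc := (@Normc.normc R).

Lemma eps_is_derive (f : R -> R) (x df : R) :
  (forall e : R, 0 < e -> exists2 d : R, 0 < d & forall t, `|t| < d ->
    `|f (x + t) - f x - df * t| <= e * `|t|) ->
  is_derive (x : R^o) (1 : R^o) (f : R^o -> R^o) df.
Proof.
move=> H.
have cv : (fun h : R => h^-1 *: ((f \o shift x) (h *: (1 : R^o)) - f x : R^o)) @ 0^' --> (df : R^o).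
  apply/cvgrPdist_le => e e0; have [d d0 Hd] := H _ e0.
  apply/nbhs_ballP; exists d => //= t; rewrite /ball/= sub0r normrN => td t0.
  rewrite [t%:A]mulr1 (addrC t).
  have tn0 : 0 < `|t| by rewrite normr_gt0.
  rewrite -(ler_pM2r tn0) -normrM; apply: le_trans (Hd _ td).
  rewrite -normrN le_eqVlt; apply/orP; left; apply/eqP.
  congr (`|_|); rewrite mulrBl /= mulrAC mulVf// mul1r; ring.
split; first by apply/cvg_ex; exists df.
exact: cvg_lim cv.
Qed.

Definition rdiff (F : R -> C) (t : R) (c : C) := forall e : R, 0 < e ->
  exists2 d : R, 0 < d & forall t', `|t' - t| < d ->
    nc (F t' - F t - c * (t' - t)%:C%C) <= e * `|t' - t|.

Lemma rdiff_Re F t c : rdiff F t c ->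
  is_derive (t : R^o) (1 : R^o) ((fun s => complex.Re (F s)) : R^o -> R^o) (complex.Re c).
Proof.
move=> H; apply: eps_is_derive => e /H[d d0 Hd]; exists d => // s sd.
have := Hd (t + s); rewrite (addrC t) addrK => /(_ sd); apply: le_trans.
apply: le_trans (ler_nc_Re _); rewrite !cReImE /= mulr0 subr0; exact: lexx.
Qed.

Lemma rdiff_Im F t c : rdiff F t c ->
  is_derive (t : R^o) (1 : R^o) ((fun s => complex.Im (F s)) : R^o -> R^o) (complex.Im c).
Proof.
move=> H; apply: eps_is_derive => e /H[d d0 Hd]; exists d => // s sd.
have := Hd (t + s); rewrite (addrC t) addrK => /(_ sd); apply: le_trans.
apply: le_trans (ler_nc_Im _); rewrite !cReImE /= mulr0 add0r; exact: lexx.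
Qed.

Lemma rdiffB F G t c d : rdiff F t c -> rdiff G t d ->
  rdiff (fun s => F s - G s) t (c - d).
Proof.
move=> HF HG e e0; have e20 : 0 < e / 2 by rewrite divr_gt0.
have [d1 d10 H1] := HF _ e20; have [d2 d20 H2] := HG _ e20.
exists (Num.min d1 d2); first by rewrite lt_min d10.
move=> t'; rewrite lt_min => /andP[/H1 h1 /H2 h2].
have -> : F t' - G t' - (F t - G t) - (c - d) * (t' - t)%:C%C =
  (F t' - F t - c * (t' - t)%:C%C) - (G t' - G t - d * (t' - t)%:C%C) by ring.
by rewrite (le_trans (ler_ncB _ _))// (splitr e) mulrDl lerD.
Qed.

Lemma rdiff_linear (c : C) t : rdiff (fun s => s%:C%C * c) t c.
Proof.
move=> e e0; exists 1 => // t' _; rewrite rmorphB /=.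
have -> : t'%:C%C * c - t%:C%C * c - c * (t'%:C%C - t%:C%C) = 0 by ring.
by rewrite Normc.normc0 mulr_ge0// ltW.
Qed.

(** The real mean value theorem for each coordinate, hence the factor 2. *)
Lemma mean_value_ineq (F : R -> C) (K : R) :
  (forall t : R, 0 <= t <= 1 -> exists2 c, nc c <= K & rdiff F t c) ->
  nc (F 1 - F 0) <= 2 * K.
Proof.
move=> H.
have H' (t : R) : exists c, 0 <= t <= 1 -> nc c <= K /\ rdiff F t c.
  have [/H[c h1 h2]|h] := boolP (0 <= t <= 1); first by exists c.
  by exists 0.
have [dF HF] := choice H'.
have mvt (f df : R -> R) : (forall t : R, 0 <= t <= 1 -> is_derive (t : R^o) (1 : R^o) (f : R^o -> R^o) (df t)) ->
    (forall t : R, 0 <= t <= 1 -> `|df t| <= K) -> `|f 1 - f 0| <= K.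
  move=> hf hK; have [||c] := @MVT R f df 0 1 ltr01.
  - by move=> x; rewrite in_itv/= => /andP[x0 x1]; apply: hf; rewrite !ltW.
  - apply: continuous_in_subspaceT => x; rewrite inE/= in_itv/= => hx.
    apply: differentiable_continuous; apply/derivable1_diffP.
    by have [] := hf x hx.
  rewrite in_itv/= subr0 mulr1 => /andP[c0 c1] ->; apply: hK; by rewrite !ltW.
rewrite mulr2n mulrDl mul1r (le_trans (ler_nc_ReIm _))// !cReImE lerD//.
  apply: (mvt (fun t => complex.Re (F t)) (fun t => complex.Re (dF t))) => t /HF[h1 h2].
    exact: rdiff_Re.
  exact: le_trans (ler_nc_Re _) h1.
apply: (mvt (fun t => complex.Im (F t)) (fun t => complex.Im (dF t))) => t /HF[h1 h2].
  exact: rdiff_Im.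
exact: le_trans (ler_nc_Im _) h1.
Qed.

Lemma cint_FTC (F dF : R -> C) : (forall t : R, 0 <= t <= 1 -> rdiff F t (dF t)) ->
  ccont_on 0 1 dF -> cint 0 1 dF = F 1 - F 0.
Proof.
move=> H cd.
have ftc (f df : R -> R) : (forall t : R, 0 <= t <= 1 -> is_derive (t : R^o) (1 : R^o) (f : R^o -> R^o) (df t)) ->
    (forall t : R, 0 <= t <= 1 -> {for t, continuous df}) ->
    \int[lebesgue_measure]_(t in `[0, 1]) df t = f 1 - f 0.
  move=> hf hd; rewrite /Rintegral (@continuous_FTC2 _ df f)//.
  - apply: continuous_in_subspaceT => x; rewrite inE/= in_itv/=; exact: hd.
  - have cf x : 0 <= x <= 1 -> {for x, continuous f}.
      move=> hx; apply: differentiable_continuous; apply/derivable1_diffP.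
      by have [] := hf x hx.
    split.
    + move=> x; rewrite in_itv/= => /andP[x0 x1];
      have hx : 0 <= x <= 1 by rewrite !ltW.
      by have [] := hf x hx.
    + by apply: cvg_at_right_filter; apply: cf; rewrite lexx ler01.
    + by apply: cvg_at_left_filter; apply: cf; rewrite lexx ler01.
  - move=> x; rewrite in_itv/= => /andP[x0 x1]; rewrite derive1E.
    have hx : 0 <= x <= 1 by rewrite !ltW.
    by have [] := hf x hx.
apply: complex_ext; rewrite !cReImE /=.
  apply: (ftc (fun t => complex.Re (F t))) => t /[dup] ht.
    by move=> /H/rdiff_Re.
  by move=> /cd[].
apply: (ftc (fun t => complex.Im (F t))) => t /[dup] ht.
  by move=> /H/rdiff_Im.
by move=> /cd[].
Qed.
End real_variable.

(** * Second order estimates for holomorphic functions *)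
Section estimates.
Variables (R : realType) (n : nat).
Local Notation C := R[i].
Local Notation nc := (@Normc.normc R).
Local Notation pi := (@trigo.pi R).
Implicit Types (z w u v h g : 'rV[C]_n) (f : 'rV[C]_n -> C).

Lemma nrm_eq0 h : nrm h = 0 -> h = 0.
Proof.
move=> h0; apply/rowP => k; rewrite mxE; apply: Normc.eq0_normc; apply/eqP.
by rewrite eq_le nc_ge0 andbT -h0 nc_coord.
Qed.

Lemma nrm_gt0 h : h != 0 -> 0 < nrm h.
Proof.
by move=> h0; rewrite lt_neqAle nrm_ge0 andbT eq_sym; apply: contra h0 => /eqP/nrm_eq0->.
Qed.

Lemma delta_step u v : 0 < delta u -> nrm v <= delta u / 4 ->
  delta u / 4 <= delta (u + v).
Proof.
move=> du hv.
have h : nrm (u + v) <= nrm u + nrm v by exact: ler_nrmD.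
move: du hv h (nrm_ge0 u) (nrm_ge0 v) (nrm_ge0 (u + v)).
rewrite !deltaE -!sqr_nrm; clear; move: (nrm u) (nrm v) (nrm (u + v)) => x y w.
move=> h1 h2 h3 x0 y0 w0.
have x1 : x <= 1 by nra.
have y1 : y <= 1 / 4 by nra.
have : w ^+ 2 <= (x + y) ^+ 2 by rewrite ler_pXn2r// nnegrE addr_ge0.
have : x * y <= y by rewrite ler_piMl.
nra.
Qed.

Lemma disc_step u v : 0 < delta u -> nrm v <= delta u / 4 -> disc_in_ball u v.
Proof.
move=> du hv c c1; apply/delta_gt0P; apply: (@lt_le_trans _ _ (delta u / 4)).
  by rewrite divr_gt0.
apply: delta_step => //; rewrite nrmZ; apply: le_trans hv.
by rewrite ler_piMl// nrm_ge0.
Qed.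

(** Bounded on each set [delta z >= e], with a bound depending on [e]. The
    growth estimate provides it for the functions of the space, and it makes
    Cauchy estimates uniform on such sets. *)
Definition bounded_inside f := forall e : R, 0 < e ->
  exists M : R, forall z, e <= delta z -> nc (f z) <= M.

(** A homogeneous function bounded on a ball is bounded by a multiple of the
    norm. *)
Lemma homogeneous_bound (phi : 'rV[C]_n -> C) (r M : R) : 0 < r ->
  (forall (c : C) v, phi (c *: v) = c * phi v) ->
  (forall v, nrm v <= r -> nc (phi v) <= M) ->
  forall v, nc (phi v) <= M / r * nrm v.
Proof.
move=> r0 hphi hM v; have [->|v0] := eqVneq v 0.
  by rewrite -(scale0r 0) hphi mul0r Normc.normc0 scale0r nrm0 mulr0.
have nv := nrm_gt0 v0.
have e : nrm ((r / nrm v)%:C%C *: v) = r.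
  by rewrite nrmZ nc_real gtr0_norm ?divr_gt0// divfK ?gt_eqF.
have := hM ((r / nrm v)%:C%C *: v); rewrite e lexx => /(_ isT).
rewrite hphi Normc.normcM nc_real gtr0_norm ?divr_gt0//.
by rewrite mulrAC ler_pdivrMr// => h; rewrite mulrAC ler_pdivlMr// mulrC.
Qed.

Lemma grad_bound f : holo f -> bounded_inside f -> forall e : R, 0 < e ->
  exists2 L : R, 0 <= L & forall u h, e <= delta u -> nc (lin (grad f u) h) <= L * nrm h.
Proof.
move=> hf bf e e0; have e40 : 0 < e / 4 by rewrite divr_gt0.
have [M HM] := bf _ e40.
exists (2 * (2 * `|M|) / (e / 4)); first by rewrite divr_ge0 ?(ltW e40)// !mulr_ge0.
move=> u h hu; have du : 0 < delta u := lt_le_trans e0 hu.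
have e4u : e / 4 <= delta u / 4 by rewrite ler_pM2r.
apply: homogeneous_bound => // [c v|v hv]; first by rewrite linZ.
have hv' : nrm v <= delta u / 4 by rewrite (le_trans hv).
apply: cauchy_bound => //; first exact: disc_step.
have fM z : e / 4 <= delta z -> nc (f z) <= `|M|.
  by move=> /HM /le_trans; apply; rewrite ler_norm.
have e4 : e / 4 <= e by rewrite ler_pdivrMr// ler_peMr ?(ltW e0)// ler1n.
move=> c c1; have h1 : nc (f (u + c *: v)) <= `|M|.
  apply: fM; apply: (le_trans e4u); apply: (delta_step du).
  by rewrite nrmZ c1 mul1r.
have h2 : nc (f u) <= `|M| by apply: fM; exact: le_trans e4 hu.
rewrite (mulr2n 1) mulrDl mul1r; exact: le_trans (ler_ncB _ _) (lerD h1 h2).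
Qed.

Lemma rdiff_segment f u h t : holo f -> unit_ball (u + t%:C%C *: h) ->
  rdiff (fun t => f (u + t%:C%C *: h)) t (lin (grad f (u + t%:C%C *: h)) h).
Proof.
move=> hf hu e e0; have [d d0 Hd] := has_grad_line (gradP (hf _ hu)) e0.
exists d => // t' td; have := Hd t'%:C%C.
by rewrite -rmorphB /= nc_real; apply.
Qed.

Lemma nrm_segment h (t : R) : 0 <= t <= 1 -> nrm (t%:C%C *: h) <= nrm h.
Proof.
move=> /andP[t0 t1]; rewrite nrmZ nc_real (ger0_norm t0).
exact: ler_piMl (nrm_ge0 h) t1.
Qed.

Lemma delta_step_segment u h (t e : R) : 0 < e -> e <= delta u -> nrm h <= e / 4 ->
  0 <= t <= 1 -> e / 4 <= delta (u + t%:C%C *: h).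
Proof.
move=> e0 hu hh ht.
have e4u : e / 4 <= delta u / 4 by rewrite ler_pM2r.
apply: (le_trans e4u); apply: delta_step; first exact: lt_le_trans hu.
by rewrite (le_trans (nrm_segment _ ht))// (le_trans hh).
Qed.

Lemma unit_ball_delta z (e : R) : 0 < e -> e <= delta z -> unit_ball z.
Proof. by move=> e0 ez; apply/delta_gt0P; apply: lt_le_trans ez. Qed.

Lemma lip_bound f : holo f -> bounded_inside f -> forall e : R, 0 < e ->
  exists2 L : R, 0 <= L & forall u h, e <= delta u -> nrm h <= e / 4 ->
    nc (f (u + h) - f u) <= L * nrm h.
Proof.
move=> hf bf e e0; have e40 : 0 < e / 4 by rewrite divr_gt0.
have [L L0 HL] := grad_bound hf bf e40.
exists (2 * L); first by rewrite mulr_ge0.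
move=> u h hu hh; have := @mean_value_ineq _ (fun t => f (u + t%:C%C *: h)) (L * nrm h).
rewrite scale1r scale0r addr0 -mulrA; apply => t ht.
have dt := delta_step_segment e0 hu hh ht.
exists (lin (grad f (u + t%:C%C *: h)) h); first exact: HL.
by apply: rdiff_segment => //; exact: unit_ball_delta dt.
Qed.

(** Apply the Cauchy formula for the derivative at [u + h] and at [u]: the
    difference of the integrands is controlled by the Lipschitz bound of [f].
    *)
Lemma grad_lip f : holo f -> bounded_inside f -> forall e : R, 0 < e ->
  exists2 L : R, 0 <= L & forall u h v, e <= delta u -> nrm h <= e / 16 ->
    nc (lin (grad f (u + h)) v - lin (grad f u) v) <= L * nrm h * nrm v.
Proof.
move=> hf bf e e0; have e40 : 0 < e / 4 by rewrite divr_gt0.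
have e160 : 0 < e / 16 by rewrite divr_gt0.
have [L L0 HL] := lip_bound hf bf e40.
exists (2 * (2 * L) / (e / 16)); first by rewrite divr_ge0 ?(ltW e160)// !mulr_ge0.
move=> u h v hu hh.
have -> : 2 * (2 * L) / (e / 16) * nrm h * nrm v =
  2 * (2 * (L * nrm h)) / (e / 16) * nrm v by ring.
have e164 : e / 16 <= e / 4 by rewrite ler_pM2l// lef_pV2 ?posrE// ler_nat.
have hh4 : nrm h <= e / 4 by rewrite (le_trans hh).
have du := lt_le_trans e0 hu.
have e4u : e / 4 <= delta u / 4 by rewrite ler_pM2r.
have e4u' : e / 4 <= delta u.
  by apply: (le_trans _ hu); rewrite ler_pdivrMr// ler_peMr ?(ltW e0)// ler1n.
have duh : e / 4 <= delta (u + h).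
  by apply: (le_trans e4u); apply: delta_step; rewrite ?(le_trans hh4).
have eq16 : e / 16 = e / 4 / 4 by field.
apply: (@homogeneous_bound (fun v => lin (grad f (u + h)) v - lin (grad f u) v)) => //.
  by move=> c v'; rewrite !linZ mulrBr.
move=> {}v hv.
have dv : disc_in_ball u v by apply: disc_step; rewrite ?(le_trans hv)// (le_trans e164).
have dv' : disc_in_ball (u + h) v.
  apply: disc_step; first exact: lt_le_trans duh.
  by rewrite (le_trans hv)// eq16 ler_pM2r.
pose F x t := (f (x + cis t *: v) - f x) * cis (- t) : C.
have cF x : disc_in_ball x v -> ccont_on 0 (2 * pi) (F x).
  move=> hx t _; apply: ccontM; last exact: ccont_cisN.
  apply: ccontB; last exact: ccont_cst.
  apply: ccont_line; last exact: ccont_cis.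
  by apply/(holo_cont hf)/hx; rewrite nc_cis.
apply: (@nc_cint_pi _ (fun t => F (u + h) t - F u t)).
- by move=> t ht; apply: ccontB; apply: cF.
- move=> t; rewrite /F -mulrBl Normc.normcM nc_cis mulr1.
  have -> : f (u + h + cis t *: v) - f (u + h) - (f (u + cis t *: v) - f u) =
    (f (u + cis t *: v + h) - f (u + cis t *: v)) - (f (u + h) - f u).
    by rewrite (addrAC u h); ring.
  rewrite (le_trans (ler_ncB _ _))// mulr2n mulrDl mul1r lerD// HL ?(le_trans hh) ?eq16//.
  apply: (le_trans e4u); apply: delta_step => //.
  by rewrite nrmZ nc_cis mul1r (le_trans hv)// (le_trans e164).
- rewrite cintB; [|exact: cF..].
  by rewrite /F !cauchy_derivative// mulrBr.
Qed.

(** The remainder of the first order expansion has small derivative along the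
    segment because the gradient is Lipschitz. A quadratic remainder with a
    uniform constant survives integration in a parameter. *)
Lemma quad_bound f : holo f -> bounded_inside f -> forall e : R, 0 < e ->
  exists2 L : R, 0 <= L & forall u h, e <= delta u -> nrm h <= e / 16 ->
    nc (f (u + h) - f u - lin (grad f u) h) <= L * nrm h ^+ 2.
Proof.
move=> hf bf e e0.
have [L L0 HL] := grad_lip hf bf e0.
exists (2 * L); first by rewrite mulr_ge0.
move=> u h hu hh.
have hh4 : nrm h <= e / 4.
  by rewrite (le_trans hh)// ler_pM2l// lef_pV2 ?posrE// ler_nat.
have := @mean_value_ineq _ (fun t => f (u + t%:C%C *: h) - t%:C%C * lin (grad f u) h)
  (L * nrm h ^+ 2).
rewrite scale1r scale0r addr0 mul0r subr0 mul1r addrAC -mulrA; apply => t ht.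
have dt := delta_step_segment e0 hu hh4 ht.
exists (lin (grad f (u + t%:C%C *: h)) h - lin (grad f u) h).
  have th := nrm_segment h ht.
  apply: (le_trans (HL _ _ _ hu (le_trans th hh))).
  by rewrite expr2 mulrA ler_wpM2r ?nrm_ge0// ler_wpM2l.
apply: rdiffB; last exact: rdiff_linear.
apply: rdiff_segment => //; by apply: unit_ball_delta dt; rewrite divr_gt0.
Qed.

Lemma quad_has_grad f u g (r L : R) : 0 < r ->
  (forall h, nrm h <= r -> nc (f (u + h) - f u - lin g h) <= L * nrm h ^+ 2) ->
  has_grad f u g.
Proof.
move=> r0 H e e0; have L1 : 0 < `|L| + 1 by rewrite ltr_wpDl.
exists (Num.min r (e / (`|L| + 1))); first by rewrite lt_min r0 divr_gt0.
move=> h; rewrite lt_min ltr_pdivlMr// => /andP[/ltW/H h1 h2].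
apply: (le_trans h1); rewrite expr2 mulrA ler_wpM2r ?nrm_ge0//.
apply: le_trans (ltW h2); rewrite mulrC ler_wpM2l ?nrm_ge0//.
by rewrite (le_trans (ler_norm L))// lerDl.
Qed.

Lemma cint_lin (a b : R) (G : R -> 'rV[C]_n) h :
  (forall k, ccont_on a b (fun t => G t 0 k)) ->
  ccont_on a b (fun t => lin (G t) h) /\
  cint a b (fun t => lin (G t) h) = lin (\row_k cint a b (fun t => G t 0 k)) h.
Proof.
move=> cG; rewrite /lin.
have cGk k : ccont_on a b (fun t => G t 0 k * h 0 k).
  by move=> t ht; apply: ccontM (cG k t ht) (ccont_cst _ _).
elim: (index_enum _) => [|k r [IH1 IH2]].
  split; first by move=> t _; under eq_fun do rewrite big_nil; exact: ccont_cst.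
  rewrite big_nil (@eq_cint _ _ _ _ (fun=> 0 * 0)); last by move=> t _; rewrite big_nil mulr0.
  by rewrite cintZ ?mul0r// => t _; exact: ccont_cst.
split.
  move=> t ht; under eq_fun do rewrite big_cons.
  exact: ccontD (cGk k t ht) (IH1 t ht).
rewrite big_cons -IH2 (@eq_cint _ _ _ _ (fun t => G t 0 k * h 0 k +
  \sum_(j <- r) G t 0 j * h 0 j)); last by move=> t _; rewrite big_cons.
rewrite (cintD (cGk k) IH1) mxE; congr (_ + _).
by under eq_cint do rewrite mulrC; rewrite cintZ// mulrC.
Qed.

(** Differentiation under the integral sign: uniform quadratic remainders are
    integrated. *)
Lemma has_grad_cint (a b : R) (F : R -> 'rV[C]_n -> C) (G : R -> 'rV[C]_n) u (r L : R) :
  a <= b -> 0 < r ->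
  (forall h, nrm h <= r -> ccont_on a b (fun t => F t (u + h))) ->
  (forall k, ccont_on a b (fun t => G t 0 k)) ->
  (forall t h, a <= t <= b -> nrm h <= r ->
     nc (F t (u + h) - F t u - lin (G t) h) <= L * nrm h ^+ 2) ->
  has_grad (fun z => cint a b (F^~ z)) u (\row_k cint a b (fun t => G t 0 k)).
Proof.
move=> ab r0 cF cG H.
apply: (@quad_has_grad _ _ _ r (2 * L * (b - a))) => // h hr.
have [c1 <-] := cint_lin h cG.
have cF0 : ccont_on a b (fun t => F t u).
  by have := cF 0; rewrite nrm0 addr0; apply; exact: ltW.
have cFh := cF _ hr.
have cB : ccont_on a b (fun t => F t (u + h) - F t u).
  by move=> t ht; apply: ccontB; [apply: cFh|apply: cF0].
rewrite -(cintB cFh cF0) -(cintB cB c1).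
have := @ler_nc_cint _ a b (fun t => F t (u + h) - F t u - lin (G t) h)
  (L * nrm h ^+ 2) ab.
rewrite (_ : 2 * (L * nrm h ^+ 2) * (b - a) = 2 * L * (b - a) * nrm h ^+ 2); last by ring.
apply.
  by move=> t ht; apply: ccontB; [apply: cB|apply: c1].
by move=> t ht; exact: H.
Qed.
End estimates.

(** * The Gleason operators *)
Section gleason_operator.
Variables (R : realType) (n : nat).
Local Notation C := R[i].
Local Notation nc := (@Normc.normc R).
Local Notation pi := (@trigo.pi R).
Implicit Types (z w u v h g b : 'rV[C]_n) (f : 'rV[C]_n -> C).

Definition partial k f z : C := grad f z 0 k.

Lemma nrm_delta_mx k : nrm (delta_mx 0 k : 'rV[C]_n) = 1.
Proof.
have h : sqnorm (delta_mx 0 k : 'rV[C]_n) = 1.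
  rewrite sqnormE (bigD1 k)//= big1 => [|j jk].
    by rewrite mxE !eqxx Normc.normc1 expr1n addr0.
  by rewrite mxE (negPf jk) andbF Normc.normc0 expr0n.
by rewrite nrmE h sqrtr1.
Qed.

Lemma partialE k f z : partial k f z = lin (grad f z) (delta_mx 0 k).
Proof. by rewrite lin_delta. Qed.

Lemma partial_bounded k f : holo f -> bounded_inside f -> bounded_inside (partial k f).
Proof.
move=> hf bf e e0; have [L L0 HL] := grad_bound hf bf e0.
by exists L => z /HL h; rewrite partialE (le_trans (h _))// nrm_delta_mx mulr1.
Qed.

Lemma partial_cont k f z : holo f -> bounded_inside f -> unit_ball z -> fcont (partial k f) z.
Proof.
move=> hf bf /delta_gt0 dz e e0; have [L L0 HL] := grad_lip hf bf dz.
have L1 : 0 < L + 1 by rewrite ltr_wpDl.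
exists (Num.min (delta z / 16) (e / (L + 1))).
  by rewrite lt_min !divr_gt0.
move=> h; rewrite lt_min => /andP[/ltW h1]; rewrite ltr_pdivlMr// => h2.
rewrite !partialE; apply: (le_lt_trans (HL _ _ _ (lexx _) h1)).
rewrite nrm_delta_mx mulr1; apply: le_lt_trans h2.
by rewrite mulrC ler_wpM2l ?nrm_ge0// lerDl.
Qed.

Lemma has_grad_localZ f (Phi : 'rV[C]_n -> C) (c : C) u g (r : R) : 0 < r ->
  (forall h, nrm h < r -> f (u + h) = c * Phi (u + h)) ->
  has_grad Phi u g -> has_grad f u (c *: g).
Proof.
move=> r0 hfP H e e0; have c1 : 0 < nc c + 1 by rewrite ltr_wpDl ?nc_ge0.
have [d d0 Hd] := H _ (divr_gt0 e0 c1).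
exists (Num.min d r); first by rewrite lt_min d0.
move=> h; rewrite lt_min => /andP[/Hd hd hr].
have fu : f u = c * Phi u by rewrite -(addr0 u) hfP// nrm0.
rewrite hfP// fu linZl -!mulrBr Normc.normcM.
apply: (le_trans (ler_wpM2l (nc_ge0 c) hd)).
rewrite mulrA ler_wpM2r ?nrm_ge0// mulrCA -[leRHS]mulr1 ler_wpM2l ?(ltW e0)//.
by rewrite ler_pdivrMr// mul1r lerDl.
Qed.

(** The Cauchy formula writes a partial derivative as an integral of
    translates of [f], which can be differentiated under the integral sign. *)
Lemma partial_holo k f : holo f -> bounded_inside f -> holo (partial k f).
Proof.
move=> hf bf u hu; pose e := delta u.
have e0 : 0 < e by exact: delta_gt0.
have e40 : 0 < e / 4 by rewrite divr_gt0.
have e4e : e / 4 <= e by rewrite ler_pdivrMr// ler_peMr ?(ltW e0)// ler1n.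
have [L L0 HL] := quad_bound hf bf e40.
(* The discs of this radius stay at depth [e / 4], and [r = e / 4 / 16] is the
   range of [quad_bound] at that depth. *)
pose r := e / 64; have r0 : 0 < r by rewrite divr_gt0.
have r16 : r = e / 4 / 16 by rewrite /r; field.
have r4 : r <= e / 4 by rewrite ler_pM2l// lef_pV2 ?posrE// ler_nat.
have r44 : r <= e / 4 / 4 by rewrite r16 ler_pM2l// lef_pV2 ?posrE// ler_nat.
clearbody r.
pose v : 'rV[C]_n := r%:C%C *: delta_mx 0 k.
have nv : nrm v = r by rewrite nrmZ nc_real (gtr0_norm r0) nrm_delta_mx mulr1.
have near h : nrm h <= r -> e / 4 <= delta (u + h).
  by move=> hh; apply: delta_step => //; exact: le_trans hh r4.
have dv h : nrm h <= r -> disc_in_ball (u + h) v.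
  move=> hh; have h1 := near _ hh; apply: disc_step; first exact: lt_le_trans h1.
  by rewrite nv (le_trans r44)// ler_pM2r.
have nv' t : nrm (cis t *: v) <= r by rewrite nrmZ nc_cis mul1r nv.
have duv : disc_in_ball u v by have := dv 0; rewrite nrm0 addr0; apply; exact: ltW.
pose F t x := (f (x + cis t *: v) - f x) * cis (- t) : C.
pose G t := cis (- t) *: (grad f (u + cis t *: v) - grad f u).
have cF h : nrm h <= r -> ccont_on 0 (2 * pi) (fun t => F t (u + h)).
  move=> hh t _; apply: ccontM; last exact: ccont_cisN.
  apply: ccontB; last exact: ccont_cst.
  apply: ccont_line; last exact: ccont_cis.
  by apply/(holo_cont hf)/(dv _ hh); rewrite nc_cis.
have cG j : ccont_on 0 (2 * pi) (fun t => G t 0 j).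
  move=> t _; have -> : (fun t => G t 0 j) =
      (fun t => cis (- t) * (partial j f (u + cis t *: v) - partial j f u)).
    by apply/funext => s; rewrite /G !mxE.
  apply: ccontM; first exact: ccont_cisN.
  apply: ccontB; last exact: ccont_cst.
  apply: ccont_line; last exact: ccont_cis.
  by apply: (partial_cont _ hf bf); apply: duv; rewrite nc_cis.
have rem t h : 0 <= t <= 2 * pi -> nrm h <= r ->
    nc (F t (u + h) - F t u - lin (G t) h) <= 2 * L * nrm h ^+ 2.
  move=> _ hh.
  have -> : F t (u + h) - F t u - lin (G t) h =
      ((f (u + cis t *: v + h) - f (u + cis t *: v) - lin (grad f (u + cis t *: v)) h)
      - (f (u + h) - f u - lin (grad f u) h)) * cis (- t).
    by rewrite /F /G linZl linBl (addrAC u h); ring.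
  rewrite Normc.normcM nc_cis mulr1.
  have h1 := HL (u + cis t *: v) h (near _ (nv' t)).
  have h2 := HL u h e4e.
  rewrite -r16 in h1 h2; apply: (le_trans (ler_ncB _ _)).
  by rewrite (mulr2n 1) !mulrDl mul1r lerD ?h1 ?h2.
have Hg := has_grad_cint (ltW (pi2_gt0 R)) r0 cF cG rem.
exists (((2 * pi * r)^-1)%:C%C *: (\row_k cint 0 (2 * pi) (fun t => G t 0 k))).
apply: (has_grad_localZ r0 _ Hg) => h /ltW hh.
rewrite /F (cauchy_derivative hf (dv _ hh)) /v linZ -partialE !mulrA -!rmorphM /=.
have -> : (2 * pi * r)^-1 * (2 * pi) * r = 1.
  by rewrite -mulrA mulVf// gt_eqF// mulr_gt0// pi2_gt0.
by rewrite mul1r.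
Qed.

(** [delta] is concave, since the squared norm is convex. *)
Lemma delta_convex b z (t : R) : 0 <= t <= 1 -> nrm b <= 1 -> nrm z <= 1 ->
  (1 - t) * delta b + t * delta z <= delta (b + t%:C%C *: (z - b)).
Proof.
move=> /andP[t0 t1] b1 z1; rewrite !deltaE -!sqr_nrm.
have -> : b + t%:C%C *: (z - b) = (1 - t)%:C%C *: b + t%:C%C *: z.
  by rewrite scalerBr rmorphB rmorph1 scalerBl scale1r addrA addrAC.
have := ler_nrmD ((1 - t)%:C%C *: b) (t%:C%C *: z).
rewrite !nrmZ !nc_real !ger0_norm ?subr_ge0//.
move: b1 z1 t0 t1 (nrm_ge0 b) (nrm_ge0 z) (nrm_ge0 ((1 - t)%:C%C *: b + t%:C%C *: z)).
clear; move: (nrm b) (nrm z) (nrm (_ + _)) => x y w x1 y1 t0 t1 x0 y0 w0 h.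
have h2 : w ^+ 2 <= ((1 - t) * x + t * y) ^+ 2.
  by rewrite ler_pXn2r// nnegrE addr_ge0// mulr_ge0// subr_ge0.
have : 0 <= t * (1 - t) * (x - y) ^+ 2 by rewrite mulr_ge0 ?sqr_ge0// mulr_ge0// subr_ge0.
move: h2; clear; lra.
Qed.

Definition gleason b k f z : C :=
  cint 0 1 (fun t => partial k f (b + t%:C%C *: (z - b))).

Lemma segment_ball b z (t : R) : 0 <= t <= 1 -> unit_ball b -> unit_ball z ->
  unit_ball (b + t%:C%C *: (z - b)).
Proof.
move=> ht hb hz; apply/delta_gt0P.
apply: lt_le_trans (delta_convex ht (sqnorm_ball_le1 hb) (sqnorm_ball_le1 hz)).
have := delta_gt0 hb; have := delta_gt0 hz; case/andP: ht; clear.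
by move: (delta b) (delta z) => x y; nra.
Qed.

Lemma ccont_real t : ccont (fun s : R => s%:C%C) t.
Proof.
split => /=; [exact: cvg_id|exact: cvg_cst].
Qed.

Lemma gleason_cont b k f z : unit_ball b -> unit_ball z -> holo f -> bounded_inside f ->
  ccont_on 0 1 (fun t => partial k f (b + t%:C%C *: (z - b))).
Proof.
move=> hb hz hf bf t ht; apply: ccont_line; last exact: ccont_real.
by apply: (partial_cont _ hf bf); exact: segment_ball.
Qed.

(** Differentiation under the integral sign applies to [partial k f], which is
    holomorphic and satisfies the same interior bounds as [f]. *)
Lemma gleason_holo b k f : unit_ball b -> holo f -> bounded_inside f -> holo (gleason b k f).
Proof.
move=> hb hf bf z hz; have hg := partial_holo k hf bf; have bg := partial_bounded k hf bf.
have db := delta_gt0 hb; have dz := delta_gt0 hz.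
pose e := Num.min (delta b) (delta z / 4).
have e0 : 0 < e by rewrite lt_min db divr_gt0.
have eb : e <= delta b by rewrite ge_min lexx.
have ez : e <= delta z / 4 by rewrite ge_min lexx orbT.
have [L L0 HL] := quad_bound hg bg e0.
pose r := e / 16; have r0 : 0 < r by rewrite divr_gt0.
have re : r <= delta z / 4.
  by apply: le_trans ez; rewrite ler_pdivrMr// ler_peMr ?(ltW e0)// ler1n.
have near h : nrm h <= r -> e <= delta (z + h).
  by move=> hh; apply: (le_trans ez); apply: delta_step => //; exact: le_trans hh re.
have seg x t : 0 <= t <= 1 -> e <= delta x -> e <= delta (b + t%:C%C *: (x - b)).
  move=> ht ex; have hx : unit_ball x := unit_ball_delta e0 ex.
  apply: le_trans (delta_convex ht (sqnorm_ball_le1 hb) (sqnorm_ball_le1 hx)).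
  case/andP: ht => t0 t1; apply: (@le_trans _ _ ((1 - t) * e + t * e)).
    by rewrite -mulrDl subrK mul1r.
  by rewrite lerD// ler_wpM2l// subr_ge0.
have ez' : e <= delta z by have := near 0; rewrite nrm0 addr0; apply; exact: ltW.
pose F t x := partial k f (b + t%:C%C *: (x - b)).
pose G t := t%:C%C *: grad (partial k f) (b + t%:C%C *: (z - b)).
have cF h : nrm h <= r -> ccont_on 0 1 (fun t => F t (z + h)).
  by move=> hh; exact: (gleason_cont k hb (unit_ball_delta e0 (near _ hh)) hf bf).
have cG j : ccont_on 0 1 (fun t => G t 0 j).
  move=> t ht; have -> : (fun t => G t 0 j) =
      (fun t => t%:C%C * partial j (partial k f) (b + t%:C%C *: (z - b))).
    by apply/funext => s; rewrite /G !mxE.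
  apply: ccontM; first exact: ccont_real.
  exact: (gleason_cont j hb hz hg bg).
have rem t h : 0 <= t <= 1 -> nrm h <= r ->
    nc (F t (z + h) - F t z - lin (G t) h) <= L * nrm h ^+ 2.
  move=> ht hh; have th := nrm_segment h ht.
  have -> : F t (z + h) - F t z - lin (G t) h =
    partial k f (b + t%:C%C *: (z - b) + t%:C%C *: h) - partial k f (b + t%:C%C *: (z - b)) -
    lin (grad (partial k f) (b + t%:C%C *: (z - b))) (t%:C%C *: h).
    by rewrite /F /G linZl linZ -(addrA b) -scalerDr (addrAC z h).
  apply: (le_trans (HL _ _ (seg _ _ ht ez') (le_trans th hh))).
  by rewrite ler_wpM2l// ler_pXn2r ?nnegrE ?nrm_ge0.
eexists; exact: has_grad_cint ler01 r0 cF cG rem.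
Qed.

Lemma gleason_identity b f z : unit_ball b -> unit_ball z -> holo f -> bounded_inside f ->
  f z - f b = \sum_(k < n) (z 0 k - b 0 k) * gleason b k f z.
Proof.
move=> hb hz hf bf.
have [c1 e1] := cint_lin (z - b) (G := fun t => grad f (b + t%:C%C *: (z - b)))
  (fun k => gleason_cont k hb hz hf bf).
have := @cint_FTC _ (fun t => f (b + t%:C%C *: (z - b)))
  (fun t => lin (grad f (b + t%:C%C *: (z - b))) (z - b)).
rewrite scale1r scale0r addr0 subrKC => <-.
- rewrite e1 /lin; apply: eq_bigr => k _; rewrite !mxE mulrC; congr (_ * _).
- by move=> t ht; exact: (rdiff_segment hf (segment_ball ht hb hz)).
- exact: c1.
Qed.
End gleason_operator.

(** * Measure preserving maps *)
Section measure_preserving.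
Context d (T : measurableType d) (R : realType).

Definition measure_preserving (mu : set T -> \bar R) (phi : T -> T) :=
  measurable_fun setT phi /\ forall A, measurable A -> mu (phi @^-1` A) = mu A.

Lemma mpres_integral (mu : {measure set T -> \bar R}) phi : measure_preserving mu phi ->
  forall g : T -> \bar R, measurable_fun setT g -> (forall x, (0 <= g x)%E) ->
  (\int[mu]_x g (phi x) = \int[mu]_x g x)%E.
Proof.
move=> [mphi H] g mg g0.
have := @ge0_integral_pushforward _ _ _ _ R phi mphi mu setT g measurableT mg (fun x _ => g0 x).
rewrite preimage_setT => <-.
apply: eq_measure_integral => A mA _; exact: H.
Qed.
End measure_preserving.

(** The image of the product measure takes the value of the product measure on
    rectangles, and this determines it. *)
Lemma mpres_prod d1 d2 (T1 : measurableType d1) (T2 : measurableType d2) (R : realType)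
  (m1 : {sigma_finite_measure set T1 -> \bar R})
  (m2 : {sigma_finite_measure set T2 -> \bar R}) p1 p2 :
  measure_preserving m1 p1 -> measure_preserving m2 p2 ->
  measure_preserving (m1 \x m2)%E (fun x : T1 * T2 => (p1 x.1, p2 x.2)).
Proof.
move=> [mp1 H1] [mp2 H2].
have mp : measurable_fun setT (fun x : T1 * T2 => (p1 x.1, p2 x.2)).
  by apply: measurable_fun_pair; exact: measurableT_comp.
split => // A mA.
pose P : {mfun (T1 * T2)%type >-> (T1 * T2)%type} := HB.pack (fun x : T1 * T2 => (p1 x.1, p2 x.2))
  (isMeasurableFun.Build _ _ _ _ _ mp).
have := @product_measure_unique _ _ _ _ R m1 m2 (pushforward (m1 \x m2)%E P) _ A mA.
move=> -> // B C mB mC; rewrite /pushforward.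
change ((m1 \x m2)%E ((p1 @^-1` B) `*` (p2 @^-1` C)) = (m1 B * m2 C)%E).
rewrite product_measure1E.
- by congr (_ * _)%E; [exact: H1|exact: H2].
- by rewrite -[X in measurable X]setTI; exact: mp1.
- by rewrite -[X in measurable X]setTI; exact: mp2.
Qed.

Section translation.
Variable R : realType.
Local Notation Rm := (measurableTypeR R).
Local Notation leb := (@lebesgue_measure R).

Lemma mpres_lebesgue (c : R) : measure_preserving leb (fun x : Rm => x + c : Rm).
Proof.
have mp : measurable_fun setT (fun x : Rm => x + c : Rm).
  by apply: measurable_funD => //; exact: measurable_cst.
split => // A mA.
pose P : {mfun Rm >-> Rm} := HB.pack (fun x : Rm => x + c : Rm)
  (isMeasurableFun.Build _ _ _ _ _ mp).
apply/esym; apply: (@lebesgue_measure_unique _ (pushforward leb P)) => // _ [[a b] _ <-] /=.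
change (leb `]a, b] = leb (P @^-1` `]a, b])).
have -> : P @^-1` `]a, b] = `](a - c), (b - c)]%classic.
  by apply/seteqP; split => x /=; rewrite !in_itv/= ltrBlDr lerBrDr.
rewrite !lebesgue_measure_itv/= !lte_fin ltrD2r; case: ifP => // _.
by rewrite -!EFinB; congr EFin; rewrite opprB addrA subrK.
Qed.

Lemma mpres_plane (c : R * R) :
  measure_preserving (@lebesgue_plane R) (fun x : Rm * Rm => (x.1 + c.1 : Rm, x.2 + c.2 : Rm)).
Proof. exact: mpres_prod (mpres_lebesgue c.1) (mpres_lebesgue c.2). Qed.
End translation.

(** Induction on the length, the tuple measure being an iterated product. *)
Lemma mpres_tuple d (T : measurableType d) (R : realType)
  (mu : {sigma_finite_measure set T -> \bar R}) n (p : 'I_n -> T -> T) :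
  (forall k, measure_preserving mu (p k)) ->
  measure_preserving (tuple_measure mu n) (fun t : n.-tuple T => [tuple p k (tnth t k) | k < n]).
Proof.
elim: n p => [|n IH] p hp.
  split.
    by apply/measurable_fun_tnthP => -[].
  move=> A mA; congr (tuple_measure mu 0 _); apply/seteqP; split => t /=;
    by rewrite (tuple0 t) (tuple0 [tuple _ | _ < _]).
split.
  apply/measurable_fun_tnthP => k.
  rewrite (_ : _ \o _ = (fun t => p k (tnth t k))); last first.
    by apply/funext => t; rewrite /= tnth_mktuple.
  have [mk _] := hp k; apply: (measurableT_comp mk); exact: measurable_tnth.
move=> A mA.
have [mIH HIH] := IH (fun k => p (lift ord0 k)) (fun k => hp _).
have [_ HP] := mpres_prod (hp ord0) (conj mIH HIH).
have mc : measurable (@tuple_cons _ T n @^-1` A).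
  by rewrite -[X in measurable X]setTI; apply: measurable_tuple_cons.
rewrite /= /tuple_measure_succ /pushforward -(HP _ mc).
congr (_ _); apply/seteqP; split => -[x t] /=;
  rewrite (_ : [tuple _ | _ < _] = tuple_cons (p ord0 x,
     [tuple p (lift ord0 k) (tnth t k) | k < n]))//;
  apply: eq_from_tnth => k; rewrite tnth_mktuple;
  (have [j ->|->] := unliftP ord0 k;
    [by rewrite !tnthS tnth_mktuple | by rewrite !tnth0]).
Qed.

(** * Measurability and translations on complex space *)
Section lebesgue_Cn_theory.
Variables (R : realType) (n : nat).
Local Notation C := R[i].
Local Notation nc := (@Normc.normc R).
Local Notation Rm := (measurableTypeR R).
Local Notation Cn := (measCn R n).
Local Notation V := (@lebesgue_Cn R n).
Implicit Types (z w u v a : 'rV[C]_n).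

Let lebesgue_Cn_sigma_finite : sigma_finite setT V.
Proof.
have /sigma_finiteP[F [TF ndF Foo]] := sigma_finiteT (tuple_measure (@lebesgue_plane R) n).
exists (fun k => (@real_coords R n) @^-1` F k).
  apply/seteqP; split=> // z _.
  have [i _ Fi] : (\bigcup_k F k) (real_coords z) by rewrite -TF.
  by exists i.
move=> k; have [mF Fk] := Foo k; split; first by exists (F k) => //; rewrite setTI.
rewrite /lebesgue_Cn /pushforward.
rewrite (_ : _ @^-1` _ = F k)//; apply/seteqP; split=> t /=;
  by rewrite of_real_coordsK.
Qed.

HB.instance Definition _ := Measure_isSigmaFinite.Build _ _ _ V
  lebesgue_Cn_sigma_finite.

Lemma measurable_real_coords : measurable_fun [set: Cn] (@real_coords R n).
Proof. by move=> _ A mA; rewrite setTI; exists A => //; rewrite setTI. Qed.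

Lemma measurable_to_Cn d (T : measurableType d) (D : set T) (f : T -> Cn) :
  measurable_fun D (@real_coords R n \o f) -> measurable_fun D f.
Proof. by move=> H mD _ [A mA <-]; rewrite setTI -comp_preimage; exact: H. Qed.

Lemma measurable_coord (k : 'I_n) :
  measurable_fun [set: Cn] (fun z : Cn => complex.Re ((z : 'rV[C]_n) 0 k) : Rm) /\
  measurable_fun [set: Cn] (fun z : Cn => complex.Im ((z : 'rV[C]_n) 0 k) : Rm).
Proof.
have h : measurable_fun [set: Cn] (fun z : Cn => tnth (@real_coords R n z) k).
  apply: (measurableT_comp (f := fun t : n.-tuple (Rm * Rm) => tnth t k)).
    exact: measurable_tnth.
  exact: measurable_real_coords.
split.
  rewrite (_ : (fun z : Cn => _) = (fun z : Cn => (tnth (@real_coords R n z) k).1)); last first.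
    by apply/funext => z; rewrite tnth_mktuple.
  exact: (measurableT_comp (f := fst) measurable_fst h).
rewrite (_ : (fun z : Cn => _) = (fun z : Cn => (tnth (@real_coords R n z) k).2)); last first.
  by apply/funext => z; rewrite tnth_mktuple.
exact: (measurableT_comp (f := snd) measurable_snd h).
Qed.

(** A complex function is measurable when both its coordinates are; this keeps
    the sigma-algebra on the complex numbers out of the picture. *)
Definition cmeas d (T : measurableType d) (D : set T) (f : T -> C) :=
  measurable_fun D (fun x => complex.Re (f x) : Rm) /\
  measurable_fun D (fun x => complex.Im (f x) : Rm).

Section cmeas_rules.
Context d (T : measurableType d) (D : set T).
Implicit Types f g : T -> C.

Lemma cmeas_cst (c : C) : cmeas D (fun=> c).
Proof. by split; exact: measurable_cst. Qed.

Lemma cmeasD f g : cmeas D f -> cmeas D g -> cmeas D (fun x => f x + g x).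
Proof.
move=> [f1 f2] [g1 g2]; split.
  rewrite (_ : (fun x => _) = (fun x => complex.Re (f x) + complex.Re (g x))).
    exact: measurable_funD.
  by apply/funext => x; rewrite cReD.
rewrite (_ : (fun x => _) = (fun x => complex.Im (f x) + complex.Im (g x))).
  exact: measurable_funD.
by apply/funext => x; rewrite cImD.
Qed.

Lemma cmeasM f g : cmeas D f -> cmeas D g -> cmeas D (fun x => f x * g x).
Proof.
move=> [f1 f2] [g1 g2]; split.
  rewrite (_ : (fun x => _) = (fun x => complex.Re (f x) * complex.Re (g x) -
      complex.Im (f x) * complex.Im (g x))).
    by apply: measurable_funB; apply: measurable_funM.
  by apply/funext => x; rewrite cReM.
rewrite (_ : (fun x => _) = (fun x => complex.Re (f x) * complex.Im (g x) +
      complex.Im (f x) * complex.Re (g x))).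
  by apply: measurable_funD; apply: measurable_funM.
by apply/funext => x; rewrite cImM.
Qed.

Lemma cmeasB f g : cmeas D f -> cmeas D g -> cmeas D (fun x => f x - g x).
Proof.
move=> hf hg; rewrite (_ : (fun x => _) = (fun x => f x + (-1) * g x)); last first.
  by apply/funext => x; rewrite mulN1r.
exact: cmeasD hf (cmeasM (cmeas_cst _) hg).
Qed.

Lemma cmeas_sum (I : Type) (r : seq I) (F : I -> T -> C) :
  (forall k, cmeas D (F k)) -> cmeas D (fun x => \sum_(k <- r) F k x).
Proof.
move=> hF; elim: r => [|k r IH].
  rewrite (_ : (fun x => _) = fun=> 0); first exact: cmeas_cst.
  by apply/funext => x; rewrite big_nil.
rewrite (_ : (fun x => _) = (fun x => F k x + \sum_(j <- r) F j x)); first exact: cmeasD.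
by apply/funext => x; rewrite big_cons.
Qed.

Lemma cmeas_conj f : cmeas D f -> cmeas D (fun x => (f x)^*%C).
Proof.
move=> [f1 f2]; split.
  by rewrite (_ : (fun x => _) = (fun x => complex.Re (f x)))//; apply/funext => x; case: (f x).
rewrite (_ : (fun x => _) = (fun x => - complex.Im (f x))).
  exact: measurable_funN.
by apply/funext => x; case: (f x).
Qed.

Lemma measurable_nc f : cmeas D f -> measurable_fun D (fun x => nc (f x) : Rm).
Proof.
move=> [f1 f2].
rewrite (_ : (fun x => _) = (fun x => Num.sqrt (complex.Re (f x) ^+ 2 + complex.Im (f x) ^+ 2))); last first.
  by apply/funext => x; rewrite ncE.
apply: (measurableT_comp (f := @Num.sqrt R)); first exact: (continuous_measurable_fun (@sqrt_continuous R)).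
by apply: measurable_funD; apply: measurable_funX.
Qed.

End cmeas_rules.

Lemma measurable_Cn_coords d (T : measurableType d) (f : T -> Cn) :
  (forall k, cmeas setT (fun x => (f x : 'rV[C]_n) 0 k)) -> measurable_fun setT f.
Proof.
move=> hf; apply: measurable_to_Cn.
apply/measurable_fun_tnthP => k.
rewrite (_ : _ \o _ = (fun x => (complex.Re ((f x : 'rV[C]_n) 0 k) : Rm,
   complex.Im ((f x : 'rV[C]_n) 0 k) : Rm))); last first.
  by apply/funext => x; rewrite /= tnth_mktuple.
have [h1 h2] := hf k; exact: measurable_fun_pair.
Qed.

Lemma cmeas_comp d d' (T : measurableType d) (T' : measurableType d') (f : T' -> C) (g : T -> T') :
  cmeas setT f -> measurable_fun setT g -> cmeas setT (fun x => f (g x)).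
Proof. by move=> [f1 f2] mg; split; [apply: measurableT_comp f1 mg|apply: measurableT_comp f2 mg]. Qed.

Lemma cmeas_coord (k : 'I_n) : cmeas [set: Cn] (fun z : Cn => (z : 'rV[C]_n) 0 k).
Proof. exact: measurable_coord. Qed.
End lebesgue_Cn_theory.

Section volume.
Variables (R : realType) (n : nat).
Local Notation C := R[i].
Local Notation nc := (@Normc.normc R).
Local Notation Rm := (measurableTypeR R).
Local Notation Cn := (measCn R n).
Local Notation V := (@lebesgue_Cn R n).
Implicit Types (z w u v a : 'rV[C]_n).

Lemma cmeas_coordT d (T : measurableType d) (f : T -> Cn) k : measurable_fun setT f ->
  cmeas setT (fun x => (f x : 'rV[C]_n) 0 k).
Proof. by move=> mf; exact: cmeas_comp (@cmeas_coord R n k) mf. Qed.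

Lemma measurable_CnD d (T : measurableType d) (f g : T -> Cn) :
  measurable_fun setT f -> measurable_fun setT g ->
  measurable_fun setT (fun x => ((f x : 'rV[C]_n) + g x : Cn)).
Proof.
move=> mf mg; apply: measurable_Cn_coords => k.
rewrite (_ : (fun x => _) = (fun x => (f x : 'rV[C]_n) 0 k + (g x : 'rV[C]_n) 0 k)).
  by apply: cmeasD; exact: cmeas_coordT.
by apply/funext => x; rewrite mxE.
Qed.

Lemma measurable_CnZ d (T : measurableType d) (c : T -> C) (f : T -> Cn) :
  cmeas setT c -> measurable_fun setT f ->
  measurable_fun setT (fun x => (c x *: (f x : 'rV[C]_n) : Cn)).
Proof.
move=> mc mf; apply: measurable_Cn_coords => k.
rewrite (_ : (fun x => _) = (fun x => c x * (f x : 'rV[C]_n) 0 k)).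
  by apply: cmeasM => //; exact: cmeas_coordT.
by apply/funext => x; rewrite mxE.
Qed.

Lemma measurable_CnB d (T : measurableType d) (f g : T -> Cn) :
  measurable_fun setT f -> measurable_fun setT g ->
  measurable_fun setT (fun x => ((f x : 'rV[C]_n) - g x : Cn)).
Proof.
move=> mf mg; rewrite (_ : (fun x => _) = (fun x => ((f x : 'rV[C]_n) + (-1) *: (g x : 'rV[C]_n) : Cn))).
  by apply: measurable_CnD => //; apply: measurable_CnZ => //; exact: cmeas_cst.
by apply/funext => x; rewrite scaleN1r.
Qed.

Lemma measurable_mulmx (U : 'M[C]_n) :
  measurable_fun setT (fun z : Cn => ((z : 'rV[C]_n) *m U : Cn)).
Proof.
apply: measurable_Cn_coords => k.
rewrite (_ : (fun x => _) = (fun z : Cn => \sum_j (z : 'rV[C]_n) 0 j * U j k)).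
  apply: cmeas_sum => j; apply: cmeasM (cmeas_cst _ _); exact: cmeas_coord.
by apply/funext => x; rewrite mxE.
Qed.

Lemma cmeas_dotmx d (T : measurableType d) (f g : T -> Cn) :
  measurable_fun setT f -> measurable_fun setT g ->
  cmeas setT (fun x => dotmx (f x : 'rV[C]_n) (g x : 'rV[C]_n)).
Proof.
move=> mf mg; rewrite (_ : (fun x => _) = (fun x => \sum_j (f x : 'rV[C]_n) 0 j *
   ((g x : 'rV[C]_n) 0 j)^*%C)).
  by apply: cmeas_sum => j; apply: cmeasM; [|apply: cmeas_conj]; exact: cmeas_coordT.
by apply/funext => x; rewrite dotmxS.
Qed.

Lemma measurable_sqnorm d (T : measurableType d) (f : T -> Cn) :
  measurable_fun setT f -> measurable_fun setT (fun x => sqnorm (f x : 'rV[C]_n) : Rm).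
Proof. by move=> mf; have [] := cmeas_dotmx mf mf. Qed.

Lemma measurable_nrm d (T : measurableType d) (f : T -> Cn) :
  measurable_fun setT f -> measurable_fun setT (fun x => nrm (f x : 'rV[C]_n) : Rm).
Proof.
move=> mf; rewrite (_ : (fun x => _) = (fun x => Num.sqrt (sqnorm (f x : 'rV[C]_n)))).
  apply: (measurableT_comp (f := @Num.sqrt R)); last exact: measurable_sqnorm.
  exact: (continuous_measurable_fun (@sqrt_continuous R)).
by apply/funext => x; rewrite nrmE.
Qed.

Lemma measurable_delta d (T : measurableType d) (f : T -> Cn) :
  measurable_fun setT f -> measurable_fun setT (fun x => delta (f x : 'rV[C]_n) : Rm).
Proof.
move=> mf; rewrite (_ : (fun x => _) = (fun x => 1 - sqnorm (f x : 'rV[C]_n))).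
  by apply: measurable_funB; [exact: measurable_cst|exact: measurable_sqnorm].
by apply/funext => x; rewrite deltaE.
Qed.

Lemma measurable_unit_ball : measurable (@unit_ball R n : set Cn).
Proof.
have := @measurable_sqnorm _ _ id (@measurable_id _ Cn setT) measurableT _
  (measurable_itv `]-oo, (1:R)[).
rewrite setTI; congr measurable; apply/seteqP; split => z /=; by rewrite in_itv.
Qed.

Lemma mpres_translation w : measure_preserving V (fun z : Cn => ((z : 'rV[C]_n) + w : Cn)).
Proof.
have mt : measurable_fun setT (fun z : Cn => ((z : 'rV[C]_n) + w : Cn)).
  apply: measurable_CnD; [exact: measurable_id|exact: measurable_cst].
split => // A mA.
have [_ H] := mpres_tuple (fun k : 'I_n => mpres_plane (complex.Re (w 0 k), complex.Im (w 0 k))).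
have mB : measurable ((@of_real_coords R n : _ -> Cn) @^-1` A).
  by rewrite -[X in measurable X]setTI; apply: measurable_of_real_coords.
apply: etrans (H _ mB); rewrite /lebesgue_Cn /pushforward; congr (tuple_measure _ _ _).
apply/seteqP; split => t /=; rewrite (_ : of_real_coords [tuple _ | _ < _] = of_real_coords t + w)//;
  by apply/rowP => k; rewrite !mxE tnth_mktuple; case: (w 0 k).
Qed.

(** Open sets, described by Euclidean balls. *)
Definition Copen (O : set 'rV[C]_n) := forall z, O z ->
  exists2 d : R, 0 < d & forall h, nrm h < d -> O (z + h).

(** Boxes of side [2 / (m + 1)] with rational centre: a countable base. *)
Definition rbox (q : 'rV[rat * rat]_n) (m : nat) : set 'rV[C]_n := [set z | forall k,
  `|complex.Re (z 0 k) - ratr (q 0 k).1| < m.+1%:R^-1 /\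
  `|complex.Im (z 0 k) - ratr (q 0 k).2| < m.+1%:R^-1].

Lemma measurable_rbox q m : measurable (rbox q m : set Cn).
Proof.
have -> : (rbox q m : set Cn) = \bigcap_(k in [set: 'I_n]) ([set z : Cn |
    `|complex.Re ((z : 'rV[C]_n) 0 k) - ratr (q 0 k).1| < m.+1%:R^-1] `&` [set z : Cn |
    `|complex.Im ((z : 'rV[C]_n) 0 k) - ratr (q 0 k).2| < m.+1%:R^-1]).
  by apply/seteqP; split => [z hz k _|z hz k]; [exact: hz|exact: (hz k I)].
apply: fin_bigcap_measurable; first exact: finite_finset.
move=> k _; have [h1 h2] := @cmeas_coord R n k.
have H (F : Cn -> Rm) (c : R) : measurable_fun setT F -> measurable [set z : Cn | `|F z - c| < m.+1%:R^-1].
  move=> mF; have : measurable_fun setT (fun y : Cn => `|F y - c| : Rm).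
    by apply: measurableT_comp => //; apply: measurable_funB => //; exact: measurable_cst.
  move=> /(_ measurableT _ (measurable_itv `]-oo, m.+1%:R^-1[)); rewrite setTI.
  by congr measurable; apply/seteqP; split => z /=; rewrite in_itv.
by apply: measurableI; exact: H.
Qed.

(** An open set is the countable union of the rational boxes it contains. *)
Lemma measurable_Copen (O : set 'rV[C]_n) : Copen O -> measurable (O : set Cn).
Proof.
move=> oO.
have -> : (O : set Cn) = \bigcup_(qm in [set qm : 'rV[rat * rat]_n * nat | rbox qm.1 qm.2 `<=` O]) rbox qm.1 qm.2.
  apply/seteqP; split => z; last by move=> [qm /= h]; exact: h.
  move=> /oO[d d0 Hd].
  (* Fine enough for a box containing [z] to lie in the ball of radius [d]. *)
  pose m := Num.truncn (n%:R * 4 / d).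
  have hm : n%:R * (4 / m.+1%:R) < d.
    rewrite mulrA ltr_pdivrMr ?ltr0Sn// [ltRHS]mulrC -ltr_pdivrMr//; exact: truncnS_gt.
  have m0 : 0 < m.+1%:R^-1 :> R by rewrite invr_gt0.
  have app (x : R) : exists q : rat, `|x - ratr q| < m.+1%:R^-1.
    have [|q] := @rat_in_itvoo R (x - m.+1%:R^-1) (x + m.+1%:R^-1).
      by rewrite ltrD2l gtrN.
    rewrite in_itv/= => /andP[q1 q2]; exists q.
    move: q1 q2; move: (m.+1%:R^-1) (ratr q : R) => c y; clear => q1 q2.
    by rewrite ltr_norml; apply/andP; split; lra.
  have /choice[q Hq] : forall k : 'I_n, exists q : rat * rat,
      `|complex.Re (z 0 k) - ratr q.1| < m.+1%:R^-1 /\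
      `|complex.Im (z 0 k) - ratr q.2| < m.+1%:R^-1.
    by move=> k; have [q1 h1] := app (complex.Re (z 0 k)); have [q2 h2] := app (complex.Im (z 0 k)); exists (q1, q2).
  exists (\row_k q k, m) => /=; last by move=> k; rewrite mxE; exact: Hq.
  move=> y hy; rewrite -(subrKC z y); apply: Hd; apply: le_lt_trans hm.
  apply: nrm_le_coord => k; rewrite !mxE; apply: (le_trans (ler_nc_ReIm _)).
  have [h1 h2] := hy k; have [h3 h4] := Hq k; rewrite mxE in h1 h2; rewrite !cReImE.
  have e (x p s : R) : `|x - s| < m.+1%:R^-1 -> `|p - s| < m.+1%:R^-1 -> `|x - p| <= 2 * m.+1%:R^-1.
    move=> ha hb; have -> : x - p = (x - s) - (p - s) by ring.
    by rewrite (le_trans (ler_normB _ _))// mulr2n mulrDl mul1r lerD// ltW.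
  have := lerD (e _ _ _ h1 h3) (e _ _ _ h2 h4); move/le_trans; apply.
  by rewrite -mulrDl; apply: ler_wpM2r => //; rewrite -natrD.
rewrite bigcup_mkcond; apply: countable_bigcupT_measurable => // qm.
by case: ifP => // _; exact: measurable_rbox.
Qed.

End volume.

(** * Uniqueness of the translation invariant measure *)
(** Induction on the length, peeling off one factor at a time. *)
Lemma tuple_measure_box d (T : measurableType d) (R : realType)
  (mu : {sigma_finite_measure set T -> \bar R}) n (Q : 'I_n -> set T) (q : 'I_n -> R) :
  (forall k, measurable (Q k)) -> (forall k, mu (Q k) = (q k)%:E) ->
  measurable [set t : n.-tuple T | forall k, Q k (tnth t k)] /\
  tuple_measure mu n [set t : n.-tuple T | forall k, Q k (tnth t k)] =
    (\prod_(k < n) q k)%:E.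
Proof.
elim: n Q q => [|n IH] Q q mQ hq.
  have -> : [set t : 0.-tuple T | forall k, Q k (tnth t k)] = setT.
    by apply/seteqP; split => // t _ [].
  by split => //=; rewrite big_ord0 diracT.
have [m1 h1] := IH (fun k => Q (lift ord0 k)) (fun k => q (lift ord0 k))
  (fun k => mQ _) (fun k => hq _).
split.
  have -> : [set t : n.+1.-tuple T | forall k, Q k (tnth t k)] =
     \bigcap_(k in [set: 'I_n.+1]) ((fun t => tnth t k) @^-1` Q k).
    by apply/seteqP; split => [t ht k _|t ht k]; [exact: ht|exact: (ht k I)].
  apply: fin_bigcap_measurable; first exact: finite_finset.
  by move=> k _; rewrite -[X in measurable X]setTI; apply: measurable_tnth.
rewrite /= /tuple_measure_succ /pushforward.
rewrite (_ : _ @^-1` _ = Q ord0 `*` [set t : n.-tuple T | forall k, Q (lift ord0 k) (tnth t k)]).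
  rewrite big_ord_recl EFinM -h1 -hq; exact: product_measure1E.
apply/seteqP; split => -[x t] /=.
  by move=> h; split; [have := h ord0|move=> k; have := h (lift ord0 k); rewrite tnthS].
move=> [h0 h] k; have [j ->|->] := unliftP ord0 k; last by [].
by rewrite tnthS.
Qed.

Lemma measurable_preim d d' (T : measurableType d) (T' : measurableType d') (f : T -> T') A :
  measurable_fun setT f -> measurable A -> measurable (f @^-1` A).
Proof. by move=> mf mA; rewrite -[X in measurable X]setTI; exact: mf. Qed.

Section haar.
Variables (R : realType) (n : nat).
Local Notation C := R[i].
Local Notation nc := (@Normc.normc R).
Local Notation Rm := (measurableTypeR R).
Local Notation Cn := (measCn R n).
Local Notation V := (@lebesgue_Cn R n).
Implicit Types (z w u v a : 'rV[C]_n).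

Definition box (c : 'rV[C]_n) (rho : 'I_n -> R) : set Cn := [set z : Cn | forall k,
  complex.Re ((z : 'rV[C]_n) 0 k) \in `[complex.Re (c 0 k) - rho k, complex.Re (c 0 k) + rho k] /\
  complex.Im ((z : 'rV[C]_n) 0 k) \in `[complex.Im (c 0 k) - rho k, complex.Im (c 0 k) + rho k]].

Lemma volume_box c rho : (forall k, 0 <= rho k) ->
  measurable (box c rho) /\ V (box c rho) = (\prod_(k < n) (2 * rho k) ^+ 2)%:E.
Proof.
move=> rho0.
pose Q k : set (Rm * Rm) := `[complex.Re (c 0 k) - rho k, complex.Re (c 0 k) + rho k] `*`
   `[complex.Im (c 0 k) - rho k, complex.Im (c 0 k) + rho k].
have itv (x r : R) : 0 <= r -> lebesgue_measure (`[x - r, x + r]%classic : set Rm) = (2 * r)%:E.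
  move=> r0; rewrite lebesgue_measure_itv/= lte_fin.
  have -> : 2 * r = (x + r) - (x - r) by ring.
  case: ltP => // h; congr EFin; lra.
have mQ k : measurable (Q k) by apply: measurableX.
have hQ k : @lebesgue_plane R (Q k) = ((2 * rho k) ^+ 2)%:E.
  by rewrite /lebesgue_plane product_measure1E// expr2 EFinM; congr (_ * _)%E; exact: itv.
have [m1 h1] := @tuple_measure_box _ _ R (@lebesgue_plane R) n Q _ mQ hQ.
have e : (@real_coords R n) @^-1` [set t | forall k, Q k (tnth t k)] = box c rho.
  by apply/seteqP; split => z /= h k; have := h k; rewrite /Q/= tnth_mktuple/= !in_itv.
split.
  by rewrite -e -[X in measurable X]setTI; apply: measurable_real_coords.
rewrite -h1 -e /lebesgue_Cn /pushforward; congr (tuple_measure _ _ _).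
by apply/seteqP; split => t /=; rewrite of_real_coordsK.
Qed.

Definition Copp (A : set Cn) : set Cn := [set z : Cn | A (- (z : 'rV[C]_n))].

(** Two translation invariant measures are proportional. Compute the measure
    of the pairs [(x, y)] with [x] in [A] and [x + y] in [B] for the product
    of [m] and [V] in both orders: integrating in [y] first gives [m A * V B]
    by invariance of [V], and substituting [x - y] for [x] first gives [m B *
    V (- A)] by invariance of [m]. *)
Lemma haar_unique (m : {sigma_finite_measure set Cn -> \bar R}) (A B : set Cn) :
  (forall w, measure_preserving m (fun z : Cn => ((z : 'rV[C]_n) + w : Cn))) ->
  measurable A -> measurable B ->
  (m A * V B = m B * V (Copp A))%E.
Proof.
move=> hm mA mB.
pose S : set (Cn * Cn) := [set x | A x.1 /\ B ((x.1 : 'rV[C]_n) + x.2)].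
pose S' : set (Cn * Cn) := [set x | A ((x.1 : 'rV[C]_n) - x.2) /\ B x.1].
have mD : measurable_fun setT (fun x : Cn * Cn => ((x.1 : 'rV[C]_n) + x.2 : Cn)).
  by apply: measurable_CnD; [exact: measurable_fst|exact: measurable_snd].
have mBm : measurable_fun setT (fun x : Cn * Cn => ((x.1 : 'rV[C]_n) - x.2 : Cn)).
  by apply: measurable_CnB; [exact: measurable_fst|exact: measurable_snd].
have mS : measurable S.
  apply: measurableI.
    exact: (measurable_preim (@measurable_fst _ _ Cn Cn) mA).
  exact: (measurable_preim mD mB).
have mS' : measurable S'.
  apply: measurableI.
    exact: (measurable_preim mBm mA).
  exact: (measurable_preim (@measurable_fst _ _ Cn Cn) mB).
have prodE (E : set (Cn * Cn)) : measurable E ->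
    (\int[m]_x V (xsection E x) = \int[V]_y m (ysection E y))%E.
  move=> mE; have := @product_measure_unique _ _ _ _ R m V (m \x^ V)%E _ E mE.
  apply; move=> A1 A2 mA1 mA2; exact: product_measure2E.
have ySS' y : m (ysection S y) = m (ysection S' y).
  have mys : measurable (ysection S' y) by exact: measurable_ysection.
  apply: etrans ((hm y).2 _ mys); congr (m _); apply/seteqP; split => x /=;
    by rewrite !ysectionE /= /S /S' /= addrK.
have := prodE _ mS; under [in RHS]eq_integral do rewrite ySS'; rewrite -(prodE _ mS').
have -> : (\int[m]_x V (xsection S x) = m A * V B)%E.
  transitivity (\int[m]_x (V B * (\1_A x)%:E))%E.
    apply: eq_integral => x _; rewrite indicE; case: (asboolP (A x)) => Ax.
      rewrite mem_set// mule1; apply: etrans ((@mpres_translation R n x).2 _ mB).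
      congr (V _); apply/seteqP; split => y /=; rewrite xsectionE/= /S/= addrC; tauto.
    rewrite memNset// mule0; rewrite (_ : xsection S x = set0) ?measure0//.
    by apply/seteqP; split => y //=; rewrite xsectionE/= /S/= => -[].
  rewrite ge0_integralZl//; last by apply/measurable_EFinP; exact: measurable_indic.
  by rewrite integral_indic// setIT muleC.
move=> ->.
transitivity (\int[m]_x (V (Copp A) * (\1_B x)%:E))%E.
  apply: eq_integral => x _; rewrite indicE; case: (asboolP (B x)) => Bx.
    rewrite mem_set// mule1.
    have mN : measurable (Copp A).
      have mo : measurable_fun setT (fun z : Cn => (- (z : 'rV[C]_n) : Cn)).
        rewrite (_ : (fun z => _) = (fun z : Cn => ((0 : 'rV[C]_n) - (z : 'rV[C]_n) : Cn))).
          by apply: measurable_CnB; [exact: measurable_cst|exact: measurable_id].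
        by apply/funext => z; rewrite sub0r.
      exact: (measurable_preim mo mA).
    apply: etrans ((@mpres_translation R n (- x)).2 _ mN).
    by congr (V _); apply/seteqP; split => y /=; rewrite xsectionE/= /S' /Copp /= opprB; tauto.
  rewrite memNset// mule0; rewrite (_ : xsection S' x = set0) ?measure0//.
  by apply/seteqP; split => y //=; rewrite xsectionE/= /S'/= => -[].
rewrite ge0_integralZl//; last by apply/measurable_EFinP; exact: measurable_indic.
by rewrite integral_indic// setIT muleC.
Qed.
End haar.

(** * Linear changes of variables *)
Section pushforward_inverse.
Context d (T : measurableType d) (R : realType).
Variables (m : {sigma_finite_measure set T -> \bar R}) (phi psi : T -> T).
Hypotheses (mphi : measurable_fun setT phi) (mpsi : measurable_fun setT psi).
Hypothesis phiK : cancel phi psi.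

(** The image of a sigma-finite measure under a bijection measurable in both
    directions. The measurability hypotheses are arguments because the measure
    structure depends on them. *)
Definition image_measure of measurable_fun setT phi & measurable_fun setT psi
  & cancel phi psi : set T -> \bar R := pushforward m phi.

Local Notation im := (image_measure mphi mpsi phiK).

Let im0 : im set0 = 0%E.
Proof. by rewrite /image_measure /pushforward preimage_set0 measure0. Qed.

Let im_ge0 A : (0 <= im A)%E.
Proof. exact: measure_ge0. Qed.

Let im_additive : semi_sigma_additive im.
Proof.
exact: (@measure_semi_sigma_additive _ _ _
  (measure_function_pushforward__canonical__measure_function_Measure m mphi)).
Qed.

HB.instance Definition _ := isMeasure.Build _ _ _ im im0 im_ge0 im_additive.

Let im_sigma_finite : sigma_finite setT im.
Proof.
have /sigma_finiteP[F [TF ndF Foo]] := sigma_finiteT m.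
exists (fun k => psi @^-1` F k).
  apply/seteqP; split=> // z _.
  have [i _ Fi] : (\bigcup_k F k) (psi z) by rewrite -TF.
  by exists i.
move=> k; have [mF Fk] := Foo k; split; first exact: (measurable_preim mpsi mF).
rewrite /image_measure /pushforward (_ : _ @^-1` _ = F k)//.
by apply/seteqP; split => z /=; rewrite phiK.
Qed.

HB.instance Definition _ := Measure_isSigmaFinite.Build _ _ _ im im_sigma_finite.
End pushforward_inverse.

Lemma lee_of_pmul2r (R : realType) (c : R) (x y : \bar R) : 0 < c ->
  (x * c%:E <= y * c%:E)%E -> (x <= y)%E.
Proof. by move=> c0; rewrite leNgt lte_pmul2r ?lte_fin// -leNgt. Qed.

Section linear_change.
Variables (R : realType) (n : nat).
Local Notation C := R[i].
Local Notation nc := (@Normc.normc R).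
Local Notation Rm := (measurableTypeR R).
Local Notation Cn := (measCn R n).
Local Notation V := (@lebesgue_Cn R n).
Implicit Types (z w u v a : 'rV[C]_n).

(** An additive bimeasurable bijection transports [V] to a translation
    invariant measure, so that its effect on volumes is a constant factor,
    read off from one test set [A]. *)
Lemma haar_linear (phi psi : Cn -> Cn) (A B : set Cn) :
  measurable_fun setT phi -> measurable_fun setT psi ->
  cancel phi psi -> cancel psi phi ->
  (forall z w, phi (z + w) = (phi z : 'rV[C]_n) + phi w) ->
  measurable A -> Copp A = A -> measurable B ->
  (V (phi @^-1` A) * V B = V (phi @^-1` B) * V A)%E.
Proof.
move=> mphi mpsi pK Kp phiD mA oA mB.
pose m : {sigma_finite_measure set Cn -> \bar R} := image_measure V mphi mpsi pK.
have mm (w : 'rV[C]_n) : measure_preserving m (fun z : Cn => ((z : 'rV[C]_n) + w : Cn)).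
  have [mt _] := @mpres_translation R n w; split => // D mD.
  have mpD : measurable (phi @^-1` D) by exact: (measurable_preim mphi mD).
  change (V (phi @^-1` ((fun z : Cn => ((z : 'rV[C]_n) + w : Cn)) @^-1` D)) = V (phi @^-1` D)).
  apply: etrans ((@mpres_translation R n (psi w)).2 _ mpD); congr (V _).
  by apply/seteqP; split => z /=; rewrite phiD Kp.
have := haar_unique mm mA mB; rewrite oA; exact.
Qed.

Lemma ball_volume_gt0_lty : (0 < V (@unit_ball R n))%E /\ (V (@unit_ball R n) < +oo)%E.
Proof.
have m0 : 0 < n.+1%:R^-1 / 2 :> R by rewrite divr_gt0// invr_gt0.
split.
  have [mb hb] := @volume_box R n 0 (fun=> n.+1%:R^-1 / 2) (fun=> ltW m0).
  apply: (@lt_le_trans _ _ (V (@box R n 0 (fun=> n.+1%:R^-1 / 2)))).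
    by rewrite hb lte_fin prodr_gt0// => k _; rewrite exprn_gt0// mulr_gt0.
  apply: le_measure; rewrite ?inE//; first exact: measurable_unit_ball.
  move=> z hz; apply/in_unit_ball.
  apply: (@le_lt_trans _ _ (n%:R * n.+1%:R^-1)).
    apply: nrm_le_coord => k; apply: (le_trans (ler_nc_ReIm _)).
    have [] := hz k; rewrite !mxE !in_itv/= !sub0r !add0r -!ler_norml => h1 h2.
    by rewrite (splitr n.+1%:R^-1) lerD.
  by rewrite ltr_pdivrMr ?ltr0Sn// mul1r ltr_nat.
have [mb hb] := @volume_box R n 0 (fun=> 1) (fun=> ler01).
apply: (@le_lt_trans _ _ (V (@box R n 0 (fun=> 1)))); last by rewrite hb ltry.
apply: le_measure; rewrite ?inE//; first exact: measurable_unit_ball.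
move=> z /in_unit_ball z1 k; rewrite !mxE !in_itv/= !sub0r !add0r -!ler_norml.
have h := le_trans (nc_coord z k) (ltW z1).
by split; apply: le_trans h; [exact: ler_nc_Re|exact: ler_nc_Im].
Qed.

(** The constant factor is 1, as the unit ball is invariant. *)
Lemma mpres_isometry (phi psi : Cn -> Cn) :
  measurable_fun setT phi -> measurable_fun setT psi ->
  cancel phi psi -> cancel psi phi ->
  (forall z w, phi (z + w) = (phi z : 'rV[C]_n) + phi w) ->
  (forall z, nrm (phi z : 'rV[C]_n) = nrm z) ->
  measure_preserving V phi.
Proof.
move=> mphi mpsi pK Kp phiD phiN; split => // B mB.
have [V0 Voo] := ball_volume_gt0_lty.
have mU := @measurable_unit_ball R n.
have oU : Copp (@unit_ball R n) = (@unit_ball R n).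
  by apply/seteqP; split => z /=; rewrite /Copp /= !in_unit_ball nrmN.
have := haar_linear mphi mpsi pK Kp phiD mU oU mB.
have -> : phi @^-1` (@unit_ball R n) = (@unit_ball R n).
  by apply/seteqP; split => z /=; rewrite !in_unit_ball phiN.
have fV : V (@unit_ball R n) \is a fin_num by rewrite ge0_fin_numE// ltW.
have f0 : 0 < fine (V (@unit_ball R n)) by exact: (fine_gt0 (introT andP (conj V0 Voo))).
rewrite muleC -(fineK fV); move: (fine _) f0 => x x0.
move: (V B) (V (phi @^-1` B)) => y y' e.
by apply: le_anti; apply/andP; split; apply: (lee_of_pmul2r x0); rewrite e.
Qed.

Lemma dotmx_unitary (U : 'M[C]_n) z w : U \is unitarymx ->
  dotmx (z *m U) (w *m U) = dotmx z w.
Proof.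
move=> /unitarymxP hU; rewrite !dotmxE trmx_mul map_mxM mulmxA.
by rewrite -(mulmxA z) hU mulmx1.
Qed.

Lemma nrm_unitary (U : 'M[C]_n) z : U \is unitarymx -> nrm (z *m U) = nrm z.
Proof. by move=> hU; rewrite !nrmE /sqnorm dotmx_unitary. Qed.

Lemma mpres_unitary (U : 'M[C]_n) : U \is unitarymx ->
  measure_preserving V (fun z : Cn => ((z : 'rV[C]_n) *m U : Cn)).
Proof.
move=> hU; apply: (@mpres_isometry _ (fun z : Cn => ((z : 'rV[C]_n) *m invmx U : Cn))).
- exact: measurable_mulmx.
- exact: measurable_mulmx.
- by move=> z; rewrite /= mulmxK// unitarymx_unit.
- by move=> z; rewrite /= mulmxKV// unitarymx_unit.
- by move=> z w; rewrite mulmxDl.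
- by move=> z; rewrite nrm_unitary.
Qed.

Lemma mpres_rotation (t : R) : measure_preserving V (fun z : Cn => (cis t *: (z : 'rV[C]_n) : Cn)).
Proof.
have m s : measurable_fun setT (fun z : Cn => (cis s *: (z : 'rV[C]_n) : Cn)).
  by apply: measurable_CnZ; [exact: cmeas_cst|exact: measurable_id].
apply: (@mpres_isometry _ (fun z : Cn => (cis (- t) *: (z : 'rV[C]_n) : Cn))) => //.
- by move=> z; rewrite /= scalerA mulrC cisNM scale1r.
- by move=> z; rewrite /= scalerA cisNM scale1r.
- by move=> z w; rewrite scalerDr.
- by move=> z; rewrite nrmZ nc_cis mul1r.
Qed.

(** The constant factor is read off from a cube: volumes are divided by [s ^
    (2 n)]. *)
Lemma volume_dilation (s : R) (B : set Cn) : 0 < s -> s <= 1 -> measurable B ->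
  (V B <= V ((fun z : Cn => (s%:C%C *: (z : 'rV[C]_n) : Cn)) @^-1` B))%E.
Proof.
move=> s0 s1 mB.
have m (c : R) : measurable_fun setT (fun z : Cn => (c%:C%C *: (z : 'rV[C]_n) : Cn)).
  by apply: measurable_CnZ; [exact: cmeas_cst|exact: measurable_id].
have sK : s%:C%C * s^-1%:C%C = 1 :> C by rewrite -rmorphM mulfV ?gt_eqF.
have [mA hA] := @volume_box R n 0 (fun=> 1) (fun=> ler01).
have oA : Copp (@box R n 0 (fun=> 1)) = @box R n 0 (fun=> 1).
  apply/seteqP; split => z /= h k; have := h k; rewrite !mxE !cReImE !in_itv/= !sub0r !add0r;
    by rewrite !lerN2 ![- _ <= 1]lerNl => -[/andP[-> ->] /andP[-> ->]].
have := @haar_linear (fun z : Cn => (s%:C%C *: (z : 'rV[C]_n) : Cn))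
  (fun z : Cn => (s^-1%:C%C *: (z : 'rV[C]_n) : Cn)) _ B (m s) (m s^-1) _ _ _ mA oA mB.
have cr (x c : R) : 0 < c -> (- 1 <= c * x <= 1) = (- c^-1 <= x <= c^-1).
  move=> c0; rewrite -!ler_norml normrM gtr0_norm// -(ler_pM2l (c0 : 0 < c) `|x|) mulfV ?gt_eqF//.
have s'0 : 0 < s^-1 by rewrite invr_gt0.
have [mA' hA'] := @volume_box R n 0 (fun=> s^-1) (fun=> ltW s'0).
have -> : (fun z : Cn => (s%:C%C *: (z : 'rV[C]_n) : Cn)) @^-1` (@box R n 0 (fun=> 1)) =
   @box R n 0 (fun=> s^-1).
  apply/seteqP; split => z /= h k; have := h k;
    by rewrite !mxE !cReImE /= !mul0r subr0 addr0 !in_itv/= !sub0r !add0r !cr.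
rewrite hA hA' => /(_ _ _ _)H.
have {H} : ((\prod_(k < n) (2 * s^-1) ^+ 2)%:E * V B =
  V ((fun z : Cn => (s%:C%C *: (z : 'rV[C]_n) : Cn)) @^-1` B) * (\prod_(k < n) (2 * 1) ^+ 2)%:E)%E.
  apply: H.
  - by move=> z; rewrite /= scalerA mulrC sK scale1r.
  - by move=> z; rewrite /= scalerA sK scale1r.
  - by move=> z w; rewrite scalerDr.
rewrite muleC => e.
have p0 : 0 < \prod_(k < n) (2 * 1 : R) ^+ 2 by rewrite prodr_gt0// => k _; rewrite exprn_gt0// mulr1.
apply: (lee_of_pmul2r p0); rewrite -e.
apply: lee_wpmul2l; first exact: measure_ge0.
rewrite lee_fin; apply: ler_prod => k _; rewrite sqr_ge0/=.
rewrite ler_pXn2r ?nnegrE ?mulr_ge0 ?(ltW s'0)// ler_pM2l//.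
by rewrite invf_ge1.
Qed.
End linear_change.

(** Complete the line of [a] to an orthonormal basis by the Gram-Schmidt
    process; in these coordinates the scalar product with [a] only involves
    the first one. *)
Lemma unitary_align (R : realType) (n : nat) (a : 'rV[R[i]]_n.+1) :
  exists2 U : 'M[R[i]]_n.+1, U \is unitarymx &
  exists2 c : R[i], Normc.normc c = nrm a &
   forall z : 'rV[R[i]]_n.+1, dotmx (z *m U) a = c^*%C * z 0 0.
Proof.
pose A : 'M[R[i]]_n.+1 := \matrix_i a.
exists (schmidt A); first exact: schmidt_unitarymx.
have hU : schmidt A \is unitarymx by exact: schmidt_unitarymx.
have := row_schmidt_sub A 0.
rewrite (big_pred1 ord0) => [|k]; last first.
  by rewrite /= leqn0 -val_eqE.
rewrite rowK genmxE => /sub_rVP[c ac].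
have e : row 0 (schmidt A) = delta_mx 0 0 *m schmidt A by rewrite -rowE.
have d : forall z : 'rV[R[i]]_n.+1, dotmx z (delta_mx 0 0) = z 0 0.
  move=> z; rewrite dotmxS (bigD1 0)//= big1 ?addr0 => [|k k0].
    by rewrite mxE !eqxx conjc1 mulr1.
  by rewrite mxE (negPf k0) andbF conjc0 mulr0.
exists c.
  rewrite ac nrmZ e nrm_unitary// nrmE /sqnorm d mxE !eqxx /= sqrtr1 mulr1//.
by move=> z; rewrite ac dotmxZr e dotmx_unitary// d.
Qed.

(** * The area mean value inequality *)
Section one_dimensional.
Variable R : realType.
Implicit Types (p x y K b : R).

(** The tangent line of a convex power lies below its graph; this is Young's
    inequality with the conjugate exponent [p / (p - 1)]. *)
Lemma powR_tangent p x y : 1 <= p -> 0 <= x -> 0 <= y ->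
  p * (x * y `^ (p - 1)) <= x `^ p + (p - 1) * y `^ p.
Proof.
rewrite le_eqVlt => /predU1P[<- x0 y0|p1 x0 y0].
  by rewrite subrr powRr0 mulr1 mul0r addr0 mul1r powRr1.
have p0 : 0 < p := lt_trans ltr01 p1.
have p10 : 0 < p - 1 by rewrite subr_gt0.
have := @conjugate_powR R x (y `^ (p - 1)) p (p / (p - 1)) x0 (powR_ge0 _ _) p0
  (divr_gt0 p0 p10).
have -> : p^-1 + (p / (p - 1))^-1 = 1 by field; rewrite !gt_eqF.
have -> : y `^ (p - 1) `^ (p / (p - 1)) = y `^ p.
  by rewrite -powRrM; congr (_ `^ _); field; rewrite gt_eqF.
move=> /(_ erefl); rewrite -(ler_pM2l p0) => /le_trans; apply.
rewrite le_eqVlt; apply/orP; left; apply/eqP; field.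
by rewrite !gt_eqF.
Qed.

(** Quantities comparable up to [K] have comparable powers, whatever the sign
    of the exponent. *)
Lemma powR_comparable b K x y : 0 < K -> 0 < x -> 0 < y -> x <= K * y -> y <= K * x ->
  x `^ b <= K `^ `|b| * y `^ b.
Proof.
move=> K0 x0 y0 xy yx; have [b0|b0] := leP 0 b.
  by rewrite ger0_norm// -powRM ?(ltW K0) ?(ltW y0)// ge0_ler_powR// ?nnegrE ?(ltW x0) ?mulr_ge0 ?(ltW K0) ?(ltW y0).
rewrite ltr0_norm// -[b in x `^ b]opprK -[b in y `^ b]opprK !(powRN _ (- b)).
have b'0 : 0 <= - b by rewrite oppr_ge0 ltW.
rewrite ler_pdivlMr ?powR_gt0// mulrC ler_pdivrMr ?powR_gt0//.
by rewrite -powRM ?(ltW K0) ?(ltW x0)// ge0_ler_powR// ?nnegrE ?(ltW y0) ?mulr_ge0 ?(ltW K0) ?(ltW x0).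
Qed.

Lemma nc_cint_le (a b : R) (g : R -> R[i]) (h : R -> R) : ccont_on a b g ->
  measurable_fun setT (h : measurableTypeR R -> measurableTypeR R) ->
  (forall t, a <= t <= b -> Normc.normc (g t) <= h t) ->
  ((Normc.normc (cint a b g))%:E <=
    2%:E * \int[@lebesgue_measure R]_(t in `[a, b]) (h t)%:E)%E.
Proof.
move=> /ccont_on_integrable[g1 g2] mh gh.
have H (u : R -> R) : (@lebesgue_measure R).-integrable `[a, b] (EFin \o u) ->
    (forall t, a <= t <= b -> `|u t| <= h t) ->
    (`| \int[@lebesgue_measure R]_(t in `[a, b]) u t|%:E <=
     \int[@lebesgue_measure R]_(t in `[a, b]) (h t)%:E)%E.
  move=> iu uh; have iu' := integrable_abse iu.
  apply: (@le_trans _ _ (\int[@lebesgue_measure R]_(t in `[a, b]) `|u t|)%:E).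
    by rewrite lee_fin; exact: (le_normr_Rintegral _ iu).
  rewrite /Rintegral fineK; last exact: (integrable_fin_num _ iu').
  apply: ge0_le_integral => //.
  - by case/integrableP : iu'.
  - by apply/measurable_EFinP; exact: measurable_funTS.
apply: (@le_trans _ _ (`|complex.Re (cint a b g)| + `|complex.Im (cint a b g)|)%:E).
  by rewrite lee_fin ler_nc_ReIm.
rewrite EFinD mule_natl mule2n; apply: leeD.
- by apply: H g1 _ => t /gh; apply/le_trans/ler_nc_Re.
- by apply: H g2 _ => t /gh; apply/le_trans/ler_nc_Im.
Qed.
End one_dimensional.

Lemma indic_ge0 (T : Type) (R : realType) (A : set T) x : 0 <= \1_A x :> R.
Proof. by rewrite indicE. Qed.

Section nonnegative_integrals.
Context d (T : measurableType d) (R : realType).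
Variable mu : {measure set T -> \bar R}.
Implicit Types (g h : T -> R) (D : set T).

Lemma integral_restrict D g : measurable D ->
  (\int[mu]_(x in D) (g x)%:E = \int[mu]_x (g x * \1_D x)%:E)%E.
Proof.
by move=> _; rewrite integral_mkcond; under eq_integral do rewrite epatch_indic.
Qed.

Lemma integral_scale (c : R) g : 0 <= c -> measurable_fun setT g -> (forall x, 0 <= g x) ->
  (\int[mu]_x (c * g x)%:E = c%:E * \int[mu]_x (g x)%:E)%E.
Proof.
move=> c0 mg g0; under eq_integral do rewrite EFinM.
rewrite ge0_integralZl_EFin//; last exact/measurable_EFinP.
by move=> x _; rewrite lee_fin.
Qed.

Lemma integral_mono g h : measurable_fun setT g -> measurable_fun setT h ->
  (forall x, 0 <= g x) -> (forall x, g x <= h x) ->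
  (\int[mu]_x (g x)%:E <= \int[mu]_x (h x)%:E)%E.
Proof.
move=> mg mh g0 gh; apply: ge0_le_integral => //.
- by move=> x _; rewrite lee_fin.
- exact/measurable_EFinP.
- exact/measurable_EFinP.
- by move=> x _; rewrite lee_fin.
Qed.

Lemma nonneg_integralD g h : measurable_fun setT g -> measurable_fun setT h ->
  (forall x, 0 <= g x) -> (forall x, 0 <= h x) ->
  (\int[mu]_x (g x + h x)%:E = \int[mu]_x (g x)%:E + \int[mu]_x (h x)%:E)%E.
Proof.
move=> mg mh g0 h0; under eq_integral do rewrite EFinD.
rewrite ge0_integralD//.
- by move=> x _; rewrite lee_fin.
- exact/measurable_EFinP.
- by move=> x _; rewrite lee_fin.
- exact/measurable_EFinP.
Qed.
Lemma integral_indic_scale (c : R) D : 0 <= c -> measurable D ->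
  (\int[mu]_x (c * \1_D x)%:E = c%:E * mu D)%E.
Proof.
move=> c0 mD; rewrite integral_scale//.
by rewrite integral_indic// setIT.
Qed.
End nonnegative_integrals.

Lemma ge0_integral_mono d (T : measurableType d) (R : realType)
    (mu : {measure set T -> \bar R}) (g h : T -> \bar R) :
  measurable_fun setT g -> measurable_fun setT h -> (forall x, (0 <= g x)%E) ->
  (forall x, (g x <= h x)%E) -> (\int[mu]_x g x <= \int[mu]_x h x)%E.
Proof.
move=> mg mh g0 gh; apply: ge0_le_integral => //.
Qed.

Lemma tonelli d1 d2 (T1 : measurableType d1) (T2 : measurableType d2) (R : realType)
    (m1 : {sigma_finite_measure set T1 -> \bar R})
    (m2 : {sigma_finite_measure set T2 -> \bar R})
    (g : T1 -> T2 -> R) :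
  measurable_fun setT (fun x : T1 * T2 => g x.1 x.2) -> (forall x y, 0 <= g x y) ->
  [/\ measurable_fun setT (fun x => \int[m2]_y (g x y)%:E)%E,
      measurable_fun setT (fun y => \int[m1]_x (g x y)%:E)%E &
      (\int[m1]_x \int[m2]_y (g x y)%:E = \int[m2]_y \int[m1]_x (g x y)%:E)%E].
Proof.
move=> mg g0; have mG : measurable_fun setT (fun x : T1 * T2 => (g x.1 x.2)%:E).
  exact/measurable_EFinP.
have G0 (x : T1 * T2) : (0 <= (g x.1 x.2)%:E)%E by rewrite lee_fin.
split; first exact: (@measurable_fun_fubini_tonelli_F _ _ _ _ _ m2 _ mG G0).
- exact: (@measurable_fun_fubini_tonelli_G _ _ _ _ _ m1 _ mG G0).
- exact: (@fubini_tonelli _ _ _ _ _ m1 m2 _ mG G0).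
Qed.

Section area_mean_value.
Variables (R : realType) (n : nat).
Local Notation C := R[i].
Local Notation nc := (@Normc.normc R).
Local Notation Rm := (measurableTypeR R).
Local Notation Cn := (measCn R n).
Local Notation V := (@lebesgue_Cn R n).
Local Notation B := (@unit_ball R n).
Implicit Types (z w u v a : 'rV[C]_n) (f : 'rV[C]_n -> C).

(** The modulus of [f], extended by 0 so that it is measurable on the whole
    space: nothing is known about the values of [f] outside the ball. *)
Definition absf f (z : Cn) : R := nc (f z) * \1_(B : set Cn) z.

Lemma absf_ge0 f z : 0 <= absf f z.
Proof. by rewrite mulr_ge0 ?nc_ge0// indicE. Qed.

Lemma absf_in f z : unit_ball z -> absf f z = nc (f z).
Proof. by move=> hz; rewrite /absf indicE mem_set// mulr1. Qed.

Lemma measurable_absf f : holo f -> measurable_fun setT (absf f : Cn -> Rm).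
Proof.
move=> hf; apply: (measurability _ (RGenOInfty.measurableE R)).
move=> _ [_ [r ->] <-]; rewrite setTI.
have op (s : R) : 0 <= s -> measurable ((absf f : Cn -> Rm) @^-1` `]s, +oo[%classic).
  move=> s0; rewrite preimage_itvoy; apply: measurable_Copen => z /=.
  case: (asboolP (B z)) => hz; last first.
    by rewrite /absf indicE memNset// mulr0 ltNge s0.
  rewrite absf_in// => sz; have dz := delta_gt0 hz.
  have e0 : 0 < nc (f z) - s by rewrite subr_gt0.
  have [d d0 Hd] := holo_cont hf hz e0.
  exists (Num.min d (delta z / 4)); first by rewrite lt_min d0 divr_gt0.
  move=> h; rewrite lt_min => /andP[hd hz4].
  have hzh : unit_ball (z + h).
    by apply/delta_gt0P; apply: lt_le_trans (delta_step dz (ltW hz4)); rewrite divr_gt0.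
  rewrite absf_in//; move: (Hd h hd) (ler_ncB (f (z + h)) (f (z + h) - f z)).
  have -> : f (z + h) - (f (z + h) - f z) = f z by ring.
  by clear; move: (nc (f z)) (nc (f (z + h) - f z)) (nc (f (z + h))) => x y t; lra.
case: (leP 0 r) => r0; first exact: op.
rewrite preimage_itvoy (_ : [set _ | _] = setT)//; apply/seteqP; split => // z _ /=.
exact: (lt_le_trans r0 (absf_ge0 f z)).
Qed.

(** Integrate the mean value inequality on circles over [v] in [O]; each
    rotation preserves [V] and [O], so that the circular average disappears.
    This bounds [V O * |f u|] by twice the integral of [|f|]. Then
    [powR_tangent] at the point [|f u|] replaces [|f|] by [|f|^p], as in
    Jensen's inequality. *)
Lemma area_mean_value f u (O : set Cn) (p : R) : 1 <= p -> holo f -> unit_ball u ->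
  measurable O -> (V O < +oo)%E ->
  (forall t v, O v -> O (cis t *: v)) -> (forall v, O v -> disc_in_ball u v) ->
  (V O * (nc (f u) `^ p)%:E <=
   (2 `^ p)%:E * \int[V]_v (absf f ((u + v : 'rV[C]_n) : Cn) `^ p * \1_O v)%:E)%E.
Proof.
move=> p1 hf hu mO Ofin circ disc.
have Ocis t v : O (cis t *: v) -> O v.
  by move=> /(circ (- t)); rewrite scalerA mulrC cisNM scale1r.
have mcis : cmeas setT (fun t : Rm => @cis R t).
  by split; apply: continuous_measurable_fun; [exact: continuous_cos|exact: continuous_sin].
have mS t : measurable_fun setT (fun v : Cn => ((u + cis t *: (v : 'rV[C]_n) : 'rV[C]_n) : Cn)).
  apply: measurable_CnD; first exact: measurable_cst.
  by apply: measurable_CnZ; [exact: cmeas_cst|exact: measurable_id].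
pose g (v : Cn) : R := absf f ((u + (v : 'rV[C]_n) : 'rV[C]_n) : Cn).
have mg : measurable_fun setT g.
  apply: (measurableT_comp (measurable_absf hf)).
  by apply: measurable_CnD; [exact: measurable_cst|exact: measurable_id].
have m1O : measurable_fun setT (\1_O : Cn -> R) by exact: measurable_indic.
pose I := (`[0, 2 * pi]%classic : set Rm).
pose h (v : Cn) (t : Rm) : R := g (cis t *: (v : 'rV[C]_n)) * \1_O v * \1_I t.
have g0 v : 0 <= g v by exact: absf_ge0.
have m1I : measurable_fun setT (\1_I : Rm -> R) by apply: measurable_indic; exact: measurable_itv.
have h0 v t : 0 <= h v t by rewrite /h; apply: (@mulr_ge0 R); [apply: (@mulr_ge0 R); [exact: g0|exact: indic_ge0]|exact: indic_ge0].
have mh : measurable_fun setT (fun x : Cn * Rm => h x.1 x.2).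
  apply: measurable_funM; first apply: measurable_funM.
  - apply: (measurableT_comp mg); apply: measurable_CnZ; last exact: measurable_fst.
    exact: (cmeas_comp mcis (@measurable_snd _ _ Cn Rm)).
  - exact: (measurableT_comp m1O (@measurable_fst _ _ Cn Rm)).
  - exact: (measurableT_comp m1I (@measurable_snd _ _ Cn Rm)).
have [m1 m2 E] := tonelli V (@lebesgue_measure R) mh h0.
have J0 v : 0 <= g v * \1_O v by apply: (@mulr_ge0 R); [exact: g0|exact: indic_ge0].
pose J := (\int[V]_v (g v * \1_O v)%:E)%E.
pose K := (\int[V]_v (g v `^ p * \1_O v)%:E)%E.
have mJ : measurable_fun setT (fun v : Cn => g v * \1_O v) by exact: measurable_funM.
have S1 : ((2 * pi * nc (f u))%:E * V O <= 2%:E * \int[V]_v \int[@lebesgue_measure R]_t (h v t)%:E)%E.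
  have -> : ((2 * pi * nc (f u))%:E * V O = \int[V]_v (2 * pi * nc (f u) * \1_O v)%:E)%E.
    by rewrite integral_indic_scale ?mulr_ge0 ?pi_ge0 ?nc_ge0.
  rewrite -ge0_integralZl_EFin//; last by move=> v _; apply: integral_ge0 => t _; rewrite lee_fin.
  apply: ge0_le_integral => //.
  - by move=> v _; rewrite lee_fin !mulr_ge0 ?pi_ge0 ?nc_ge0// indicE.
  - by apply/measurable_EFinP; apply: measurable_funM => //; exact: measurable_cst.
  - by apply: emeasurable_funM => //; exact: measurable_cst.
  - move=> v _; case: (asboolP (O v)) => Ov; last first.
      rewrite indicE memNset// mulr0 mule_ge0//; apply: integral_ge0 => t _; rewrite lee_fin; exact: h0.
    rewrite indicE mem_set// mulr1 /h.
    rewrite (eq_integral (fun t : Rm => (g (cis t *: (v : 'rV[C]_n)) * \1_I t)%:E)); last first.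
      by move=> t _; rewrite indicE mem_set// mulr1.
    rewrite -(@integral_restrict _ _ _ (@lebesgue_measure R) I); last exact: measurable_itv.
    have c1 t : nc (@cis R t) <= 1 by rewrite nc_cis.
    have inB t : unit_ball (u + cis t *: (v : 'rV[C]_n)) := disc _ Ov _ (c1 t).
    have Hc : ccont_on 0 (2 * pi) (fun t => f (u + cis t *: (v : 'rV[C]_n))).
      by move=> t _; apply: ccont_line; [exact: (holo_cont hf (inB t))|exact: ccont_cis].
    have Hm : measurable_fun setT (fun t : Rm => g (cis t *: (v : 'rV[C]_n)) : Rm).
      apply: (measurableT_comp mg); apply: measurable_CnZ; last exact: measurable_cst.
      exact: mcis.
    have := nc_cint_le Hc Hm (fun t _ => _).
    rewrite (mean_value_line hf (disc _ Ov)) Normc.normcM nc_real ger0_norm ?mulr_ge0 ?pi_ge0//.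
    by apply => t; rewrite /g (absf_in _ (inB t)).
have mJE : measurable_fun setT (fun v : Cn => (g v * \1_O v)%:E) by exact/measurable_EFinP.
have J0E (v : Cn) : (0 <= (g v * \1_O v)%:E)%E by rewrite lee_fin J0.
have rot t := mpres_integral (@mpres_rotation R n t) mJE J0E.
have S2 : ((nc (f u))%:E * V O <= 2%:E * J)%E.
  apply: (lee_of_pmul2r (pi2_gt0 R)); move: S1; rewrite E.
  have -> : (\int[@lebesgue_measure R]_t \int[V]_v (h v t)%:E = (2 * pi)%:E * J)%E.
    rewrite (eq_integral (fun t : Rm => J * (\1_I t)%:E)%E); last first.
      move=> t _; rewrite /h.
      under eq_integral do rewrite mulrC.
      have mt : measurable_fun setT (fun v : Cn => g (cis t *: (v : 'rV[C]_n)) * \1_O v).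
        apply: measurable_funM; last exact: m1O.
        apply: (measurableT_comp mg).
        by apply: measurable_CnZ; [exact: cmeas_cst|exact: measurable_id].
      have t0 (v : Cn) : 0 <= g (cis t *: (v : 'rV[C]_n)) * \1_O v.
        by apply: (@mulr_ge0 R); [exact: g0|exact: indic_ge0].
      rewrite (integral_scale V (indic_ge0 R I t) mt t0).
      suff -> : (\int[V]_v (g (cis t *: (v : 'rV[C]_n)) * \1_O v)%:E = J)%E by rewrite muleC.
      apply: etrans (rot t); apply: eq_integral => v _.
      congr (_ * _)%:E; rewrite !indicE; congr (_%:R).
      by apply: congr1; apply/idP/idP; rewrite !inE; [exact: circ|exact: Ocis].
    have mI : measurable_fun setT (fun t : Rm => (\1_I t : R)%:E) by apply/measurable_EFinP; exact: m1I.
    have I0 (t : Rm) : setT t -> (0 <= (\1_I t)%:E :> \bar R)%E by rewrite lee_fin indic_ge0.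
    have lI : lebesgue_measure I = (2 * pi)%:E.
      by rewrite /I lebesgue_measure_itv/= lte_fin (pi2_gt0 R) oppr0 adde0.
    have J00 : (0 <= J)%E by apply: integral_ge0 => v _; exact: J0E.
    rewrite (ge0_integralZl _ measurableT mI I0 J00) integral_indic ?setIT//; last exact: measurable_itv.
    by rewrite [X in (_ * X)%E](lI) muleC.
  move: (nc (f u)) (V O) J => y v J'.
  clear; move: (2 * pi) => c.
  by rewrite -(muleA 2%:E J') (muleC J') (muleC (y%:E * v)%E) !muleA -!EFinM (mulrC 2).
have [v vE] : exists v : R, V O = v%:E.
  by exists (fine (V O)); rewrite fineK// ge0_fin_numE.
pose y := nc (f u); have y0 : 0 <= y by exact: nc_ge0.
have p0 : 0 < p := lt_le_trans ltr01 p1.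
have mgp : measurable_fun setT (fun v : Cn => g v `^ p) by exact: (measurableT_comp (@measurable_powR R p) mg).
pose k1 (v : Cn) := 2 `^ p * (g v `^ p * \1_O v).
pose k2 (v : Cn) := (p - 1) * y `^ p * \1_O v.
have p10 : 0 <= (p - 1) * y `^ p by rewrite mulr_ge0 ?powR_ge0 ?subr_ge0.
have S3 : ((2 * p * y `^ (p - 1))%:E * J <= (2 `^ p)%:E * K + ((p - 1) * y `^ p)%:E * V O)%E.
  have c0 : 0 <= 2 * p * y `^ (p - 1) by rewrite !mulr_ge0 ?powR_ge0 ?(ltW p0).
  have gp0 (v' : Cn) : 0 <= g v' `^ p * \1_O v' by apply: (@mulr_ge0 R); [exact: powR_ge0|exact: indic_ge0].
  have mgO : measurable_fun setT (fun v : Cn => g v `^ p * \1_O v) by apply: measurable_funM.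
  rewrite -(integral_scale V c0 mJ J0) -(integral_indic_scale V p10 mO).
  rewrite -(integral_scale V (powR_ge0 2 p) mgO gp0) -nonneg_integralD; first last.
  - by move=> v'; rewrite mulr_ge0 ?indic_ge0.
  - by move=> v'; rewrite mulr_ge0 ?powR_ge0.
  - by apply: measurable_funM => //; exact: measurable_cst.
  - by apply: measurable_funM => //; exact: measurable_cst.
  apply: integral_mono.
  - by apply: measurable_funM => //; exact: measurable_cst.
  - apply: measurable_funD; apply: measurable_funM => //; exact: measurable_cst.
  - by move=> v'; rewrite mulr_ge0.
  move=> v'; rewrite mulrA (mulrA (2 `^ p)) -mulrDl; apply: ler_wpM2r; first exact: indic_ge0.
  have := powR_tangent p1 (mulr_ge0 (ler0n R 2) (g0 v')) y0.
  rewrite powRM//; move: (g v') (g v' `^ p) (y `^ (p - 1)) (y `^ p) (2 `^ p) => g1 g2 y1 y2 t2.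
  by have -> : p * (2 * g1 * y1) = 2 * p * y1 * g1 by ring.
have yp : y `^ (p - 1) * y = y `^ p.
  case: (eqVneq y 0) => [->|yn]; first by rewrite mulr0 powR0// gt_eqF.
  by rewrite -{2}(powRr1 y0) -powRD ?subrK ?yn ?implybT.
have c0 : 0 <= p * y `^ (p - 1) by rewrite mulr_ge0 ?powR_ge0 ?(ltW p0).
have {}S2 : ((p * y `^ p * v)%:E <= (2 * p * y `^ (p - 1))%:E * J)%E.
  move: S2; rewrite vE -/y => /(lee_wpmul2l (x := (p * y `^ (p - 1))%:E)).
  rewrite lee_fin => /(_ c0); rewrite !muleA -!EFinM -yp.
  by congr (_%:E <= _%:E * _)%E; ring.
have := le_trans S2 S3; rewrite vE -/K -EFinM.
have : (0 <= K)%E by apply: integral_ge0 => v' _; rewrite lee_fin (@mulr_ge0 R) ?powR_ge0 ?indic_ge0.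
have t0 : 0 < 2 `^ p :> R by rewrite powR_gt0.
clear S3; move: (K); clear K => -[r _| _ _|//]; last by rewrite gt0_muley ?lte_fin// leey.
by rewrite -!EFinM -EFinD !lee_fin; move: (y `^ p) (2 `^ p * r) => a1 a2; lra.
Qed.
End area_mean_value.

(** * Growth estimates *)
Lemma measurable_below d (T : measurableType d) (R : realType) (g : T -> R) (c : R) :
  measurable_fun setT g -> measurable [set x | g x < c].
Proof.
move=> mg; have := mg measurableT _ (measurable_itv `]-oo, c[).
by rewrite setTI preimage_itvNyo.
Qed.

Section growth.
Variables (R : realType) (n : nat).
Local Notation C := R[i].
Local Notation nc := (@Normc.normc R).
Local Notation Cn := (measCn R n.+1).
Local Notation V := (@lebesgue_Cn R n.+1).
Implicit Types (z w u v a : 'rV[C]_n.+1) (f : 'rV[C]_n.+1 -> C).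

(** The form in which the inequality is applied: a lower bound [k] of the
    weight on [u + O] brings the weight under the integral. *)
Lemma weighted_mean_value f u (O : set Cn) (W : Cn -> R) (k p : R) :
  1 <= p -> holo f -> unit_ball u -> measurable O -> (V O < +oo)%E ->
  (forall t v, O v -> O (cis t *: v)) -> (forall v, O v -> disc_in_ball u v) ->
  measurable_fun setT W -> (forall z, 0 <= W z) -> 0 <= k ->
  (forall v, O v -> k <= W (u + v)) ->
  (V O * (k * nc (f u) `^ p)%:E <=
   (2 `^ p)%:E * \int[V]_z (absf f z `^ p * W z)%:E)%E.
Proof.
move=> p1 hf hu mO Ofin circ disc mW W0 k0 kW.
have mu : measurable_fun setT (fun v : Cn => ((u + (v : 'rV[C]_n.+1) : 'rV[C]_n.+1) : Cn)).
  by apply: measurable_CnD; [exact: measurable_cst|exact: measurable_id].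
have mp : measurable_fun setT (fun z : Cn => absf f z `^ p).
  exact: (measurableT_comp (@measurable_powR R p) (measurable_absf hf)).
have mpu : measurable_fun setT (fun v : Cn => absf f (u + (v : 'rV[C]_n.+1)) `^ p).
  exact: (measurableT_comp mp mu).
have mg : measurable_fun setT (fun v : Cn => absf f (u + (v : 'rV[C]_n.+1)) `^ p * \1_O v).
  by apply: measurable_funM => //; exact: measurable_indic.
have g0 (v : Cn) : 0 <= absf f (u + (v : 'rV[C]_n.+1)) `^ p * \1_O v.
  by apply: (@mulr_ge0 R); [exact: powR_ge0|exact: indic_ge0].
have H : (k%:E * \int[V]_v (absf f (u + (v : 'rV[C]_n.+1)) `^ p * \1_O v)%:E <=
          \int[V]_z (absf f z `^ p * W z)%:E)%E.
  rewrite -(integral_scale V k0 mg g0).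
  pose G (z : Cn) := (absf f z `^ p * W z)%:E.
  have mG : measurable_fun setT G by apply/measurable_EFinP; exact: (measurable_funM mp mW).
  have G0 z : (0 <= G z)%E by rewrite lee_fin (@mulr_ge0 R) ?powR_ge0.
  rewrite -(mpres_integral (@mpres_translation R n.+1 u) mG G0).
  under [leRHS]eq_integral do rewrite addrC.
  apply: integral_mono.
  - exact: (measurable_funM (measurable_cst k) mg).
  - exact: (measurable_funM mpu (measurableT_comp mW mu)).
  - by move=> v; exact: (mulr_ge0 k0 (g0 v)).
  - move=> v; rewrite mulrCA; apply: ler_wpM2l; first exact: powR_ge0.
    case: (asboolP (O v)) => Ov.
      by rewrite indicE (mem_set Ov) mulr1; exact: kW.
    by rewrite indicE (memNset Ov) mulr0; exact: W0.
rewrite EFinM muleCA; have := area_mean_value p1 hf hu mO Ofin circ disc.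
have k0E : (0 <= k%:E)%E by rewrite lee_fin.
move=> /(lee_wpmul2l k0E) /le_trans; apply.
rewrite muleCA; apply: lee_wpmul2l => //.
Qed.

(** The Cauchy estimate for a disc of radius [r]. *)
Lemma partial_sup f w (k : 'I_n.+1) (r M : R) : holo f -> 0 < delta w -> 0 < r -> r <= delta w / 4 ->
  (forall h, nrm h <= r -> nc (f (w + h)) <= M) -> nc (partial k f w) <= 4 * M / r.
Proof.
move=> hf dw r0 rw hM; pose v : 'rV[C]_n.+1 := r%:C%C *: delta_mx 0 k.
have nv : nrm v = r by rewrite nrmZ nrm_delta_mx mulr1 nc_real gtr0_norm.
have disc : disc_in_ball w v by apply: disc_step => //; rewrite nv.
have := @cauchy_bound _ _ f w v (2 * M) hf disc.
have -> : nc (lin (grad f w) v) = nc (partial k f w) * r.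
  by rewrite linZ Normc.normcM nc_real gtr0_norm// partialE mulrC.
rewrite ler_pdivlMr// => H; apply: le_trans (H _) _; last by rewrite mulrA -natrM.
move=> c c1; apply: (le_trans (ler_ncB _ _)).
rewrite mulr2n mulrDl mul1r lerD//.
  by apply: hM; rewrite nrmZ c1 mul1r nv.
by have := hM 0; rewrite addr0 nrm0; apply; exact: ltW.
Qed.

Definition nball (r : R) : set Cn := [set v : Cn | nrm (v : 'rV[C]_n.+1) < r].

Lemma measurable_nball r : measurable (nball r).
Proof. exact: (measurable_below r (measurable_nrm (@measurable_id _ Cn setT))). Qed.

Lemma box_nrm r v : 0 <= r -> box 0 (fun=> r) v -> nrm v <= n.+1%:R * (2 * r).
Proof.
move=> r0 hv; apply: nrm_le_coord => k; apply: (le_trans (ler_nc_ReIm _)).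
have [] := hv k; rewrite !mxE !in_itv/= !sub0r !add0r -!ler_norml => h1 h2.
by rewrite mulr2n mulrDl mul1r lerD.
Qed.

Lemma volume_nball (r : R) : 0 < r ->
  (((r / n.+1%:R / 2) `^ (n.+1%:R + n.+1%:R))%:E <= V (nball r))%E /\
  (V (nball r) <= ((2 * r) `^ (n.+1%:R + n.+1%:R))%:E)%E.
Proof.
move=> r0.
have E (x : R) : 0 <= x -> \prod_(k < n.+1) x ^+ 2 = x `^ (n.+1%:R + n.+1%:R).
  by move=> x0; rewrite prodr_const card_ord -exprM -natrD powR_mulrn// addnn mul2n.
split.
  (* The cube of half side [r / (4 N)] lies in the ball. *)
  have r'0 : 0 <= r / n.+1%:R / 2 / 2 by rewrite !divr_ge0// ltW.
  have [mb hb] := @volume_box R n.+1 0 (fun=> r / n.+1%:R / 2 / 2) (fun=> r'0).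
  have e2 : 2 * (r / n.+1%:R / 2 / 2) = r / n.+1%:R / 2 by move: (r / _ / _) => x; field.
  move: hb; rewrite e2 E ?divr_ge0 ?(ltW r0)// => <-.
  apply: le_measure; rewrite ?inE//; first exact: measurable_nball.
  move=> v hv; rewrite /nball/=; apply: (le_lt_trans (box_nrm r'0 hv)).
  rewrite e2; have -> : n.+1%:R * (r / n.+1%:R / 2) = r / 2.
    by move: (n.+1%:R) (@pnatr_eq0 R n.+1) => N; move=> /negbT N0; field.
  by rewrite ltr_pdivrMr// ltr_pMr// ltr1n.
have [mb hb] := @volume_box R n.+1 0 (fun=> r) (fun=> ltW r0).
move: hb; rewrite E ?mulr_ge0 ?(ltW r0)// => <-.
apply: le_measure; rewrite ?inE//; first exact: measurable_nball.
move=> z /ltW z1 k; rewrite !mxE !in_itv/= !sub0r !add0r -!ler_norml.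
have h := le_trans (nc_coord z k) z1.
by split; apply: le_trans h; [exact: ler_nc_Re|exact: ler_nc_Im].
Qed.

Definition gap z a : R := nc (1 - dotmx z a).

(** The density of the integrand of the norm against Lebesgue measure, up to
    the normalization of the volume; see [weight_identity]. *)
Definition weight (be m : R) a (z : Cn) : R :=
  delta z `^ be * delta a `^ m * gap z a `^ (- (m + m)).

Lemma measurable_gap a : measurable_fun setT (fun z : Cn => gap z a).
Proof.
apply: measurable_nc; apply: cmeasB; first exact: cmeas_cst.
by apply: cmeas_dotmx; [exact: measurable_id|exact: measurable_cst].
Qed.

Lemma measurable_delta_powR be : measurable_fun setT (fun z : Cn => delta z `^ be).
Proof.
exact: (measurableT_comp (@measurable_powR R be) (measurable_delta (@measurable_id _ Cn setT))).
Qed.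

Lemma measurable_gap_powR be a : measurable_fun setT (fun z : Cn => gap z a `^ be).
Proof. exact: (measurableT_comp (@measurable_powR R be) (measurable_gap a)). Qed.

Lemma measurable_weight be m a : measurable_fun setT (weight be m a).
Proof.
apply: (measurable_funM _ (measurable_gap_powR _ a)).
exact: (measurable_funM (measurable_delta_powR be) (measurable_cst _)).
Qed.

Lemma weight_ge0 be m a z : 0 <= weight be m a z.
Proof. by rewrite !(@mulr_ge0 R)// powR_ge0. Qed.

(** [|<z - w, a>| <= |z - w|] for [a] in the ball. *)
Lemma gap_lip z w a : unit_ball a -> gap z a <= gap w a + nrm (z - w).
Proof.
move=> /in_unit_ball/ltW ha; have h := nc_dotmx (w - z) a.
have e : (1 - dotmx w a) + dotmx (w - z) a = 1 - dotmx z a.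
  by rewrite dotmxBl; move: (dotmx z a) (dotmx w a) => x y; ring.
have := ler_ncD (1 - dotmx w a) (dotmx (w - z) a); rewrite e => /le_trans; apply.
by rewrite lerD2l (le_trans h)// nrm_distC ler_piMr// nrm_ge0.
Qed.

(** A nonisotropic polydisc centred at 0: of size [delta u] in the direction
    of [u] and of size the square root of [delta u] in the orthogonal ones. On
    its translate by [u] both [delta] and [gap _ u] are comparable to [delta
    u]. *)
Definition npolydisc u : set Cn := [set v : Cn |
  nc (dotmx (v : 'rV[C]_n.+1) u) < delta u / 8 /\ sqnorm (v : 'rV[C]_n.+1) < delta u / 8].

Lemma measurable_npolydisc u : measurable (npolydisc u).
Proof.
apply: measurableI.
  have m1 : measurable_fun setT (fun v : Cn => nc (dotmx (v : 'rV[C]_n.+1) u)).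
    by apply: measurable_nc; apply: cmeas_dotmx; [exact: measurable_id|exact: measurable_cst].
  exact: (measurable_below (delta u / 8) m1).
exact: (measurable_below (delta u / 8) (measurable_sqnorm (@measurable_id _ Cn setT))).
Qed.

Lemma npolydisc_cis u (t : R) v : npolydisc u v -> npolydisc u (cis t *: v).
Proof.
rewrite /npolydisc/= dotmxZl Normc.normcM nc_cis mul1r -!sqr_nrm nrmZ nc_cis mul1r; exact.
Qed.

Lemma npolydisc_delta u v (c : C) : unit_ball u -> npolydisc u v -> nc c <= 1 ->
  delta u * (5 / 8) <= delta (u + c *: v) <= delta u * (5 / 4).
Proof.
move=> hu [h1 h2] c1; have du := delta_gt0 hu.
rewrite !deltaE sqnormD dotmxZl -(sqr_nrm (c *: v)) nrmZ exprMn sqr_nrm.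
have := le_trans (ler_nc_Re (c * dotmx v u)) (_ : _ <= nc (dotmx v u)).
rewrite Normc.normcM ler_piMl ?nc_ge0// => /(_ isT); rewrite ler_norml => /andP[r1 r2].
have : nc c ^+ 2 * sqnorm v <= sqnorm v.
  by rewrite ler_piMl ?sqnorm_ge0// exprn_ile1// nc_ge0.
have : 0 <= nc c ^+ 2 * sqnorm v by rewrite mulr_ge0 ?sqr_ge0 ?sqnorm_ge0.
move: du h1 h2 r1 r2; rewrite deltaE.
move: (nc c ^+ 2 * sqnorm v) (sqnorm v) (sqnorm u) (complex.Re _) (nc _) => x y t r s.
by clear; move=> *; apply/andP; split; lra.
Qed.

Lemma npolydisc_gap u v : unit_ball u -> npolydisc u v ->
  delta u * (7 / 8) <= gap (u + v) u <= delta u * (9 / 8).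
Proof.
move=> hu [h1 _]; have du := delta_gt0 hu; rewrite /gap dotmxDl.
have -> : 1 - (dotmx u u + dotmx v u) = (delta u)%:C%C - dotmx v u.
  by rewrite deltaE rmorphB rmorph1 dotmx_sqnorm opprD addrA.
have du' : nc (delta u)%:C%C = delta u by rewrite nc_real gtr0_norm.
have := ler_ncB (delta u)%:C%C (dotmx v u).
have := ler_ncB ((delta u)%:C%C - dotmx v u) (- dotmx v u).
rewrite opprK subrK ncN du'; move: h1; move: (nc (dotmx v u)) (nc _) => x y.
by clear -du; move=> *; apply/andP; split; lra.
Qed.

(** After a unitary change of variables, the polydisc contains a box with one
    complex side of order [delta u] and the others of order its square root.
    *)
Lemma npolydisc_volume : exists2 c : R, 0 < c & forall u, unit_ball u ->
  ((c * delta u `^ n.+2%:R)%:E <= V (npolydisc u))%E.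
Proof.
(* Small enough for the coordinates of the box to satisfy both defining
   inequalities. *)
pose kap : R := (n.+1%:R)^-1 / 32.
have kap0 : 0 < kap by rewrite divr_gt0 ?invr_gt0.
exists ((2 * kap) ^+ 2 * \prod_(k < n) (2 * kap) ^+ 2).
  by rewrite mulr_gt0 ?exprn_gt0 ?prodr_gt0 => // [|k _]; rewrite ?exprn_gt0// mulr_gt0.
move=> u hu; have du := delta_gt0 hu; have d1 := delta_le1 u.
have [U hU [c nc_c hc]] := unitary_align u.
pose s := Num.sqrt (delta u).
have s0 : 0 < s by rewrite sqrtr_gt0.
have s2 : s ^+ 2 = delta u by rewrite sqr_sqrtr ?ltW.
have ds : delta u <= s.
  by rewrite -s2 expr2 ler_piMr ?(ltW s0)// -sqrtr1 ler_sqrt ?ler01.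
pose rho (k : 'I_n.+1) : R := if k == 0 then kap * delta u else kap * s.
have rho0 k : 0 <= rho k by rewrite /rho; case: eqP => _; rewrite mulr_ge0 ?(ltW kap0) ?(ltW du) ?(ltW s0).
have [mb hb] := volume_box 0 rho0.
have <- : V (box 0 rho) = ((2 * kap) ^+ 2 * \prod_(k < n) (2 * kap) ^+ 2 * delta u `^ n.+2%:R)%:E.
  rewrite hb big_ord_recl /=; congr (_%:E).
  have -> : \prod_(i < n) (2 * rho (lift ord0 i)) ^+ 2 = \prod_(k < n) (2 * kap) ^+ 2 * delta u ^+ n.
    have -> : delta u ^+ n = \prod_(k < n) delta u by rewrite prodr_const card_ord.
    rewrite -big_split; apply: eq_bigr => k _.
    by rewrite /rho /= -s2; ring.
  rewrite /rho eqxx powR_mulrn ?(ltW du)//.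
  have -> : delta u ^+ n.+2 = delta u ^+ 2 * delta u ^+ n by rewrite -exprD.
  by move: (\prod_(k < n) _) (delta u) (delta u ^+ n) => x y t; ring.
have := (@mpres_unitary R n.+1 U hU).2 _ (measurable_npolydisc u) => <-.
apply: le_measure; rewrite ?inE//.
  exact: (measurable_preim (@measurable_mulmx R n.+1 U) (measurable_npolydisc u)).
move=> z hz; have rs k : rho k <= kap * s.
  by rewrite /rho; case: eqP => // _; rewrite ler_pM2l.
have zk k : nc (z 0 k) <= 2 * rho k.
  have [] := hz k; rewrite !mxE !in_itv/= !sub0r !add0r -!ler_norml => h1 h2.
  by apply: (le_trans (ler_nc_ReIm _)); rewrite mulr2n mulrDl mul1r lerD.
have N1 : 1 <= n.+1%:R :> R by rewrite ler1n.
split => /=.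
  rewrite hc Normc.normcM nc_conj nc_c.
  have nu : nrm u <= 1 by apply/ltW/in_unit_ball.
  apply: (@le_lt_trans _ _ (2 * rho 0)).
    by apply: le_trans (zk 0); rewrite ler_piMl ?nc_ge0.
  rewrite /rho eqxx mulrA [ltRHS]mulrC ltr_pM2r//.
  have : kap <= 32^-1 by rewrite /kap -[leRHS]mul1r ler_pM2r// invf_le1 ?ltr0n.
  by lra.
rewrite -sqr_nrm nrm_unitary//.
have : nrm z <= n.+1%:R * (2 * (kap * s)).
  by apply: nrm_le_coord => k; apply: (le_trans (zk k)); rewrite ler_pM2l.
have -> : n.+1%:R * (2 * (kap * s)) = s / 16.
  rewrite /kap; move: N1; move: (n.+1%:R) => N N1; field.
  by rewrite gt_eqF// (lt_le_trans ltr01).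
move=> h; apply: (@le_lt_trans _ _ ((s / 16) ^+ 2)).
  by rewrite ler_pXn2r// nnegrE ?nrm_ge0// divr_ge0 ?(ltW s0).
by rewrite exprMn s2 ltr_pM2l//; lra.
Qed.

Lemma npolydisc_sub_nball u : unit_ball u -> npolydisc u `<=` nball 1.
Proof.
move=> hu v [_ h]; rewrite /nball/= -(@ltr_pXn2r _ 2) ?nnegrE ?nrm_ge0// sqr_nrm expr1n.
by apply: (lt_le_trans h); have := delta_le1 u; lra.
Qed.

(** Apply [weighted_mean_value] on [u + npolydisc u] with the weight of centre
    [a = u]: there the weight is of order [delta u ^ (be - m)]. *)
Lemma growth (p be m : R) : 1 <= p -> exists2 K : R, 0 < K & forall f (N : R), holo f ->
  (forall a, unit_ball a -> (\int[V]_z (absf f z `^ p * weight be m a z)%:E <= N%:E)%E) ->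
  forall u, unit_ball u -> nc (f u) `^ p <= K * N * delta u `^ (m - be - n.+2%:R).
Proof.
move=> p1; have [c c0 cV] := npolydisc_volume.
pose k1 : R := (2 `^ `|be|)^-1 * (2 `^ `|- (m + m)|)^-1.
have k10 : 0 < k1 by rewrite mulr_gt0 ?invr_gt0 ?powR_gt0.
exists (2 `^ p / (c * k1)); first by rewrite divr_gt0 ?mulr_gt0 ?powR_gt0.
move=> f N hf HN u hu; have du := delta_gt0 hu.
have fin : (V (npolydisc u) < +oo)%E.
  apply: (@le_lt_trans _ _ (V (nball 1))).
    apply: le_measure; rewrite ?inE; [exact: measurable_npolydisc|exact: measurable_nball|].
    exact: npolydisc_sub_nball.
  by apply: (le_lt_trans (volume_nball ltr01).2); rewrite ltry.
have disc v : npolydisc u v -> disc_in_ball u v.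
  move=> hv x x1; apply/delta_gt0P; have /andP[+ _] := npolydisc_delta hu hv x1.
  by apply: lt_le_trans; rewrite mulr_gt0.
pose k := k1 * (delta u `^ be * delta u `^ m * delta u `^ (- (m + m))).
have k0 : 0 <= k by rewrite /k !mulr_ge0 ?powR_ge0 ?(ltW k10).
have kW v : npolydisc u v -> k <= weight be m u (u + v).
  move=> hv; have /andP[a1 a2] := npolydisc_gap hu hv.
  have := npolydisc_delta hu hv (_ : nc 1 <= 1); rewrite scale1r nc_real normr1 => /(_ (lexx _))/andP[b1 b2].
  have dd : 0 < delta (u + v) by apply: lt_le_trans b1; rewrite mulr_gt0.
  have gg : 0 < gap (u + v) u by apply: lt_le_trans a1; rewrite mulr_gt0.
  have e1 : (2 `^ `|be|)^-1 * delta u `^ be <= delta (u + v) `^ be.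
    by rewrite ler_pdivrMl ?powR_gt0//; apply: powR_comparable => //; move: du; clear - b1 b2; lra.
  have e2 : (2 `^ `|- (m + m)|)^-1 * delta u `^ (- (m + m)) <= gap (u + v) u `^ (- (m + m)).
    by rewrite ler_pdivrMl ?powR_gt0//; apply: powR_comparable => //; move: du; clear - a1 a2; lra.
  rewrite /weight /k /k1.
  apply: (@le_trans _ _ ((2 `^ `|be|)^-1 * delta u `^ be * delta u `^ m *
    ((2 `^ `|- (m + m)|)^-1 * delta u `^ (- (m + m))))).
    by rewrite le_eqVlt; apply/orP; left; apply/eqP; ring.
  apply: ler_pM => //; first by rewrite !mulr_ge0 ?invr_ge0 ?powR_ge0.
    by rewrite mulr_ge0 ?invr_ge0 ?powR_ge0.
  by rewrite ler_wpM2r ?powR_ge0.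
have := weighted_mean_value p1 hf hu (measurable_npolydisc u) fin
  (fun t v => @npolydisc_cis u t v) disc (measurable_weight be m u) (weight_ge0 be m u) k0 kW.
have kf0 : (0 <= (k * nc (f u) `^ p)%:E)%E by rewrite lee_fin mulr_ge0 ?powR_ge0.
have := lee_wpmul2r kf0 (cV u hu) => /le_trans/[apply].
have t0 : (0 <= (2 `^ p)%:E :> \bar R)%E by rewrite lee_fin powR_ge0.
move=> /le_trans/(_ (lee_wpmul2l t0 (HN u hu))); rewrite -!EFinM lee_fin /k.
have -> : delta u `^ (m - be - n.+2%:R) =
    (delta u `^ n.+2%:R * delta u `^ be * delta u `^ m * delta u `^ (- (m + m)))^-1.
  rewrite -!powRD ?(gt_eqF du) ?implybT// -powRN; congr (_ `^ _).
  by move: (n.+2%:R) => N'; ring.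
have : 0 < delta u `^ n.+2%:R * delta u `^ be * delta u `^ m * delta u `^ (- (m + m)).
  by rewrite !mulr_gt0// powR_gt0.
set X := _ * delta u `^ (- (m + m)) => X0 h.
rewrite ler_pdivlMr// [leRHS]mulrAC ler_pdivlMr ?mulr_gt0//.
apply: le_trans h; rewrite le_eqVlt; apply/orP; left; apply/eqP; rewrite /X; ring.
Qed.
End growth.

(** * Power integrals and dilations *)
Section power_integrals.
Variable R : realType.
Local Notation Rm := (measurableTypeR R).
Local Notation leb := (@lebesgue_measure R).

Lemma is_derive_shift_powR (M e x : R) : x < M ->
  is_derive x 1 (fun s : R => (M - s) `^ e) (- (e * (M - x) `^ (e - 1))).
Proof.
move=> xM; have x0 : 0 < M - x by rewrite subr_gt0.
have h1 : is_derive x (1 : R) (fun s : R => M - s) (-1).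
  by have := is_deriveB (is_derive_cst M x (1 : R)) (is_derive_id x (1 : R)); rewrite sub0r.
have h2 := is_derive1_powR e x0.
have := @is_derive1_comp _ (fun y : R => y `^ e) (fun s : R => M - s) x _ _ h2 h1.
by rewrite mulrN1.
Qed.

Lemma continuous_shift_powR (M e x : R) : x < M ->
  {for x, continuous (fun s : R => (M - s) `^ e)}.
Proof.
move=> xM; have [h _] := is_derive_shift_powR e xM.
by apply: differentiable_continuous; apply/derivable1_diffP.
Qed.

Lemma integral_shift_powR (a b M e : R) : e != 0 -> a < b -> b < M ->
  (\int[leb]_(s in `[a, b]) ((M - s) `^ (e - 1))%:E =
   ((M - a) `^ e / e - (M - b) `^ e / e)%:E)%E.
Proof.
move=> e0 ab bM; pose F (s : R) : R := - e^-1 * (M - s) `^ e.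
have dF x : x < M -> is_derive x (1 : R) F ((M - x) `^ (e - 1)).
  move=> xM; have h := is_derive_shift_powR e xM.
  have := is_deriveZ (- e^-1) h; rewrite /F.
  have -> // : (- e^-1) *: (- (e * (M - x) `^ (e - 1))) = (M - x) `^ (e - 1) :> R.
  by rewrite /GRing.scale/= mulrN mulNr opprK mulrA mulVf ?mul1r.
have cF x : x < M -> {for x, continuous F}.
  by move=> /dF[h _]; apply: differentiable_continuous; apply/derivable1_diffP.
rewrite (@continuous_FTC2 _ (fun s => (M - s) `^ (e - 1)) F a b ab).
- by rewrite -EFinB /F !mulNr opprK addrC !(mulrC e^-1).
- apply: continuous_in_subspaceT => x; rewrite inE/= in_itv/= => /andP[_ xb].
  by apply: continuous_shift_powR; exact: le_lt_trans bM.
- split.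
  + by move=> x; rewrite in_itv/= => /andP[_ xb]; have [] := dF x (lt_trans xb bM).
  + by apply: cvg_at_right_filter; apply: cF; exact: lt_trans bM.
  + by apply: cvg_at_left_filter; apply: cF.
- move=> x; rewrite in_itv/= => /andP[_ xb]; rewrite derive1E.
  by have [_ ->] := dF x (lt_trans xb bM).
Qed.

Lemma measurable_shift_powR (D : set Rm) (M e : R) :
  measurable_fun D (fun s : Rm => (M - s) `^ e : R).
Proof.
apply: measurable_funTS; apply: (measurableT_comp (@measurable_powR R e)).
by apply: measurable_funB; [exact: measurable_cst|exact: measurable_id].
Qed.

(** The integrand is singular at [M] when [e < 1]: the integral is the limit
    of those over [[a, M - (M - a) / (k + 2)]]. *)
Lemma integral_singular_powR (a M e : R) : 0 < e -> a < M ->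
  (\int[leb]_(s in `[a, M[) ((M - s) `^ (e - 1))%:E <= ((M - a) `^ e / e)%:E)%E.
Proof.
move=> e0 aM; have Ma : 0 < M - a by rewrite subr_gt0.
pose F (k : nat) : set Rm := `[a, M - (M - a) / k.+2%:R]%classic.
have eF : \bigcup_k F k = `[a, M[%classic.
  apply/seteqP; split => [s [k _]|s]; rewrite /F/= !in_itv/=.
    move=> /andP[-> h]; apply: (le_lt_trans h); rewrite ltrBlDr ltrDl divr_gt0//.
  move=> /andP[as_ sM]; have sM0 : 0 < M - s by rewrite subr_gt0.
  have q0 : 0 <= (M - a) / (M - s) by rewrite divr_ge0 ?ltW.
  exists (Num.bound ((M - a) / (M - s))) => //; rewrite /F/= in_itv/= as_/=.
  rewrite lerBrDr -lerBrDl ler_pdivrMr ?ltr0n// mulrC -ler_pdivrMr//.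
  apply/ltW/(lt_le_trans (archi_boundP q0)); rewrite ler_nat.
  exact: leq_trans (leqnSn _) (leqnSn _).
have nd : nondecreasing_seq F.
  apply/nondecreasing_seqP => k; rewrite subsetEset => s; rewrite /F/= !in_itv/= => /andP[->/=].
  move=> /le_trans; apply; rewrite lerD2l lerN2 ler_pM2l// lef_pV2 ?posrE ?ltr0n// ler_nat//.
have mF i : measurable (F i) by exact: measurable_itv.
have mf i : measurable_fun (F i) (fun s : Rm => ((M - s) `^ (e - 1))%:E).
  by apply/measurable_EFinP; exact: measurable_shift_powR.
have f0 i (x : Rm) : F i x -> (0 <= ((M - x) `^ (e - 1))%:E)%E.
  by move=> _; rewrite lee_fin powR_ge0.
have := @ge0_nondecreasing_set_cvg_integral _ _ _ F _ leb nd mF mf f0; rewrite eF => H.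
apply: (cvge_to_le H); apply: nearW => k.
have bM : M - (M - a) / k.+2%:R < M by rewrite gtrBl divr_gt0.
have ab : a < M - (M - a) / k.+2%:R.
  by rewrite ltrBrDr -ltrBrDl ltr_pdivrMr ?ltr0n// ltr_pMr// ltr1n.
rewrite /F (integral_shift_powR (lt0r_neq0 e0) ab bM) lee_fin gerBl.
by rewrite divr_ge0 ?powR_ge0 ?ltW.
Qed.

Lemma integral_cauchy_powR (x k : R) : 0 < x -> 0 < k ->
  (\int[leb]_(t in `[0%R, 1%R]) ((1 - t + x) `^ (- 1 - k))%:E <= (x `^ (- k) / k)%:E)%E.
Proof.
move=> x0 k0.
have := @integral_shift_powR 0 1 (1 + x) (- k) _ ltr01; rewrite oppr_eq0 gt_eqF// ltrDl x0.
move=> /(_ isT isT) h.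
under eq_integral do rewrite addrAC [- 1 - k]addrC.
rewrite h lee_fin [1 + x - 1]addrC addKr !invrN !mulrN opprK addrC gerBl.
by rewrite divr_ge0 ?powR_ge0 ?ltW.
Qed.
End power_integrals.

Lemma powR_anti (R : realType) (x y e : R) : 0 < x -> x <= y -> e <= 0 -> y `^ e <= x `^ e.
Proof.
move=> x0 xy e0; have y0 := lt_le_trans x0 xy.
rewrite -[e]opprK powRN [leRHS]powRN lef_pV2 ?posrE ?powR_gt0//.
by rewrite ge0_ler_powR ?nnegrE ?oppr_ge0 ?(ltW x0) ?(ltW y0).
Qed.

Section dilation.
Variables (R : realType) (n : nat).
Local Notation C := R[i].
Local Notation nc := (@Normc.normc R).
Local Notation Rm := (measurableTypeR R).
Local Notation leb := (@lebesgue_measure R).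
Local Notation Cn := (measCn R n).
Local Notation V := (@lebesgue_Cn R n).
Implicit Types (z w u v a : 'rV[C]_n).

(** Contractions decrease volumes, hence integrals of nonnegative functions.
    *)
Lemma integral_dilation (s : R) (g : Cn -> R) : 0 < s -> s <= 1 ->
  measurable_fun setT g -> (forall z, 0 <= g z) ->
  (\int[V]_z (g z)%:E <= \int[V]_z (g (s%:C%C *: (z : 'rV[C]_n)))%:E)%E.
Proof.
move=> s0 s1 mg g0.
have m : measurable_fun setT (fun z : Cn => (s%:C%C *: (z : 'rV[C]_n) : Cn)).
  by apply: measurable_CnZ; [exact: cmeas_cst|exact: measurable_id].
have mG : measurable_fun setT (fun z : Cn => (g z)%:E) by exact/measurable_EFinP.
have G0 (z : Cn) : (0 <= (g z)%:E)%E by rewrite lee_fin.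
have := @ge0_integral_pushforward _ _ _ _ R _ m V setT _ measurableT mG (fun z _ => G0 z).
rewrite preimage_setT => <-.
apply: ge0_le_measure_integral => //; first by move=> S mS; exact: volume_dilation.
Qed.

(** Average [integral_dilation] over the ratios [s] in [[1 - h, 1[]. After
    exchanging the integrals, for fixed [v] the point [s v] moves radially and
    [delta (s v)] is at least the distance of [s] to the exit parameter, so
    that the integral in [s] of its power [ga] is at most [h ^ (ga + 1) / (ga
    + 1)]. This integrates the singular power without polar coordinates. *)
Lemma dilation_bound (ga h : R) (E E' : set Cn) : -1 < ga -> ga < 0 -> 0 < h -> h < 1 ->
  measurable E -> measurable E' -> E `<=` @unit_ball R n ->
  (forall (s : R) v, 1 - h <= s -> s <= 1 -> E (s%:C%C *: v) -> E' v) ->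
  (\int[V]_z (delta z `^ ga * \1_E z)%:E <= (h `^ ga / (ga + 1))%:E * V E')%E.
Proof.
move=> ga1 ga0 h0 h1 mE mE' EB EE'.
have e0 : 0 < ga + 1 by rewrite -ltrBlDr sub0r.
pose g (z : Cn) : R := delta z `^ ga * \1_E z.
have mg : measurable_fun setT g.
  apply: measurable_funM; last exact: measurable_indic.
  exact: (measurableT_comp (@measurable_powR R ga) (measurable_delta (@measurable_id _ Cn setT))).
have g0 z : 0 <= g z by apply: (@mulr_ge0 R); [exact: powR_ge0|exact: indic_ge0].
pose J : set Rm := `[1 - h, 1[%classic.
have mJ : measurable J by exact: measurable_itv.
have m1J : measurable_fun setT (\1_J : Rm -> R) by exact: measurable_indic.
pose H (s : Rm) (v : Cn) : R := g (s%:C%C *: (v : 'rV[C]_n)) * \1_J s.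
have H0 s v : 0 <= H s v by apply: (@mulr_ge0 R); [exact: g0|exact: indic_ge0].
have mS : cmeas setT (fun x : Rm * Cn => (x.1 : R)%:C%C).
  by split => /=; [exact: measurable_fst|exact: measurable_cst].
have mH : measurable_fun setT (fun x : Rm * Cn => H x.1 x.2).
  apply: measurable_funM; last exact: (measurableT_comp m1J (@measurable_fst _ _ Rm Cn)).
  apply: (measurableT_comp mg); apply: measurable_CnZ; last exact: measurable_snd.
  exact: mS.
have [m1 m2 eT] := tonelli leb V mH H0.
have J0 s : J s -> 0 < s /\ s <= 1.
  rewrite /J/= in_itv/= => /andP[a1 /ltW a2]; split => //.
  by apply: lt_le_trans a1; rewrite subr_gt0.
have inner (v : Cn) : (\int[leb]_s (H s v)%:E <= (h `^ (ga + 1) / (ga + 1) * \1_E' v)%:E)%E.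
  have Hz : (forall s : R, J s -> ~ E (s%:C%C *: (v : 'rV[C]_n))) ->
      (\int[leb]_s (H s v)%:E <= (h `^ (ga + 1) / (ga + 1) * \1_E' v)%:E)%E.
    move=> nE; rewrite (eq_integral (cst 0%E)).
      rewrite integral0 lee_fin (@mulr_ge0 R) ?indic_ge0//.
      by rewrite divr_ge0 ?powR_ge0 ?ltW.
    move=> s _; rewrite /H; case: (asboolP (J s)) => Js.
      by rewrite /g indicE (memNset (nE s Js)) mulr0 mul0r.
    by rewrite [\1_J s]indicE (memNset Js) mulr0.
  case: (asboolP (E' v)) => Ev; last first.
    apply: Hz => s Js Es; apply: Ev; apply: EE' Es.
      by move: Js; rewrite /J/= in_itv/= => /andP[].
    by have [] := J0 s Js.
  (* The exit parameter is [M]: [s v] leaves the ball at [s = 1 / |v|], and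
     only [s < 1] is considered. *)
  pose m := Num.max 1 (nrm (v : 'rV[C]_n)); pose M := m^-1.
  have m1' : 1 <= m by rewrite le_max lexx.
  have m0 : 0 < m := lt_le_trans ltr01 m1'.
  have M1 : M <= 1 by rewrite invf_le1.
  have key (s : R) : J s -> E (s%:C%C *: (v : 'rV[C]_n)) ->
      s < M /\ M - s <= delta (s%:C%C *: (v : 'rV[C]_n)).
    move=> Js /EB/in_unit_ball; have [s0 s1] := J0 s Js.
    rewrite deltaE -sqr_nrm nrmZ nc_real gtr0_norm// => sv.
    have sm : s * m < 1.
      have s1' : s < 1 by move: Js; rewrite /J/= in_itv/= => /andP[].
      have [v1|v1] := leP 1 (nrm (v : 'rV[C]_n)); first by rewrite /m (max_r v1).
      by rewrite /m (max_l (ltW v1)) mulr1.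
    have sM : s < M by rewrite /M -[ltRHS]div1r ltr_pdivlMr.
    split => //.
    have vm : nrm (v : 'rV[C]_n) <= m by rewrite le_max lexx orbT.
    have svm : s * nrm (v : 'rV[C]_n) <= s * m by rewrite ler_pM2l.
    have mM : m * M = 1 by rewrite mulfV ?gt_eqF.
    have sv0 : 0 <= s * nrm (v : 'rV[C]_n) by rewrite mulr_ge0 ?nrm_ge0 ?(ltW s0).
    move: sv0 svm sm mM m1' sM s0; move: (s * nrm _) (M) (m) => x M' m'; clear; nra.
  have [aM|Ma] := ltP (1 - h) M; last first.
    apply: Hz => s Js /(key s Js)[sM _]; move: Js; rewrite /J/= in_itv/= => /andP[a1 _].
    by have := lt_le_trans sM (le_trans Ma a1); rewrite ltxx.
  pose I : set Rm := `[1 - h, M[%classic.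
  have mI : measurable I by exact: measurable_itv.
  have mi := @measurable_shift_powR R setT M ga.
  have le1 : (\int[leb]_s (H s v)%:E <= \int[leb]_s ((M - s) `^ ga * \1_I s)%:E)%E.
    apply: integral_mono => //.
    - exact: (measurableT_comp mH (pair2_measurable (v : Cn))).
    - by apply: (measurable_funM mi); exact: measurable_indic.
    - move=> s; have r0 : 0 <= (M - s) `^ ga * \1_I s by apply: (@mulr_ge0 R); [exact: powR_ge0|exact: indic_ge0].
      rewrite /H; case: (asboolP (J s)) => Js; last by rewrite [\1_J s]indicE (memNset Js) mulr0.
      rewrite [\1_J s]indicE (mem_set Js) mulr1 /g.
      case: (asboolP (E (s%:C%C *: (v : 'rV[C]_n)))) => Es; last first.
        by rewrite [\1_E _]indicE (memNset Es) mulr0.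
      have [sM dM] := key s Js Es.
      rewrite !indicE (mem_set Es) mulr1 mem_set ?mulr1.
        by apply: powR_anti => //; [rewrite subr_gt0|exact: ltW].
      by move: Js; rewrite /J /I/= !in_itv/= sM andbT => /andP[].
  apply: (le_trans le1); rewrite -(integral_restrict leb _ mI).
  rewrite indicE (mem_set Ev) mulr1.
  have := integral_singular_powR e0 aM; rewrite addrK => /le_trans; apply.
  rewrite lee_fin ler_pM2r ?invr_gt0// ge0_ler_powR ?nnegrE ?(ltW e0)//.
  - by rewrite subr_ge0 ltW.
  - exact: ltW.
  - by rewrite opprB addrCA gerDl subr_le0.
have sI : ((\int[V]_z (g z)%:E) * h%:E <= \int[leb]_s \int[V]_v (H s v)%:E)%E.
  have I0 : (0 <= \int[V]_z (g z)%:E)%E by apply: integral_ge0 => z _; rewrite lee_fin.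
  have -> : ((\int[V]_z (g z)%:E) * h%:E = \int[leb]_s ((\int[V]_z (g z)%:E) * (\1_J s)%:E))%E.
    have mJE : measurable_fun setT (fun s : Rm => (\1_J s : R)%:E) by apply/measurable_EFinP; exact: m1J.
    have J0E (s : Rm) : setT s -> (0 <= (\1_J s)%:E :> \bar R)%E by rewrite lee_fin indic_ge0.
    rewrite (ge0_integralZl _ measurableT mJE J0E I0) integral_indic ?setIT//.
    have lJ : leb J = h%:E.
      by rewrite /J lebesgue_measure_itv/= lte_fin gtrBl h0 -EFinD opprB addrCA subrr addr0.
    by rewrite [X in (_ = _ * X)%E](lJ).
  apply: ge0_integral_mono; last 1 first.
  - move=> s; rewrite indicE; case: (asboolP (J s)) => Js; last first.
      by rewrite (memNset Js) mule0; apply: integral_ge0 => v _; rewrite lee_fin.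
    have [s0 s1] := J0 s Js.
    rewrite (mem_set Js) mule1; apply: (le_trans (integral_dilation s0 s1 mg g0)).
    by rewrite /H indicE (mem_set Js); under [leRHS]eq_integral do rewrite mulr1.
  - apply: emeasurable_funM; first exact: measurable_cst.
    by apply/measurable_EFinP; exact: m1J.
  - exact: m1.
  - by move=> s; rewrite mule_ge0 ?lee_fin ?indic_ge0.
apply: (lee_of_pmul2r h0); apply: (le_trans sI); rewrite eT.
have c0 : 0 <= h `^ (ga + 1) / (ga + 1) by rewrite divr_ge0 ?powR_ge0 ?ltW.
apply: (@le_trans _ _ (\int[V]_v (h `^ (ga + 1) / (ga + 1) * \1_E' v)%:E)%E).
  apply: ge0_le_integral => //.
  - by move=> v _; apply: integral_ge0 => s _; rewrite lee_fin.
  - apply/measurable_EFinP; apply: measurable_funM; first exact: measurable_cst.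
    exact: measurable_indic.
rewrite (integral_indic_scale V c0 mE') muleAC -EFinM.
rewrite mulrAC -[X in _ `^ ga * X](powRr1 (ltW h0)) -powRD ?(gt_eqF h0) ?implybT//.
Qed.
End dilation.

(** * Estimates of Forelli and Rudin type *)
Section forelli_rudin.
Variables (R : realType) (n : nat).
Local Notation C := R[i].
Local Notation nc := (@Normc.normc R).
Local Notation Cn := (measCn R n.+1).
Local Notation V := (@lebesgue_Cn R n.+1).
Local Notation B := (@unit_ball R n.+1).
Implicit Types (z w u v a : 'rV[C]_n.+1) (f : 'rV[C]_n.+1 -> C).

Lemma measurable_dist (u : 'rV[C]_n.+1) :
  measurable_fun setT (fun z : Cn => nrm ((z : 'rV[C]_n.+1) - u)).
Proof.
apply: measurable_nrm.
by apply: measurable_CnB; [exact: measurable_id|exact: measurable_cst].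
Qed.

(** Dilations with ratio in [[1 - delta u / 2, 1]] move points of the ball by
    at most [delta u], so the enlarged set is a ball of comparable radius. *)
Lemma boundary_ball_integral (ga c : R) : -1 < ga -> ga < 0 -> 0 < c ->
  exists2 K : R, 0 < K & forall u, unit_ball u ->
  (\int[V]_z (delta z `^ ga * \1_(B `&` [set z | nrm (z - u) < c * delta u]%classic : set Cn) z)%:E
    <= (K * delta u `^ (ga + (n.+1%:R + n.+1%:R)))%:E)%E.
Proof.
move=> ga1 ga0 c0; have c10 : 0 < 2 * (1 + c) by rewrite mulr_gt0// addr_gt0.
have e0 : 0 < ga + 1 by rewrite -ltrBlDr sub0r.
exists ((2^-1) `^ ga / (ga + 1) * (2 * (1 + c)) `^ (n.+1%:R + n.+1%:R)).
  by rewrite mulr_gt0 ?divr_gt0 ?powR_gt0.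
move=> u hu; have du := delta_gt0 hu; have d1 := delta_le1 u.
pose E : set Cn := B `&` [set z | nrm (z - u) < c * delta u]%classic.
pose E' : set Cn := (fun z : Cn => ((z : 'rV[C]_n.+1) + (- u) : Cn)) @^-1` nball ((1 + c) * delta u).
have mt := @mpres_translation R n.+1 (- u).
have mE : measurable E.
  apply: measurableI; first exact: measurable_unit_ball.
  exact: (measurable_below (c * delta u) (measurable_dist u)).
have mE' : measurable E' by apply: (measurable_preim mt.1); exact: measurable_nball.
have h0 : 0 < delta u / 2 by rewrite divr_gt0.
have h1 : delta u / 2 < 1 by lra.
have EB : E `<=` B by move=> z [].
have EE' (s : R) v : 1 - delta u / 2 <= s -> s <= 1 -> E (s%:C%C *: v) -> E' v.
  move=> s1 s2 [/in_unit_ball b1 /= b2]; rewrite /E' /nball/=.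
  have s0 : 0 < s by lra.
  move: b1; rewrite nrmZ nc_real gtr0_norm// => b1.
  have -> : v - u = (v - s%:C%C *: v) + (s%:C%C *: v - u) by rewrite addrA subrK.
  apply: (le_lt_trans (ler_nrmD _ _)); rewrite mulrDl mul1r ler_ltD//.
  have -> : v - s%:C%C *: v = (1 - s)%:C%C *: v by rewrite rmorphB scalerBl scale1r.
  rewrite nrmZ nc_real ger0_norm ?subr_ge0//.
  have v2 : nrm v <= 2.
    have := nrm_ge0 v; move: (nrm v) b1 => x; clear -s1 d1; nra.
  by have := nrm_ge0 v; move: (nrm v) v2 => x; clear -s1 d1 s2 du; nra.
have := dilation_bound ga1 ga0 h0 h1 mE mE' EB EE'.
have -> : V E' = V (nball ((1 + c) * delta u)) by apply: mt.2; exact: measurable_nball.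
have r0 : 0 < (1 + c) * delta u by rewrite mulr_gt0// addr_gt0.
move=> /le_trans; apply.
have k0 : (0 <= ((delta u / 2) `^ ga / (ga + 1))%:E)%E.
  by rewrite lee_fin divr_ge0 ?powR_ge0 ?ltW.
apply: (le_trans (lee_wpmul2l k0 (@volume_nball R n _ r0).2)); rewrite -EFinM lee_fin.
rewrite mulrA (powRM _ (ltW c10) (ltW du)) (powRM _ (ltW du)) ?invr_ge0//.
rewrite (@powRD _ (delta u) ga) ?(gt_eqF du) ?implybT//.
rewrite le_eqVlt; apply/orP; left; apply/eqP.
by ring.
Qed.

(** Contains the quotients of the points of [carleson a r] by ratios in [[1 -
    r / 8, 1]]. *)
Definition cap a (r : R) : set Cn := [set v | gap v a < 4 * r] `&` [set v | sqnorm v < 1 + r].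

Lemma measurable_cap a r : measurable (cap a r).
Proof.
apply: measurableI; first exact: (measurable_below (4 * r) (measurable_gap a)).
exact: (measurable_below (1 + r) (measurable_sqnorm (@measurable_id _ Cn setT))).
Qed.

(** In coordinates in which [<v, a>] is the first coordinate times the
    conjugate of [c], with [|c| = |a|], the first coordinate lies in a disc of
    radius of order [r] and, by the bound on the norm, the others are of order
    the square root of [r]. *)
Lemma cap_volume : exists2 K : R, 0 < K & forall a (r : R), unit_ball a -> 0 < r ->
  (V (cap a r) <= (K * r `^ n.+2%:R)%:E)%E.
Proof.
exists (20 ^+ 2 * \prod_(k < n) (6 ^+ 2)).
  by rewrite mulr_gt0 ?exprn_gt0 ?prodr_gt0 => // [|k _]; rewrite exprn_gt0.
move=> a r ha r0; have [U hU [c nc_c hc]] := unitary_align a.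
pose s := Num.sqrt r.
have s0 : 0 < s by rewrite sqrtr_gt0.
have s2 : s ^+ 2 = r by rewrite sqr_sqrtr ?ltW.
pose rho (k : 'I_n.+1) : R := if k == 0 then 10 * r else 3 * s.
have rho0 k : 0 <= rho k by rewrite /rho; case: eqP => _; rewrite mulr_ge0 ?(ltW r0) ?(ltW s0).
have c1 : nc c < 1 by rewrite nc_c; apply/in_unit_ball.
(* When [|c| >= 1 / 2] the disc is centred at the inverse of the conjugate of
   [c]; otherwise [r] is bounded below and a disc centred at 0 is large
   enough. *)
pose zeta : C := if 2^-1 <= nc c then (c^*%C)^-1 else 0.
pose ctr : 'rV[C]_n.+1 := \row_k (if k == 0 then zeta else 0).
have [mb hb] := volume_box ctr rho0.
have <- : V (box ctr rho) = (20 ^+ 2 * \prod_(k < n) (6 ^+ 2) * r `^ n.+2%:R)%:E.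
  rewrite hb big_ord_recl /=; congr (_%:E).
  have -> : \prod_(i < n) (2 * rho (lift ord0 i)) ^+ 2 = \prod_(k < n) (6 ^+ 2) * r ^+ n.
    have -> : r ^+ n = \prod_(k < n) r by rewrite prodr_const card_ord.
    rewrite -big_split; apply: eq_bigr => k _.
    by rewrite /rho /= -s2; ring.
  rewrite /rho eqxx powR_mulrn ?(ltW r0)//.
  have -> : r ^+ n.+2 = r ^+ 2 * r ^+ n by rewrite -exprD.
  by move: (\prod_(k < n) _) (r ^+ n) => x t; ring.
have := (@mpres_unitary R n.+1 U hU).2 _ (measurable_cap a r) => <-.
apply: le_measure; rewrite ?inE//.
  exact: (measurable_preim (@measurable_mulmx R n.+1 U) (measurable_cap a r)).
move=> z [/= g1 g2].
have {}g1 : nc (1 - c^*%C * z 0 0) < 4 * r by move: g1; rewrite /gap hc.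
have {}g2 : sqnorm z < 1 + r by move: g2; rewrite -!sqr_nrm nrm_unitary.
have z0 : 1 - 4 * r < nc c * nc (z 0 0).
  have := ler_ncB (1 - c^*%C * z 0 0) (- (c^*%C * z 0 0)).
  rewrite opprK subrK ncN Normc.normcM nc_conj.
  have -> : nc (1 : C) = 1 by rewrite nc_real normr1.
  by move: g1; clear; lra.
have z00 : nc (z 0 0) ^+ 2 < 1 + r.
  by apply: le_lt_trans g2; rewrite sqnormE (bigD1 0)//= lerDl sumr_ge0// => j _; exact: sqr_ge0.
have zk k : nc (z 0 k - ctr 0 k) <= rho k.
  rewrite /ctr /rho mxE; case: (eqVneq k 0) => [->|k0].
    rewrite /zeta; case: ifP => [c2|/negbT].
      have cn0 : c^*%C != 0.
        by apply/eqP => e; move: c2; rewrite -nc_conj e Normc.normc0 leNgt invr_gt0 ltr0n.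
      have -> : z 0 0 - (c^*%C)^-1 = - ((c^*%C)^-1 * (1 - c^*%C * z 0 0)).
        by rewrite mulrBr mulr1 mulrA mulVf// mul1r opprB.
      rewrite ncN Normc.normcM Normc.normcV nc_conj.
      have nc0 : 0 < nc c by apply: lt_le_trans c2.
      by rewrite ler_pdivrMl//; move: g1 c2 r0; clear; move: (nc _) (nc _) => x y; nra.
    rewrite -ltNge subr0 => c2.
    move: z0 z00 c2 (nc_ge0 c) (nc_ge0 (z 0 0)) r0; clear; move: (nc _) (nc _) => x y; nra.
  rewrite subr0 -(@ler_pXn2r _ 2) ?nnegrE ?nc_ge0 ?mulr_ge0 ?(ltW s0)// exprMn s2.
  have : nc (z 0 0) ^+ 2 + nc (z 0 k) ^+ 2 <= sqnorm z.
    rewrite sqnormE (bigD1 0)//= lerD2l (bigD1 k)//= lerDl sumr_ge0// => j _; exact: sqr_ge0.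
  have : 1 - 8 * r <= nc (z 0 0) ^+ 2 .
    have : nc c * nc (z 0 0) <= nc (z 0 0) by rewrite ler_piMl ?nc_ge0// ltW.
    move: z0 (sqr_ge0 (nc (z 0 0) - 1)); clear; move: (nc c * nc (z 0 0)) (nc (z 0 0)) => x y.
    have -> : (y - 1) ^+ 2 = y ^+ 2 - 2 * y + 1 by ring.
    by move: (y ^+ 2) => t; lra.
  move: g2 (r0); clear; move: (nc (z 0 0) ^+ 2) (nc (z 0 k) ^+ 2) (sqnorm z) => x y t.
  have -> : 3 ^+ 2 = 9 :> R by ring.
  by lra.
move=> k; have := zk k; rewrite !in_itv/= => h; split.
  have := le_trans (ler_nc_Re _) h; rewrite cReD cReN ler_norml => /andP[h1 h2].
  by apply/andP; split; move: h1 h2; clear; lra.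
have := le_trans (ler_nc_Im _) h; rewrite cImD cImN ler_norml => /andP[h1 h2].
by apply/andP; split; move: h1 h2; clear; lra.
Qed.

(** A Carleson box: the trace of a nonisotropic ball around [a]. *)
Definition carleson a (r : R) : set Cn := B `&` [set z | gap z a < r]%classic.

Lemma measurable_carleson a r : measurable (carleson a r).
Proof.
apply: measurableI; first exact: measurable_unit_ball.
exact: (measurable_below r (measurable_gap a)).
Qed.

Lemma gap_le2 z a : unit_ball z -> unit_ball a -> gap z a <= 2.
Proof.
move=> /in_unit_ball/ltW hz /in_unit_ball/ltW ha; apply: (le_trans (ler_ncB _ _)).
have -> : nc (1 : C) = 1 by rewrite nc_real normr1.
rewrite (_ : 2 = 1 + 1)// lerD2l (le_trans (nc_dotmx z a))//.
by rewrite mulr_ile1 ?nrm_ge0.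
Qed.

(** Dilation argument with [h = r / 8] for [r <= 4]; beyond that the set no
    longer grows. *)
Lemma carleson_integral (ga : R) : -1 < ga -> ga < 0 -> exists2 K : R, 0 < K &
  forall a (r : R), unit_ball a -> 0 < r ->
  (\int[V]_z (delta z `^ ga * \1_(carleson a r) z)%:E <= (K * r `^ (ga + n.+2%:R))%:E)%E.
Proof.
move=> ga1 ga0; have [K K0 HK] := cap_volume.
have e0 : 0 < ga + 1 by rewrite -ltrBlDr sub0r.
have e1 : 0 < ga + n.+2%:R by rewrite -addn1 natrD addrCA ltr_wpDl.
pose K1 : R := (8^-1) `^ ga / (ga + 1) * K.
have K10 : 0 < K1 by rewrite mulr_gt0 ?divr_gt0 ?powR_gt0.
have small a (r : R) : unit_ball a -> 0 < r -> r <= 4 ->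
  (\int[V]_z (delta z `^ ga * \1_(carleson a r) z)%:E <= (K1 * r `^ (ga + n.+2%:R))%:E)%E.
  move=> ha r0 r4.
  have h0 : 0 < r / 8 by rewrite divr_gt0.
  have h1 : r / 8 < 1 by lra.
  have EB : carleson a r `<=` B by move=> z [].
  have EE' (s : R) v : 1 - r / 8 <= s -> s <= 1 -> carleson a r (s%:C%C *: v) -> cap a r v.
    move=> s1 s2 [/in_unit_ball b1 /= b2].
    have s0 : 0 < s by lra.
    move: b1; rewrite nrmZ nc_real gtr0_norm// => b1; split => /=.
      have e : s%:C%C * (1 - dotmx v a) = (1 - dotmx (s%:C%C *: v) a) - (1 - s)%:C%C.
        have -> : (1 - s)%:C%C = 1 - s%:C%C :> C by rewrite rmorphB rmorph1.
        by rewrite dotmxZl; move: (dotmx v a) (s%:C%C) => x y; ring.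
      have h : s * gap v a <= gap (s%:C%C *: v) a + (1 - s).
        have := ler_ncB (1 - dotmx (s%:C%C *: v) a) (1 - s)%:C%C.
        by rewrite -e Normc.normcM !nc_real (gtr0_norm s0) (ger0_norm (_ : 0 <= 1 - s)) ?subr_ge0.
      have y0 : 0 <= gap v a by exact: nc_ge0.
      clear -b2 h s1 s2 r0 r4 y0; move: (gap _ a) (gap v a) b2 h y0 => x y b2 h y0; nra.
    rewrite -sqr_nrm; have := nrm_ge0 v; move: b1; move: (nrm v) => x; clear -s1 s2 r0 r4 s0 => b1 x0.
    have x2 : x < 2 by nra.
    have q1 : (1 - r / 8) * x < 1 by nra.
    nra.
  have := dilation_bound ga1 ga0 h0 h1 (measurable_carleson a r) (measurable_cap a r) EB EE'.
  move=> /le_trans; apply.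
  have k0 : (0 <= ((r / 8) `^ ga / (ga + 1))%:E)%E.
    by rewrite lee_fin divr_ge0 ?powR_ge0 ?ltW.
  apply: (le_trans (lee_wpmul2l k0 (HK a r ha r0))); rewrite -EFinM lee_fin.
  rewrite (powRM _ (ltW r0)) ?invr_ge0// (@powRD _ r ga) ?(gt_eqF r0) ?implybT//.
  by rewrite le_eqVlt; apply/orP; left; apply/eqP; rewrite /K1; ring.
exists K1 => // a r ha r0; have [r4|r4] := leP r 4; first exact: small.
have -> : carleson a r = carleson a 4.
  apply/seteqP; split => z [hz /= g]; split => //=.
    by apply: le_lt_trans (gap_le2 hz ha) _; rewrite ltr_nat.
  exact: lt_trans r4.
have h4 : 0 < 4 :> R by rewrite ltr0n.
apply: (le_trans (small a 4 ha h4 (lexx _))); rewrite lee_fin ler_pM2l//.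
by rewrite ge0_ler_powR ?nnegrE ?(ltW e1) ?(ltW r0) ?(ltW r4).
Qed.

Lemma integral_sum_le (J : nat) (g : nat -> Cn -> R) (c : nat -> R) :
  (forall j, measurable_fun setT (g j)) -> (forall j z, 0 <= g j z) ->
  (forall j, (\int[V]_z (g j z)%:E <= (c j)%:E)%E) ->
  (\int[V]_z (\sum_(j < J) g j z)%:E <= (\sum_(j < J) c j)%:E)%E.
Proof.
move=> mg g0 gc; elim: J => [|J IH].
  by rewrite big_ord0; under eq_integral do rewrite big_ord0; rewrite integral0.
under eq_integral do rewrite big_ord_recr/=.
have ms : measurable_fun setT (fun z : Cn => \sum_(j < J) g j z) by apply: measurable_sum.
have s0 z : 0 <= \sum_(j < J) g j z by apply: sumr_ge0.
rewrite (nonneg_integralD V ms (mg J) (fun z : Cn => s0 z) (fun z : Cn => g0 J z)) big_ord_recr/=.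
by rewrite EFinD; apply: leeD; [exact: IH|exact: gc].
Qed.

Lemma geometric_le (x : R) (J : nat) : 0 <= x -> x < 1 -> \sum_(j < J) x ^+ j <= (1 - x)^-1.
Proof.
move=> x0 x1; rewrite -[leRHS]mul1r ler_pdivlMr ?subr_gt0//.
have e := subrX1 x J; have -> : (\sum_(j < J) x ^+ j) * (1 - x) = 1 - x ^+ J.
  by rewrite mulrC -opprB mulNr -e opprB.
by rewrite gerBl exprn_ge0.
Qed.

(** Cut the ball along the dyadic values [2 ^ j * delta a] of [gap z a], which
    is at least [delta a / 2]. On each piece [delta z <= 2 * gap z a] reduces
    the exponent [be] to some [ga] in the interval ]-1, 0[ and
    [carleson_integral] applies; the resulting series is geometric of ratio [2
    ^ (- m)]. *)
Lemma forelli_rudin (m q : R) : 0 < m -> 0 < q ->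
  let be := q + m - n.+2%:R in -1 < be -> exists2 K : R, 0 < K &
  forall a, unit_ball a ->
  (\int[V]_z (delta z `^ be * gap z a `^ (- (m + m + q)) * \1_(B : set Cn) z)%:E <=
    (K * delta a `^ (- m))%:E)%E.
Proof.
move=> m0 q0 be be1.
pose ka := (Num.max be 0 + be + 1) / 2; pose ga := be - ka.
have [ka0 [ga1 ga0]] : 0 < ka /\ -1 < ga /\ ga < 0.
  rewrite /ga /ka; case: (leP be 0) => h; split; try split; lra.
have [K K0 HK] := carleson_integral ga1 ga0.
pose t := m + m + q; pose x : R := 2 `^ (- m).
have t0 : 0 < t by rewrite !addr_gt0.
have x0 : 0 < x by rewrite powR_gt0.
have x1 : x < 1.
  have h : 1 `^ m < 2 `^ m :> R by rewrite gt0_ltr_powR ?nnegrE// ltr1n.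
  by rewrite /x powRN invf_lt1 ?powR_gt0//; move: h; rewrite powR1.
exists (2 `^ ka * 2 `^ t * K * (1 - x)^-1).
  by rewrite !mulr_gt0 ?powR_gt0// invr_gt0 subr_gt0.
move=> a ha; have da := delta_gt0 ha.
pose r (j : nat) : R := 2 ^+ j * delta a.
have r0 j : 0 < r j by rewrite mulr_gt0// exprn_gt0.
pose c j := 2 `^ ka * 2 `^ t * r j `^ (ka - t).
have c0 j : 0 <= c j by rewrite !mulr_ge0// powR_ge0.
pose g j (z : Cn) : R := c j * (delta z `^ ga * \1_(carleson a (r j)) z).
have g00 j (z : Cn) : 0 <= delta z `^ ga * \1_(carleson a (r j)) z.
  by apply: (@mulr_ge0 R); [exact: powR_ge0|exact: indic_ge0].
have g0 j z : 0 <= g j z by apply: (@mulr_ge0 R).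
have mg0 j : measurable_fun setT (fun z : Cn => delta z `^ ga * \1_(carleson a (r j)) z).
  apply: measurable_funM; first exact: measurable_delta_powR.
  by apply: measurable_indic; exact: measurable_carleson.
have mg j : measurable_fun setT (g j).
  by apply: measurable_funM; [exact: measurable_cst|exact: mg0].
have gc j : (\int[V]_z (g j z)%:E <= (c j * (K * r j `^ (ga + n.+2%:R)))%:E)%E.
  rewrite (integral_scale V (c0 j) (mg0 j) (g00 j)) (EFinM (c j)).
  by apply: lee_wpmul2l; [rewrite lee_fin c0|exact: HK].
have [J0 hJ0] := expn2_gt (2 / delta a).
(* All of the ball is covered by the first [J] radii. *)
pose J := J0.+1.
have := integral_sum_le J mg g0 gc.
have -> : \sum_(j < J) c j * (K * r j `^ (ga + n.+2%:R)) =
    2 `^ ka * 2 `^ t * K * delta a `^ (- m) * \sum_(j < J) x ^+ j.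
  rewrite mulr_sumr; apply: eq_bigr => j _; rewrite /c.
  have -> : x ^+ j = (2 ^+ j) `^ (- m).
    by rewrite /x -powR_mulrn ?powR_ge0// -powRrM mulrC powRrM powR_mulrn.
  have -> : 2 `^ ka * 2 `^ t * K * delta a `^ (- m) * (2 ^+ j) `^ (- m) =
      2 `^ ka * 2 `^ t * K * ((2 ^+ j) `^ (- m) * delta a `^ (- m)) by ring.
  rewrite -powRM ?exprn_ge0 ?(ltW da)// -/(r j).
  have -> : - m = (ka - t) + (ga + n.+2%:R) by rewrite /ga /t /be; ring.
  by rewrite (@powRD _ (r j) (ka - t)) ?(gt_eqF (r0 j)) ?implybT//; ring.
move=> H; apply: le_trans (le_trans H _); last first.
  rewrite lee_fin -!mulrA !ler_pM2l ?powR_gt0// mulrC ler_pM2r ?powR_gt0//.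
  exact: geometric_le (ltW x0) x1.
apply: integral_mono => //.
- apply: measurable_funM; last by apply: measurable_indic; exact: measurable_unit_ball.
  by apply: measurable_funM; [exact: measurable_delta_powR|exact: measurable_gap_powR].
- by apply: measurable_sum.
- by move=> z; rewrite !(@mulr_ge0 R) ?powR_ge0 ?indic_ge0.
move=> z; case: (asboolP (B z)) => hz; last first.
  by rewrite [\1_B z]indicE (memNset hz) mulr0; apply: sumr_ge0.
rewrite [\1_B z]indicE (mem_set hz) mulr1.
have dz := delta_gt0 hz.
have gz : 0 < gap z a := nc_1sub_gt0 hz ha.
have gd : delta z / 2 <= gap z a := nc_1sub_ge hz ha.
have ga2 : delta a / 2 <= gap z a by rewrite /gap nc_1subC; exact: nc_1sub_ge.
have exJ : exists j, gap z a < r j.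
  by exists J0; apply: (le_lt_trans (gap_le2 hz ha)); rewrite /r -ltr_pdivrMr.
case: (ex_minnP exJ) => j gj jmin.
have jJ : (j < J)%N.
  by rewrite ltnS; apply: jmin; apply: (le_lt_trans (gap_le2 hz ha)); rewrite /r -ltr_pdivrMr.
have rj : r j / 2 <= gap z a.
  case: j gj jmin {jJ} => [|j] gj jmin; first by rewrite /r expr0 mul1r.
  have -> : r j.+1 / 2 = r j by rewrite /r exprS; field.
  rewrite leNgt; apply/negP => /jmin.
  by rewrite ltnn.
rewrite (bigD1 (Ordinal jJ))//= -[leLHS]addr0; apply: lerD; last by apply: sumr_ge0.
rewrite /g indicE (@mem_set _ (carleson a (r j)) z) ?mulr1; last by split.
have -> : delta z `^ be = delta z `^ ka * delta z `^ ga.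
  by rewrite -powRD ?(gt_eqF dz) ?implybT//; congr (_ `^ _); rewrite /ga; ring.
have b1 : delta z `^ ka <= 2 `^ ka * r j `^ ka.
  have n1 : 0 <= 2 * r j := mulr_ge0 (ler0n R 2) (ltW (r0 j)).
  rewrite -powRM ?(ltW (r0 j))//; apply: ge0_ler_powR; rewrite ?nnegrE ?(ltW ka0) ?(ltW dz)//.
  by move: gd gj; clear; lra.
have b2 : gap z a `^ (- (m + m + q)) <= 2 `^ t * r j `^ (- t).
  apply: (@le_trans _ _ ((r j / 2) `^ (- t))).
    by apply: powR_anti => //; [rewrite divr_gt0|rewrite oppr_le0 ltW].
  rewrite (powRM _ (ltW (r0 j))) ?invr_ge0// mulrC ler_wpM2r ?powR_ge0//.
  by rewrite -(powR_inv1 (ler0n R 2)) -powRrM mulN1r opprK.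
rewrite /c (@powRD _ (r j) ka) ?(gt_eqF (r0 j)) ?implybT//.
have -> : 2 `^ ka * 2 `^ t * (r j `^ ka * r j `^ (- t)) * delta z `^ ga =
   (2 `^ ka * r j `^ ka) * delta z `^ ga * (2 `^ t * r j `^ (- t)) by ring.
apply: ler_pM; rewrite ?mulr_ge0 ?powR_ge0//.
by rewrite ler_wpM2r ?powR_ge0.
Qed.
End forelli_rudin.

(** * Pointwise bound for the Gleason operators *)
Lemma root_bound (R : realType) (p x c y d e : R) : 0 < p -> 0 <= x -> 0 <= c -> 0 <= y -> 0 < d ->
  x `^ p <= c * y * d `^ e -> x <= c `^ p^-1 * y `^ p^-1 * d `^ (e / p).
Proof.
move=> p0 x0 c0 y0 d0 h; have pn : p != 0 by rewrite gt_eqF.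
have e1 : x = (x `^ p) `^ p^-1 by rewrite -powRrM mulfV// powRr1.
rewrite [leLHS]e1 (powRrM d) -!powRM ?mulr_ge0 ?powR_ge0//.
by apply: ge0_ler_powR; rewrite ?nnegrE ?invr_ge0 ?mulr_ge0 ?powR_ge0 ?(ltW p0).
Qed.

Lemma powR_add_le (R : realType) (p x y : R) : 0 < p -> 0 <= x -> 0 <= y ->
  (x + y) `^ p <= 2 `^ p * (x `^ p + y `^ p).
Proof.
move=> p0; wlog xy : x y / x <= y => [H x0 y0|x0 y0].
  by have [/ltW h|h] := ltP y x; [rewrite addrC [x `^ p + _]addrC|]; exact: H.
apply: (@le_trans _ _ ((2 * y) `^ p)).
  apply: ge0_ler_powR; rewrite ?nnegrE ?addr_ge0 ?mulr_ge0 ?(ltW p0)//.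
  by rewrite mulr2n mulrDl mul1r lerD2r.
by rewrite powRM// ler_pM2l ?powR_gt0// lerDr powR_ge0.
Qed.

Section main_estimate.
Variables (R : realType) (n : nat).
Local Notation C := R[i].
Local Notation nc := (@Normc.normc R).
Local Notation Cn := (measCn R n.+1).
Local Notation V := (@lebesgue_Cn R n.+1).
Local Notation B := (@unit_ball R n.+1).
Local Notation leb := (@lebesgue_measure R).
Local Notation Rm := (measurableTypeR R).
Local Notation NN := (n.+1%:R + n.+1%:R : R).
Implicit Types (z w u v a b : 'rV[C]_n.+1) (f : 'rV[C]_n.+1 -> C).

Local Notation pt b z t := (b + (t : R)%:C%C *: (z - b)).

(** Concavity of [delta] on the segment. *)
Lemma delta_pt b z (t : R) : unit_ball b -> unit_ball z -> 0 <= t <= 1 ->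
  delta b / 2 * (1 - t + delta z) <= delta (pt b z t).
Proof.
move=> hb hz ht; have := delta_convex ht (ltW (iffLR (in_unit_ball b) hb)) (ltW (iffLR (in_unit_ball z) hz)); have db := delta_gt0 hb; have dz := delta_gt0 hz.
move=> h; apply: le_trans h.
have b1 := delta_le1 b; have z1 := delta_le1 z.
move: ht db dz b1 z1; move: (delta b) (delta z) => x y /andP[t0 t1] x0 y0 x1 y1; clear -t0 t1 x0 y0 x1 y1.
rewrite -subr_ge0.
have -> : (1 - t) * x + t * y - x / 2 * (1 - t + y) =
  t * y * (1 - x / 2) + (1 - t) * (x / 2) * (1 - y) by field.
have x2 : x / 2 <= 1 by lra.
by rewrite addr_ge0 ?mulr_ge0 ?subr_ge0 ?divr_ge0 ?(ltW x0) ?(ltW y0).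
Qed.

Lemma nrm_pt b z (t : R) : unit_ball b -> unit_ball z -> 0 <= t <= 1 ->
  nrm (pt b z t - z) <= 2 * (1 - t).
Proof.
move=> /in_unit_ball/ltW hb /in_unit_ball/ltW hz /andP[t0 t1].
have -> : pt b z t - z = (1 - t)%:C%C *: (b - z).
  have -> : (1 - t)%:C%C = 1 - t%:C%C :> C by rewrite rmorphB rmorph1.
  rewrite scalerBl scale1r -[z - b]opprB scalerN; move: (_ *: _) => x.
  by rewrite addrAC.
rewrite nrmZ nc_real ger0_norm ?subr_ge0// mulrC ler_wpM2r ?subr_ge0//.
by apply: (le_trans (ler_nrmB _ _)); rewrite (_ : 2 = 1 + 1)// lerD.
Qed.

(** The part of the ball seen from [z] when the mean value inequality is
    applied along the segment from [b] to [z]. *)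
Definition approach_region (c2 : R) a z : set Cn :=
  [set u | nrm (u - z) < c2 * delta u] `&` [set u | gap u a < 10 * gap z a].

Lemma measurable_approach_region c2 a z : measurable (approach_region c2 a z).
Proof.
apply: measurableI.
  have mg : measurable_fun setT (fun u : Cn => nrm ((u : 'rV[C]_n.+1) - z) - c2 * delta (u : 'rV[C]_n.+1)).
    apply: measurable_funB; first exact: measurable_dist.
    apply: measurable_funM; first exact: measurable_cst.
    exact: (measurable_delta (@measurable_id _ Cn setT)).
  rewrite (_ : [set _ | _] = [set u : Cn | nrm ((u : 'rV[C]_n.+1) - z) - c2 * delta (u : 'rV[C]_n.+1) < 0]).
    exact: (measurable_below 0 mg).
  by apply/seteqP; split => u /=; rewrite subr_lt0.
exact: (measurable_below _ (measurable_gap a)).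
Qed.

Definition local_mass (p k c2 : R) f a z : \bar R :=
  (\int[V]_u (absf f u `^ p * (delta u `^ (k - NN) * \1_(approach_region c2 a z) u))%:E)%E.

(** On the ball of radius of order [d] around the point [w] of the segment,
    [delta] is comparable to [d] and, because [1 - t <= gap z a], the ball
    lies in the region over which [local_mass] integrates. The mean value
    inequality followed by a Cauchy estimate gives the bound. *)
Lemma partial_near (p k : R) b : 1 <= p -> 0 < k -> unit_ball b -> exists2 K : R, 0 < K &
  forall f a z (t y : R) j, holo f -> unit_ball a -> unit_ball z -> 0 <= t <= 1 ->
  1 - t <= gap z a -> 0 <= y ->
  (local_mass p k (24 / delta b) f a z <= y%:E)%E ->
  nc (partial j f (pt b z t)) <= K * y `^ p^-1 * (1 - t + delta z) `^ (- 1 - k / p).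
Proof.
move=> p1 k0 hb; have db := delta_gt0 hb; have b1 := delta_le1 b.
have p0 : 0 < p := lt_le_trans ltr01 p1.
pose c1 := delta b / 2; have c10 : 0 < c1 by rewrite divr_gt0.
have c11 : c1 <= 2^-1 by rewrite /c1; move: b1; clear; lra.
(* On the ball used below, [delta] and [d] differ at most by the factor [K1].
   *)
pose K1 := 8 / c1; have K10 : 0 < K1 by rewrite divr_gt0.
pose K2 := (K1 `^ `|k - NN|)^-1; have K20 : 0 < K2 by rewrite invr_gt0 powR_gt0.
pose K3 := (c1 / 16 / n.+1%:R / 2) `^ NN; have K30 : 0 < K3 by rewrite powR_gt0// !divr_gt0.
pose K4 := 2 `^ p / (K2 * K3); have K40 : 0 < K4 by rewrite divr_gt0 ?powR_gt0 ?mulr_gt0.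
exists (4 * K4 `^ p^-1 / (c1 / 16)); first by rewrite !divr_gt0 ?mulr_gt0 ?powR_gt0.
move=> f a z t y j hf ha hz ht tg y0 hy; have dz := delta_gt0 hz.
have t01 : 0 <= 1 - t by case/andP: ht => _; rewrite subr_ge0.
have [d dE] : exists d : R, d = 1 - t + delta z by eexists.
have d0 : 0 < d by rewrite dE ltr_wpDl.
pose w := pt b z t.
have dw : c1 * d <= delta w by rewrite dE; exact: delta_pt hb hz ht.
have cd0 : 0 < c1 * d by rewrite mulr_gt0.
have dw0 : 0 < delta w by exact: lt_le_trans dw.
have cdd : c1 * d <= d / 2 by rewrite mulrC ler_pM2l.
have [r rE] : exists r : R, r = c1 / 16 * d by eexists.
have rcd : r = c1 * d / 16 by rewrite rE mulrAC.
have r0 : 0 < r by rewrite rcd divr_gt0.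
have nw : nrm (w - z) <= 2 * (1 - t) := nrm_pt hb hz ht.
have gz : delta z / 2 <= gap z a := nc_1sub_ge hz ha.
have r4 : r <= delta w / 4.
  by rewrite rcd; move: dw cd0; clear; move: (c1 * d) (delta w) => x x'; lra.
have bz : nrm z <= 1 by apply/ltW/in_unit_ball.
have bnd h : nrm h <= r -> nc (f (w + h)) <= K4 `^ p^-1 * y `^ p^-1 * d `^ (- k / p).
  move=> hr; pose w' := w + h.
  have dw' : c1 * d / 4 <= delta w'.
    have := delta_step dw0 (le_trans hr r4); apply: le_trans.
    by rewrite ler_pM2r.
  have dw'0 : 0 < delta w' by apply: lt_le_trans dw'; rewrite divr_gt0.
  have hw' : unit_ball w' by apply/delta_gt0P.
  have disc v : nball r v -> disc_in_ball w' v.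
    rewrite /nball/= => /ltW hv; apply: disc_step => //; apply: (le_trans hv).
    by rewrite rcd; move: dw' cd0; clear; move: (c1 * d) (delta w') => x x'; lra.
  have inr v : nball r v ->
      [/\ c1 * d / 4 <= delta (w' + v), delta (w' + v) <= 7 * d & nrm (w' + v - z) < 3 * d].
    rewrite /nball/= => hv.
    have hv2 : nrm (h + v) <= delta w / 4.
      apply: (le_trans (ler_nrmD _ _)); move: dw hr hv cd0; rewrite rcd; clear.
      by move: (c1 * d) (delta w) (nrm h) (nrm v) => x1 x2 x3 x4; lra.
    have e : w' + v = w + (h + v) by rewrite addrA.
    have du : c1 * d / 4 <= delta (w' + v).
      by rewrite e; apply: le_trans (delta_step dw0 hv2); rewrite ler_pM2r.
    have uz : nrm (w' + v - z) < 3 * d.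
      have -> : w' + v - z = (h + v) + (w - z) by rewrite e addrAC addrC.
      apply: (le_lt_trans (ler_nrmD _ _)); have := ler_nrmD h v.
      move: hr hv nw cdd dz d0; rewrite rcd dE; clear.
      by move: (c1 * (1 - t + delta z)) (nrm (h + v)) (nrm h) (nrm v) (nrm (w - z)) (delta z) => x1 x2 x3 x4 x5 x6; lra.
    split => //.
    have bu : nrm (w' + v) <= 1.
      by apply/ltW/in_unit_ball/delta_gt0P; apply: lt_le_trans du; rewrite divr_gt0.
    apply: (le_trans (delta_lip bu bz)); move: uz t01; rewrite dE.
    by clear; move: (nrm _) (delta z) => x1 x2; lra.
  have mW : measurable_fun setT (fun u : Cn => delta u `^ (k - NN) * \1_(approach_region (24 / delta b) a z) u).
    apply: measurable_funM; first exact: measurable_delta_powR.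
    by apply: measurable_indic; exact: measurable_approach_region.
  have W0 (u : Cn) : 0 <= delta u `^ (k - NN) * \1_(approach_region (24 / delta b) a z) u.
    by apply: (@mulr_ge0 R); [exact: powR_ge0|exact: indic_ge0].
  have q0 : 0 <= K2 * d `^ (k - NN) by rewrite mulr_ge0 ?powR_ge0 ?(ltW K20).
  have kW v : nball r v -> K2 * d `^ (k - NN) <=
      delta (w' + v) `^ (k - NN) * \1_(approach_region (24 / delta b) a z) (w' + v).
    move=> /inr[i1 i2 i3].
    have u0 : 0 < delta (w' + v) by apply: lt_le_trans i1; rewrite divr_gt0.
    rewrite indicE mem_set ?mulr1; last first.
      split => /=.
        apply: (lt_le_trans i3).
        have -> : 24 / delta b = 12 / c1 by rewrite /c1; field; rewrite gt_eqF.
        rewrite mulrAC ler_pdivlMr// -ler_pdivrMl// mulrC; move: i1.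
        by rewrite -mulrA (mulrC d); clear; move: (c1 * d) (delta _) => x1 x2; lra.
      apply: (le_lt_trans (gap_lip (w' + v) z ha)).
      move: i3 tg gz t01 dz; rewrite dE; clear.
      by move: (gap z a) (nrm _) (delta z) => x1 x2 x3; lra.
    rewrite /K2 ler_pdivrMl ?powR_gt0//; apply: powR_comparable => //.
      rewrite /K1 mulrAC ler_pdivlMr// mulrC; move: i1 u0.
      by clear; move: (c1 * d) (delta _) => x1 x2; lra.
    apply: (le_trans i2); rewrite ler_pM2r// /K1 ler_pdivlMr//; move: c11; clear; lra.
  have nfin : (V (nball r) < +oo)%E by apply: (le_lt_trans (@volume_nball R n _ r0).2); rewrite ltry.
  have circ (t' : R) v : nball r v -> nball r (cis t' *: v).
    by rewrite /nball/= nrmZ nc_cis mul1r.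
  have := weighted_mean_value p1 hf hw' (@measurable_nball R n r) nfin circ disc mW W0 q0 kW.
  have kf0 : (0 <= (K2 * d `^ (k - NN) * nc (f w') `^ p)%:E)%E.
    by rewrite lee_fin !mulr_ge0 ?powR_ge0 ?(ltW K20).
  move=> /(le_trans (lee_wpmul2r kf0 (@volume_nball R n _ r0).1)).
  have t0 : (0 <= (2 `^ p)%:E :> \bar R)%E by rewrite lee_fin powR_ge0.
  move=> /le_trans/(_ (lee_wpmul2l t0 hy)); rewrite -!EFinM lee_fin.
  have -> : (r / n.+1%:R / 2) `^ NN = K3 * d `^ NN.
    have K3b : 0 <= c1 / 16 / n.+1%:R / 2 by exact: (divr_ge0 (divr_ge0 (divr_ge0 (ltW c10) (ler0n R 16)) (ler0n R n.+1)) (ler0n R 2)).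
    rewrite /K3 -(powRM _ K3b (ltW d0)).
    by congr (_ `^ _); rewrite rE; ring.
  have dk : d `^ NN * d `^ (k - NN) = d `^ k.
    by rewrite -powRD ?(gt_eqF d0) ?implybT//; congr (_ `^ _); ring.
  move=> H; apply: (root_bound p0 (nc_ge0 _) (ltW K40) y0 d0).
  rewrite powRN ler_pdivlMr ?powR_gt0// /K4 mulrAC ler_pdivlMr ?mulr_gt0//.
  by apply: le_trans H; rewrite -dk le_eqVlt; apply/orP; left; apply/eqP; ring.
apply: (le_trans (partial_sup j hf dw0 r0 r4 bnd)); rewrite -dE rE.
have -> : d `^ (- 1 - k / p) = d^-1 * d `^ (- k / p).
  by rewrite mulNr (@powRD _ d (-1)) ?(gt_eqF d0) ?implybT// (powR_inv1 (ltW d0)).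
rewrite le_eqVlt; apply/orP; left; apply/eqP.
move: (K4 `^ _) (y `^ _) (d `^ _) => x1 x2 x3; field.
by rewrite ?(gt_eqF d0) ?(gt_eqF c10).
Qed.

(** The growth bound at the points at distance at most [delta w / 4] of [w],
    followed by a Cauchy estimate. *)
Lemma partial_far (p q : R) b : 1 <= p -> 0 < q -> unit_ball b -> exists2 K : R, 0 < K &
  forall f z (t N : R) j, holo f -> unit_ball z -> 0 <= t <= 1 -> 0 <= N ->
  (forall u, unit_ball u -> nc (f u) `^ p <= N * delta u `^ (- q)) ->
  nc (partial j f (pt b z t)) <= K * N `^ p^-1 * (1 - t + delta z) `^ (- 1 - q / p).
Proof.
move=> p1 q0 hb; have db := delta_gt0 hb.
have p0 : 0 < p := lt_le_trans ltr01 p1.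
pose c1 := delta b / 2; have c10 : 0 < c1 by rewrite divr_gt0.
(* A lower bound of [delta / d] on the ball of radius [delta w / 4] around
   [w]. *)
pose c4 := c1 / 4; have c40 : 0 < c4 by rewrite divr_gt0.
pose K4 := c4 `^ (- q); have K40 : 0 < K4 by rewrite powR_gt0.
exists (4 * K4 `^ p^-1 / c4); first by rewrite divr_gt0 ?mulr_gt0 ?powR_gt0.
move=> f z t N j hf hz ht N0 hG; have dz := delta_gt0 hz.
have t01 : 0 <= 1 - t by case/andP: ht => _; rewrite subr_ge0.
have [d dE] : exists d : R, d = 1 - t + delta z by eexists.
have d0 : 0 < d by rewrite dE ltr_wpDl.
pose w := pt b z t.
have dw : c1 * d <= delta w by rewrite dE; exact: delta_pt hb hz ht.
have cd0 : 0 < c1 * d by rewrite mulr_gt0.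
have dw0 : 0 < delta w by exact: lt_le_trans dw.
have [r rE] : exists r : R, r = c4 * d by eexists.
have rcd : r = c1 * d / 4 by rewrite rE /c4 mulrAC.
have r0 : 0 < r by rewrite rcd divr_gt0.
have r4 : r <= delta w / 4 by rewrite rcd ler_pM2r.
have bnd h : nrm h <= r -> nc (f (w + h)) <= K4 `^ p^-1 * N `^ p^-1 * d `^ (- q / p).
  move=> hr; pose w' := w + h.
  have dw' : c4 * d <= delta w'.
    have := delta_step dw0 (le_trans hr r4); apply: le_trans.
    by rewrite -rE.
  have hw' : unit_ball w' by apply/delta_gt0P; apply: lt_le_trans dw'; rewrite mulr_gt0.
  apply: (root_bound p0 (nc_ge0 _) (ltW K40) N0 d0).
  apply: (le_trans (hG w' hw')); rewrite (mulrC K4) -mulrA ler_wpM2l//.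
  rewrite /K4 -(powRM _ (ltW c40) (ltW d0)).
  by apply: powR_anti => //; [rewrite mulr_gt0|rewrite oppr_le0 ltW].
apply: (le_trans (partial_sup j hf dw0 r0 r4 bnd)); rewrite -dE rE.
have -> : d `^ (- 1 - q / p) = d^-1 * d `^ (- q / p).
  by rewrite mulNr (@powRD _ d (-1)) ?(gt_eqF d0) ?implybT// (powR_inv1 (ltW d0)).
rewrite le_eqVlt; apply/orP; left; apply/eqP.
move: (K4 `^ _) (N `^ _) (d `^ _) c40 => x1 x2 x3; move: (c4) => c4' c40; field.
by rewrite ?(gt_eqF d0) ?(gt_eqF c40).
Qed.

(** When [1 - t > gap z a], the quantity [1 - t + delta z] of [partial_far]
    may be replaced by [1 - t + gap z a] at the cost of a constant. The
    exponent of the second term thus no longer involves [delta z]. *)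
Lemma partial_bound (p q k : R) b : 1 <= p -> 0 < q -> 0 < k -> unit_ball b -> exists2 K : R, 0 < K &
  forall f a z (t y N : R) j, holo f -> unit_ball a -> unit_ball z -> 0 <= t <= 1 ->
  0 <= y -> (local_mass p k (24 / delta b) f a z <= y%:E)%E ->
  0 <= N -> (forall u, unit_ball u -> nc (f u) `^ p <= N * delta u `^ (- q)) ->
  nc (partial j f (pt b z t)) <= K * (y `^ p^-1 * (1 - t + delta z) `^ (- 1 - k / p) +
    N `^ p^-1 * (1 - t + gap z a) `^ (- 1 - q / p)).
Proof.
move=> p1 q0 k0 hb; have [K1 K10 H1] := partial_near p1 k0 hb; have [K2 K20 H2] := partial_far p1 q0 hb.
have p0 : 0 < p := lt_le_trans ltr01 p1.
pose K3 := K2 * 2 `^ (1 + q / p); have K30 : 0 < K3 by rewrite mulr_gt0 ?powR_gt0.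
exists (K1 + K3); first by rewrite addr_gt0.
move=> f a z t y N j hf ha hz ht y0 hy N0 hG; have dz := delta_gt0 hz.
have t01 : 0 <= 1 - t by case/andP: ht => _; rewrite subr_ge0.
have g0 : 0 < gap z a := nc_1sub_gt0 hz ha.
set X := y `^ _ * _; set Z := N `^ _ * _.
have X0 : 0 <= X by rewrite mulr_ge0 ?powR_ge0.
have Z0 : 0 <= Z by rewrite mulr_ge0 ?powR_ge0.
have [tg|gt] := leP (1 - t) (gap z a).
  apply: (le_trans (H1 f a z t y j hf ha hz ht tg y0 hy)); rewrite -mulrA -/X.
  by apply: ler_pM; rewrite ?(ltW K10)// ?lerDl ?(ltW K30).
apply: (le_trans (H2 f z t N j hf hz ht N0 hG)).
apply: (@le_trans _ _ (K3 * Z)); last first.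
  by apply: ler_pM; rewrite ?(ltW K30)// ?lerDr ?(ltW K10).
rewrite /K3 /Z -!mulrA ler_pM2l// mulrCA ler_wpM2l ?powR_ge0//.
have -> : 2 `^ (1 + q / p) = 2^-1 `^ (- 1 - q / p) :> R.
  by rewrite -(powR_inv1 (ler0n R 2)) -powRrM; congr (_ `^ _); ring.
have h2 : 0 <= 2^-1 :> R by rewrite invr_ge0.
rewrite -(powRM _ h2 (addr_ge0 t01 (ltW g0))); apply: powR_anti.
- by rewrite mulr_gt0 ?invr_gt0// ltr_wpDl.
- by move: gt dz; clear; lra.
- by rewrite -opprD oppr_le0 addr_ge0// divr_ge0 ?(ltW q0) ?(ltW p0).
Qed.

(** Integrate [partial_bound] in [t]: both terms are explicit power integrals.
    *)
Lemma gleason_pointwise (p q k : R) b : 1 <= p -> 0 < q -> 0 < k -> unit_ball b ->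
  exists2 K : R, 0 < K & forall f a z (N : R) j, holo f -> bounded_inside f ->
  unit_ball a -> unit_ball z ->
  0 <= N -> (forall u, unit_ball u -> nc (f u) `^ p <= N * delta u `^ (- q)) ->
  ((nc (gleason b j f z) `^ p)%:E <=
    (K * delta z `^ (- k))%:E * local_mass p k (24 / delta b) f a z +
    (K * N * gap z a `^ (- q))%:E)%E.
Proof.
move=> p1 q0 k0 hb; have [K K0 H] := partial_bound p1 q0 k0 hb.
have p0 : 0 < p := lt_le_trans ltr01 p1.
pose K1 := 2 * K * (p / k + p / q).
have K10 : 0 < K1 by rewrite !mulr_gt0// addr_gt0// divr_gt0.
exists (2 `^ p * K1 `^ p); first by rewrite mulr_gt0 ?powR_gt0.
move=> f a z N j hf bf ha hz N0 hG; have dz := delta_gt0 hz.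
have g0 : 0 < gap z a := nc_1sub_gt0 hz ha.
have L0 : (0 <= local_mass p k (24 / delta b) f a z)%E.
  by apply: integral_ge0 => u _; rewrite lee_fin !(@mulr_ge0 R) ?powR_ge0 ?indic_ge0.
case Ly : (local_mass p k (24 / delta b) f a z) L0 => [y| |] // y0; last first.
  by rewrite gt0_muley ?lte_fin ?mulr_gt0 ?powR_gt0// addye// leey.
rewrite lee_fin in y0; rewrite -EFinM -EFinD lee_fin.
have hy : (local_mass p k (24 / delta b) f a z <= y%:E)%E by rewrite Ly.
pose al := y `^ p^-1 * delta z `^ (- (k / p)).
pose bt := N `^ p^-1 * gap z a `^ (- (q / p)).
have al0 : 0 <= al by rewrite mulr_ge0 ?powR_ge0.
have bt0 : 0 <= bt by rewrite mulr_ge0 ?powR_ge0.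
have main : nc (gleason b j f z) <= K1 * (al + bt).
  pose F1 (t : R) := (1 - t + delta z) `^ (- 1 - k / p).
  pose F2 (t : R) := (1 - t + gap z a) `^ (- 1 - q / p).
  have mF (x e : R) : measurable_fun setT (fun t : Rm => (1 - t + x) `^ e : R).
    rewrite (_ : (fun t => _) = (fun t : Rm => (1 + x - t) `^ e)).
      exact: measurable_shift_powR.
    by apply/funext => t; rewrite addrAC.
  pose Y1 := K * y `^ p^-1; pose N1 := K * N `^ p^-1.
  have Y10 : 0 <= Y1 by rewrite mulr_ge0 ?powR_ge0 ?(ltW K0).
  have N10 : 0 <= N1 by rewrite mulr_ge0 ?powR_ge0 ?(ltW K0).
  have mh : measurable_fun setT (fun t : Rm => Y1 * F1 t + N1 * F2 t : Rm).
    apply: measurable_funD; apply: measurable_funM; (try exact: measurable_cst); exact: mF.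
  have cc : ccont_on 0 1 (fun t => partial j f (pt b z t)).
    move=> t ht; apply: (@ccont_line _ _ _ b (z - b) (fun t => t%:C%C)); last exact: ccont_real.
    by apply: holo_cont; [exact: partial_holo|exact: segment_ball].
  have := nc_cint_le cc mh.
  have hh t : 0 <= t <= 1 -> nc (partial j f (pt b z t)) <= Y1 * F1 t + N1 * F2 t.
    move=> ht; apply: (le_trans (H f a z t y N j hf ha hz ht y0 hy N0 hG)).
    by rewrite mulrDr !mulrA.
  move=> /(_ hh) => le1; rewrite -lee_fin; apply: (le_trans le1).
  have mI : measurable (`[0%R, 1%R]%classic : set Rm) by exact: measurable_itv.
  have -> : (\int[leb]_(t in `[0%R, 1%R]) (Y1 * F1 t + N1 * F2 t)%:E =
     Y1%:E * \int[leb]_(t in `[0%R, 1%R]) (F1 t)%:E + N1%:E * \int[leb]_(t in `[0%R, 1%R]) (F2 t)%:E)%E.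
    have mE (x e : R) : measurable_fun (`[0%R, 1%R]%classic : set Rm) (fun t : Rm => ((1 - t + x) `^ e)%:E).
      by apply/measurable_EFinP; apply: measurable_funTS; exact: mF.
    under eq_integral do rewrite EFinD !EFinM.
    rewrite ge0_integralD//.
    - rewrite !ge0_integralZl_EFin//.
      + by move=> t _; rewrite lee_fin powR_ge0.
      + exact: mE.
      + by move=> t _; rewrite lee_fin powR_ge0.
      + exact: mE.
    - by move=> t _; rewrite mule_ge0 ?lee_fin ?powR_ge0.
    - by apply: emeasurable_funM; [exact: measurable_cst|exact: mE].
    - by move=> t _; rewrite mule_ge0 ?lee_fin ?powR_ge0.
    - by apply: emeasurable_funM; [exact: measurable_cst|exact: mE].
  have kp0 : 0 < k / p by rewrite divr_gt0.
  have qp0 : 0 < q / p by rewrite divr_gt0.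
  have Y1E : (0 <= Y1%:E)%E by rewrite lee_fin.
  have N1E : (0 <= N1%:E)%E by rewrite lee_fin.
  have I1 := lee_wpmul2l Y1E (integral_cauchy_powR dz kp0).
  have I2 := lee_wpmul2l N1E (integral_cauchy_powR g0 qp0).
  have two : (0 <= 2%:E :> \bar R)%E by rewrite lee_fin.
  apply: (le_trans (lee_wpmul2l two (leeD I1 I2))).
  rewrite -(EFinM Y1) -(EFinM N1) -EFinD -(EFinM 2) lee_fin.
  have -> : Y1 * (delta z `^ (- (k / p)) / (k / p)) = K * al * (p / k).
    by rewrite /Y1 /al invf_div; ring.
  have -> : N1 * (gap z a `^ (- (q / p)) / (q / p)) = K * bt * (p / q).
    by rewrite /N1 /bt invf_div; ring.
  have h1 : 0 <= K * al * (p / q) by exact: (mulr_ge0 (mulr_ge0 (ltW K0) al0) (divr_ge0 (ltW p0) (ltW q0))).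
  have h2 : 0 <= K * bt * (p / k) by exact: (mulr_ge0 (mulr_ge0 (ltW K0) bt0) (divr_ge0 (ltW p0) (ltW k0))).
  have -> : K1 * (al + bt) = 2 * (K * al * (p / k) + K * bt * (p / q)) +
     2 * (K * al * (p / q) + K * bt * (p / k)) by rewrite /K1; ring.
  by rewrite lerDl mulr_ge0// addr_ge0.
have n0 := nc_ge0 (gleason b j f z).
apply: (@le_trans _ _ ((K1 * (al + bt)) `^ p)).
  apply: (ge0_ler_powR (ltW p0) _ _ main); rewrite ?nnegrE; first exact: n0.
  exact: (mulr_ge0 (ltW K10) (addr_ge0 al0 bt0)).
rewrite (powRM _ (ltW K10) (addr_ge0 al0 bt0)).
have ap : al `^ p = y * delta z `^ (- k).
  rewrite /al powRM ?powR_ge0// -!powRrM mulVf ?gt_eqF// powRr1//; congr (_ * _ `^ _).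
  by field; rewrite gt_eqF.
have bp : bt `^ p = N * gap z a `^ (- q).
  rewrite /bt powRM ?powR_ge0// -!powRrM mulVf ?gt_eqF// powRr1//; congr (_ * _ `^ _).
  by field; rewrite gt_eqF.
apply: (le_trans (ler_wpM2l (powR_ge0 _ _) (powR_add_le p0 al0 bt0))).
rewrite ap bp le_eqVlt; apply/orP; left; apply/eqP; ring.
Qed.
End main_estimate.

(** * Integration of the pointwise bound *)
Lemma indic_in (T : Type) (R : realType) (A : set T) x : A x -> \1_A x = 1 :> R.
Proof. by move=> h; rewrite indicE mem_set. Qed.

Lemma indic_out (T : Type) (R : realType) (A : set T) x : ~ A x -> \1_A x = 0 :> R.
Proof. by move=> h; rewrite indicE memNset. Qed.

Lemma powR_split (R : realType) (x a b c : R) : 0 < x -> c = a + b -> x `^ c = x `^ a * x `^ b.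
Proof. by move=> x0 ->; rewrite powRD// (gt_eqF x0) implybT. Qed.

Lemma powRN_le10 (R : realType) (e x y : R) : 0 <= e -> 0 < x -> x <= 10 * y ->
  y `^ (- e) <= 10 `^ e * x `^ (- e).
Proof.
move=> e0 x0 xy; have i10 : 0 <= 10^-1 :> R by rewrite invr_ge0.
apply: (@le_trans _ _ ((x / 10) `^ (- e))).
  apply: powR_anti; rewrite ?oppr_le0//; first by rewrite divr_gt0.
  by rewrite ler_pdivrMr// mulrC.
by rewrite (powRM _ (ltW x0) i10) -(powR_inv1 (ler0n R 10)) -powRrM mulN1r opprK mulrC.
Qed.

(** The order of the factors is that of the two integrands compared in
    [local_mass_integral]. *)
Lemma ler_weight_product (R : realType) (x1 x2 x3 x4 x5 x6 x7 : R) : 0 <= x1 -> 0 <= x2 ->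
  0 <= x3 -> 0 <= x4 -> 0 <= x5 -> x6 <= x7 ->
  x1 * (x2 * x3 * x6) * (x4 * x5) <= x4 * x5 * x3 * x7 * (x1 * x2).
Proof.
move=> h1 h2 h3 h4 h5 h67.
have -> : x1 * (x2 * x3 * x6) * (x4 * x5) = x1 * x2 * x3 * x4 * x5 * x6 by ring.
have -> : x4 * x5 * x3 * x7 * (x1 * x2) = x1 * x2 * x3 * x4 * x5 * x7 by ring.
by rewrite ler_wpM2l// !mulr_ge0.
Qed.

Section gleason_bounded.
Variables (R : realType) (n : nat).
Local Notation C := R[i].
Local Notation nc := (@Normc.normc R).
Local Notation Cn := (measCn R n.+1).
Local Notation V := (@lebesgue_Cn R n.+1).
Local Notation B := (@unit_ball R n.+1).
Local Notation NN := (n.+1%:R + n.+1%:R : R).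
Implicit Types (z w u v a b : 'rV[C]_n.+1) (f : 'rV[C]_n.+1 -> C).

Lemma absf_out f z : ~ unit_ball z -> absf f z = 0.
Proof. by move=> hz; rewrite /absf indicE memNset// mulr0. Qed.

Lemma growth_bounded_inside (p q N : R) f : 0 < p -> 0 <= N ->
  (forall u, unit_ball u -> nc (f u) `^ p <= N * delta u `^ (- q)) -> 0 < q -> bounded_inside f.
Proof.
move=> p0 N0 hG q0 e e0; exists (1 `^ p^-1 * N `^ p^-1 * e `^ (- q / p)) => z hz.
have dz : 0 < delta z := lt_le_trans e0 hz.
apply: (root_bound p0 (nc_ge0 _) ler01 N0 e0); rewrite mul1r.
apply: (le_trans (hG z (iffLR (delta_gt0P z) dz))); rewrite ler_wpM2l//.
by apply: powR_anti => //; rewrite oppr_le0 ltW.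
Qed.

Lemma measurable_approach_region_pair (c2 : R) a :
  measurable_fun setT (fun x : Cn * Cn => \1_(approach_region c2 a x.1) x.2 : R).
Proof.
pose S : set (Cn * Cn) :=
  [set x | nrm ((x.2 : 'rV[C]_n.+1) - x.1) - c2 * delta (x.2 : 'rV[C]_n.+1) < 0] `&`
  [set x | gap x.2 a - 10 * gap x.1 a < 0].
have mS : measurable S.
  apply: measurableI.
    apply: measurable_below; apply: measurable_funB.
      apply: measurable_nrm; apply: measurable_CnB; first exact: measurable_snd.
      exact: measurable_fst.
    apply: measurable_funM; first exact: measurable_cst.
    by apply: measurable_delta; exact: measurable_snd.
  apply: measurable_below; apply: measurable_funB.
    exact: (measurableT_comp (measurable_gap a) (@measurable_snd _ _ Cn Cn)).
  apply: measurable_funM; first exact: measurable_cst.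
  exact: (measurableT_comp (measurable_gap a) (@measurable_fst _ _ Cn Cn)).
rewrite (_ : (fun x => _) = \1_S); first exact: measurable_indic.
apply/funext => x; rewrite !indicE; congr (_%:R); apply: congr1.
by apply/idP/idP; rewrite !inE => -[h1 h2]; split; move: h1 h2; rewrite /S /= !subr_lt0.
Qed.

(** Exchange the integrals. For fixed [u] the variable [z] ranges over [|z -
    u| < c2 delta u], where [gap z a] is at least a tenth of [gap u a], and
    [boundary_ball_integral] produces the missing power of [delta u]. *)
Lemma local_mass_integral (p m k c2 be : R) : 1 <= p -> 0 < m -> 0 < k -> 0 < c2 ->
  -1 < be - k -> be - k < 0 -> exists2 K : R, 0 < K &
  forall f (N : R) a, holo f -> unit_ball a ->
  (\int[V]_z (absf f z `^ p * weight be m a z)%:E <= N%:E)%E ->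
  measurable_fun setT (fun z : Cn =>
    (delta z `^ (- k) * weight be m a z * \1_(B : set Cn) z)%:E * local_mass p k c2 f a z)%E /\
  (\int[V]_z ((delta z `^ (- k) * weight be m a z * \1_(B : set Cn) z)%:E *
     local_mass p k c2 f a z) <= (K * N)%:E)%E.
Proof.
move=> p1 m0 k0 c20 ga1 ga0; have [K K0 HK] := boundary_ball_integral n ga1 ga0 c20.
have p0 : 0 < p := lt_le_trans ltr01 p1.
exists (10 `^ (m + m) * K); first by rewrite mulr_gt0 ?powR_gt0.
move=> f N a hf ha hN; have da := delta_gt0 ha.
have pn : p != 0 by rewrite gt_eqF.
pose A (z : Cn) : R := delta z `^ (- k) * weight be m a z * \1_(B : set Cn) z.
pose L (z u : Cn) : R := absf f u `^ p * (delta u `^ (k - NN) * \1_(approach_region c2 a z) u).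
have Ain (z : Cn) : B z -> A z = delta z `^ (- k) * weight be m a z.
  by move=> hz; rewrite /A [X in _ * X](_ : _ = 1); [rewrite mulr1|exact: indic_in].
have Aout (z : Cn) : ~ B z -> A z = 0.
  by move=> hz; rewrite /A [X in _ * X](_ : _ = 0); [rewrite mulr0|exact: indic_out].
have Lin (z u : Cn) : approach_region c2 a z u -> L z u = absf f u `^ p * delta u `^ (k - NN).
  by move=> hr; rewrite /L [X in _ * (_ * X)](_ : _ = 1); [rewrite mulr1|exact: indic_in].
have Lout (z u : Cn) : ~ approach_region c2 a z u -> L z u = 0.
  by move=> hr; rewrite /L [X in _ * (_ * X)](_ : _ = 0); [rewrite !mulr0|exact: indic_out].
have A0 z : 0 <= A z.
  by apply: (@mulr_ge0 R); [apply: (@mulr_ge0 R); [exact: powR_ge0|exact: weight_ge0]|exact: indic_ge0].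
have L0 z u : 0 <= L z u.
  by apply: (@mulr_ge0 R); [exact: powR_ge0|apply: (@mulr_ge0 R); [exact: powR_ge0|exact: indic_ge0]].
have mA : measurable_fun setT A.
  apply: measurable_funM; last by apply: measurable_indic; exact: measurable_unit_ball.
  by apply: measurable_funM; [exact: measurable_delta_powR|exact: measurable_weight].
have mfp : measurable_fun setT (fun u : Cn => absf f u `^ p).
  exact: (measurableT_comp (@measurable_powR R p) (measurable_absf hf)).
have mL : measurable_fun setT (fun x : Cn * Cn => L x.1 x.2).
  apply: measurable_funM; first exact: (measurableT_comp mfp (@measurable_snd _ _ Cn Cn)).
  apply: measurable_funM; last exact: measurable_approach_region_pair.
  exact: (measurableT_comp (measurable_delta_powR (k - NN)) (@measurable_snd _ _ Cn Cn)).
pose H (z u : Cn) : R := A z * L z u.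
have H0 z u : 0 <= H z u by exact: (mulr_ge0 (A0 z) (L0 z u)).
have mH : measurable_fun setT (fun x : Cn * Cn => H x.1 x.2).
  apply: measurable_funM; last exact: mL.
  exact: (measurableT_comp mA (@measurable_fst _ _ Cn Cn)).
have mLz (z : Cn) : measurable_fun setT (L z).
  exact: (measurableT_comp mL (pair1_measurable z)).
have eH (z : Cn) : ((A z)%:E * local_mass p k c2 f a z = \int[V]_u (H z u)%:E)%E.
  by rewrite (integral_scale V (A0 z) (mLz z) (L0 z)).
have [m1 m2 eT] := tonelli V V mH H0.
have -> : (fun z : Cn => (A z)%:E * local_mass p k c2 f a z)%E = (fun z => \int[V]_u (H z u)%:E)%E.
  by apply/funext => z; exact: eH.
split; first exact: m1.
rewrite eT; pose KK := 10 `^ (m + m) * K.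
have KK0 : 0 <= KK by rewrite mulr_ge0 ?powR_ge0 ?(ltW K0).
have mw : measurable_fun setT (fun u : Cn => absf f u `^ p * weight be m a u).
  exact: (measurable_funM mfp (measurable_weight be m a)).
have w0 u : 0 <= absf f u `^ p * weight be m a u.
  by apply: (@mulr_ge0 R); [exact: powR_ge0|exact: weight_ge0].
have KKE : (0 <= KK%:E)%E by rewrite lee_fin.
have := lee_wpmul2l KKE hN; rewrite -(integral_scale V KK0 mw w0) -EFinM.
apply: le_trans; apply: ge0_integral_mono; first exact: m2.
- apply/measurable_EFinP; exact: (measurable_funM (measurable_cst KK) mw).
- by move=> u; apply: integral_ge0 => z _; rewrite lee_fin.
move=> u; case: (asboolP (B u)) => hu; last first.
  rewrite (eq_integral (cst 0%E)) ?integral0.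
    by rewrite lee_fin; exact: (mulr_ge0 KK0 (w0 u)).
  by move=> z _; rewrite /H /L (absf_out f hu) (powR0 pn) mul0r mulr0.
have du := delta_gt0 hu.
have gu : 0 < gap u a := nc_1sub_gt0 hu ha.
pose E : set Cn := B `&` [set z | nrm (z - u) < c2 * delta u]%classic.
pose cu := absf f u `^ p * delta u `^ (k - NN) * delta a `^ m * (10 `^ (m + m) * gap u a `^ (- (m + m))).
have cu0 : 0 <= cu by rewrite /cu !mulr_ge0 ?powR_ge0.
have mE : measurable E.
  apply: measurableI; first exact: measurable_unit_ball.
  exact: (measurable_below (c2 * delta u) (measurable_dist u)).
have mg : measurable_fun setT (fun z : Cn => delta z `^ (be - k) * \1_E z).
  exact: (measurable_funM (measurable_delta_powR (be - k)) (measurable_indic mE)).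
have g0 (z : Cn) : 0 <= delta z `^ (be - k) * \1_E z.
  by apply: (@mulr_ge0 R); [exact: powR_ge0|exact: indic_ge0].
apply: (@le_trans _ _ (\int[V]_z (cu * (delta z `^ (be - k) * \1_E z))%:E)%E).
  apply: integral_mono.
  - exact: (measurableT_comp mH (pair2_measurable (u : Cn))).
  - exact: (measurable_funM (measurable_cst cu) mg).
  - by move=> z; exact: H0.
  - move=> z; have r0 := mulr_ge0 cu0 (g0 z); rewrite /H.
    case: (asboolP (B z)) => hz; last by rewrite (Aout z hz) mul0r.
    case: (asboolP (approach_region c2 a z u)) => hr; last by rewrite (Lout z u hr) mulr0.
    have dz := delta_gt0 hz.
    have gz : 0 < gap z a := nc_1sub_gt0 hz ha.
    have [r1 r2] := hr; rewrite /= in r1 r2.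
    have Ez : E z by split; [exact: hz|rewrite /= nrm_distC; exact: r1].
    rewrite (Ain z hz) (Lin z u hr) [X in _ <= _ * (_ * X)](_ : _ = 1) ?mulr1 /cu /weight; last exact: indic_in.
    have -> : delta z `^ (be - k) = delta z `^ (- k) * delta z `^ be.
      exact: (powR_split dz (addrC _ _)).
    have g2 : gap z a `^ (- (m + m)) <= 10 `^ (m + m) * gap u a `^ (- (m + m)).
      exact: (powRN_le10 (addr_ge0 (ltW m0) (ltW m0)) gu (ltW r2)).
    by apply: ler_weight_product g2; exact: powR_ge0.
rewrite (integral_scale V cu0 mg g0).
have cuE : (0 <= cu%:E)%E by rewrite lee_fin.
apply: (le_trans (lee_wpmul2l cuE (HK u hu))); rewrite -EFinM lee_fin.
have e : delta u `^ (k - NN) * delta u `^ (be - k + NN) = delta u `^ be.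
  by apply/esym/(powR_split du); move: NN => N'; ring.
rewrite /weight -e /cu /KK le_eqVlt; apply/orP; left; apply/eqP; ring.
Qed.

(** The exponent [k] has to satisfy [0 < k] and [-1 < be - k < 0]; half the
    sum of [max be 0] and [be + 1] does. *)
Lemma gleason_norm (p q m be : R) b : 1 <= p -> 0 < q -> 0 < m ->
  be = q + m - n.+2%:R -> -1 < be -> unit_ball b -> exists2 K : R, 0 < K &
  forall f (N : R), holo f -> 0 <= N ->
  (forall a, unit_ball a -> (\int[V]_z (absf f z `^ p * weight be m a z)%:E <= N%:E)%E) ->
  bounded_inside f /\ forall j a, unit_ball a ->
  (\int[V]_z (absf (gleason b j f) z `^ p * weight be m a z)%:E <= (K * N)%:E)%E.
Proof.
move=> p1 q0 m0 beE be1 hb; have p0 : 0 < p := lt_le_trans ltr01 p1.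
have db := delta_gt0 hb.
pose k := (Num.max be 0 + be + 1) / 2.
have [k0 [ga1 ga0]] : 0 < k /\ -1 < be - k /\ be - k < 0.
  rewrite /k; case: (leP be 0) => h; split; try split; lra.
have [Kg Kg0 HG] := growth n be m p1.
have [Kp Kp0 HP] := gleason_pointwise p1 q0 k0 hb.
have c20 : 0 < 24 / delta b by rewrite divr_gt0.
have [Km Km0 HM] := local_mass_integral p1 m0 k0 c20 ga1 ga0.
have := @forelli_rudin R n m q m0 q0; rewrite /= -beE => /(_ be1)[Kf Kf0 HF].
exists (Kp * Km + Kp * Kg * Kf); first by rewrite addr_gt0 ?mulr_gt0.
move=> f N hf N0 hN.
have hG u : unit_ball u -> nc (f u) `^ p <= (Kg * N) * delta u `^ (- q).
  move=> hu; have := HG f N hf hN u hu; congr (_ <= _ * _ `^ _).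
  by rewrite beE; ring.
have KN0 : 0 <= Kg * N by rewrite mulr_ge0 ?(ltW Kg0).
have bf := growth_bounded_inside p0 KN0 hG q0.
split => // j a ha; have da := delta_gt0 ha.
have [mM iM] := HM f N a hf ha (hN a ha).
have hg := gleason_holo j hb hf bf.
pose G1 (z : Cn) := (Kp%:E * ((delta z `^ (- k) * weight be m a z * \1_(B : set Cn) z)%:E *
  local_mass p k (24 / delta b) f a z))%E.
pose g2 (z : Cn) := delta z `^ be * gap z a `^ (- (m + m + q)) * \1_(B : set Cn) z.
pose G2 (z : Cn) := (Kp * (Kg * N) * delta a `^ m * g2 z)%:E.
have lm0 z : (0 <= local_mass p k (24 / delta b) f a z)%E.
  by apply: integral_ge0 => u _; rewrite lee_fin !(@mulr_ge0 R) ?powR_ge0 ?indic_ge0.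
have pos0 (z : Cn) : 0 <= delta z `^ (- k) * weight be m a z * \1_(B : set Cn) z.
  by apply: (@mulr_ge0 R); [apply: (@mulr_ge0 R); [exact: powR_ge0|exact: weight_ge0]|exact: indic_ge0].
have G10 z : (0 <= G1 z)%E by rewrite !mule_ge0 ?lee_fin ?(ltW Kp0).
have g20 (z : Cn) : 0 <= g2 z.
  by apply: (@mulr_ge0 R); [apply: (@mulr_ge0 R); exact: powR_ge0|exact: indic_ge0].
have K20 : 0 <= Kp * (Kg * N) * delta a `^ m by rewrite !mulr_ge0 ?powR_ge0 ?(ltW Kp0) ?(ltW Kg0).
have G20 z : (0 <= G2 z)%E by rewrite lee_fin mulr_ge0.
have mg2 : measurable_fun setT g2.
  apply: measurable_funM; last by apply: measurable_indic; exact: measurable_unit_ball.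
  by apply: measurable_funM; [exact: measurable_delta_powR|exact: measurable_gap_powR].
have mG1 : measurable_fun setT G1 by exact: (emeasurable_funM (measurable_cst _) mM).
have mG2 : measurable_fun setT G2.
  by apply/measurable_EFinP; exact: (measurable_funM (measurable_cst _) mg2).
have mF : measurable_fun setT (fun z : Cn => absf (gleason b j f) z `^ p * weight be m a z).
  apply: measurable_funM; last exact: measurable_weight.
  exact: (measurableT_comp (@measurable_powR R p) (measurable_absf hg)).
apply: (@le_trans _ _ (\int[V]_z (G1 z + G2 z))%E).
  apply: ge0_integral_mono.
  - by apply/measurable_EFinP; exact: mF.
  - exact: (emeasurable_funD mG1 mG2).
  - by move=> z; rewrite lee_fin (@mulr_ge0 R) ?powR_ge0 ?weight_ge0.
  move=> z; case: (asboolP (B z)) => hz; last first.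
    by rewrite (absf_out _ hz) (powR0 (lt0r_neq0 p0)) mul0r adde_ge0.
  have dz := delta_gt0 hz.
  have gz : 0 < gap z a := nc_1sub_gt0 hz ha.
  rewrite (absf_in _ hz) EFinM muleC.
  have wE : (0 <= (weight be m a z)%:E)%E by rewrite lee_fin weight_ge0.
  apply: (le_trans (lee_wpmul2l wE (HP f a z (Kg * N) j hf bf ha hz KN0 hG))).
  rewrite ge0_muleDr; first last.
  - by rewrite lee_fin !mulr_ge0 ?powR_ge0 ?(ltW Kp0) ?(ltW Kg0).
  - by rewrite mule_ge0 ?lee_fin ?mulr_ge0 ?powR_ge0 ?(ltW Kp0).
  apply: leeD.
    rewrite /G1 [X in (_ <= _ * ((_ * X)%:E * _))%E](_ : _ = 1) ?mulr1; last exact: indic_in.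
    rewrite !muleA -!EFinM.
    rewrite le_eqVlt; apply/orP; left; apply/eqP; congr (_%:E * _)%E; ring.
  rewrite /G2 /g2 [X in (_ <= (_ * (_ * X))%:E)%E](_ : _ = 1) ?mulr1; last exact: indic_in.
  rewrite -EFinM lee_fin /weight.
  have -> : gap z a `^ (- (m + m + q)) = gap z a `^ (- (m + m)) * gap z a `^ (- q).
    by apply: (powR_split gz); rewrite opprD.
  rewrite le_eqVlt; apply/orP; left; apply/eqP; ring.
rewrite ge0_integralD// mulrDl EFinD; apply: leeD.
  rewrite ge0_integralZl_EFin ?(ltW Kp0)//; last first.
    by move=> z _; rewrite mule_ge0 ?lee_fin.
  rewrite -mulrA EFinM; apply: lee_wpmul2l => //; by rewrite lee_fin ltW.
rewrite (integral_scale V K20 mg2 g20).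
have K2E : (0 <= (Kp * (Kg * N) * delta a `^ m)%:E)%E by rewrite lee_fin.
apply: (le_trans (lee_wpmul2l K2E (HF a ha))); rewrite -EFinM lee_fin.
have e : delta a `^ m * delta a `^ (- m) = 1.
  by rewrite powRN mulfV// gt_eqF// powR_gt0.
have -> : Kp * (Kg * N) * delta a `^ m * (Kf * delta a `^ (- m)) =
  Kp * Kg * Kf * N * (delta a `^ m * delta a `^ (- m)) by ring.
by rewrite e mulr1.
Qed.
End gleason_bounded.

(** * The operators on the space *)
Section gleason_linear.
Variables (R : realType) (n : nat).
Local Notation C := R[i].
Local Notation nc := (@Normc.normc R).
Implicit Types (z w u v a b : 'rV[C]_n) (f g : 'rV[C]_n -> C).

(** The gradient is local, so it only depends on the values in the ball. *)
Lemma partial_congr f g z k : holo f -> unit_ball z ->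
  (forall w, unit_ball w -> f w = g w) -> partial k g z = partial k f z.
Proof.
move=> hf hz fg; rewrite /partial (@gradE _ _ g z (grad f z))// => e e0.
have dz := delta_gt0 hz.
have [d d0 Hd] := gradP (hf z hz) e0.
exists (Num.min d (delta z / 4)); first by rewrite lt_min d0 divr_gt0.
move=> h; rewrite lt_min => /andP[hd hz4].
have hzh : unit_ball (z + h).
  by apply/delta_gt0P; apply: lt_le_trans (delta_step dz (ltW hz4)); rewrite divr_gt0.
by rewrite -(fg _ hz) -(fg _ hzh); exact: Hd.
Qed.

Lemma partial_linear (c : C) f g z k : holo f -> holo g -> unit_ball z ->
  partial k (fun w => c * f w + g w) z = c * partial k f z + partial k g z.
Proof.
move=> hf hg hz.
rewrite /partial (@gradE _ _ _ z (c *: grad f z + grad g z)); first by rewrite !mxE.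
move=> e e0; have c0 : 0 < nc c + 1 by rewrite ltr_wpDl ?nc_ge0.
have e1 : 0 < e / 2 / (nc c + 1) by rewrite !divr_gt0.
have e2 : 0 < e / 2 by rewrite divr_gt0.
have [d1 d10 H1] := gradP (hf z hz) e1; have [d2 d20 H2] := gradP (hg z hz) e2.
exists (Num.min d1 d2); first by rewrite lt_min d10.
move=> h; rewrite lt_min => /andP[/H1 h1 /H2 h2].
have -> : lin (c *: grad f z + grad g z) h = c * lin (grad f z) h + lin (grad g z) h.
  by rewrite /lin mulr_sumr -big_split; apply: eq_bigr => i _; rewrite !mxE mulrDl mulrA.
have -> : c * f (z + h) + g (z + h) - (c * f z + g z) - (c * lin (grad f z) h + lin (grad g z) h) =
  c * (f (z + h) - f z - lin (grad f z) h) + (g (z + h) - g z - lin (grad g z) h) by ring.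
apply: (le_trans (ler_ncD _ _)); rewrite Normc.normcM (splitr e) mulrDl lerD//.
apply: (@le_trans _ _ ((nc c + 1) * (e / 2 / (nc c + 1) * nrm h))).
  by apply: ler_pM; rewrite ?nc_ge0// lerDl.
by rewrite mulrA mulrCA mulfV ?gt_eqF// mulr1.
Qed.

Lemma gleason_congr b f g z k : unit_ball b -> unit_ball z -> holo f ->
  (forall w, unit_ball w -> f w = g w) -> gleason b k f z = gleason b k g z.
Proof.
move=> hb hz hf fg; apply: eq_cint => t ht.
exact: esym (partial_congr k hf (segment_ball ht hb hz) fg).
Qed.

Lemma gleason_linear b (c : C) f g z k : unit_ball b -> unit_ball z ->
  holo f -> holo g -> bounded_inside f -> bounded_inside g ->
  gleason b k (fun w => c * f w + g w) z = c * gleason b k f z + gleason b k g z.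
Proof.
move=> hb hz hf hg bf bg.
have cc h : holo h -> bounded_inside h -> ccont_on 0 1 (fun t => partial k h (b + t%:C%C *: (z - b))).
  move=> hh bh t ht; apply: (@ccont_line _ _ _ b (z - b) (fun t => t%:C%C)); last exact: ccont_real.
  exact: (holo_cont (partial_holo k hh bh) (segment_ball ht hb hz)).
rewrite /gleason -(cintZ c (cc f hf bf)) -cintD; last exact: cc.
  by apply: eq_cint => t ht; exact: (partial_linear c k hf hg (segment_ball ht hb hz)).
move=> t ht; apply/ccontM; first exact: ccont_cst.
exact: cc.
Qed.
End gleason_linear.

Section weights.
Variables (R : realType) (n : nat) (p q s : R).
Hypotheses (p1 : 1 <= p) (q0 : 0 < q).
Local Notation C := R[i].
Local Notation nc := (@Normc.normc R).
Local Notation Cn := (measCn R n.+1).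
Local Notation V := (@lebesgue_Cn R n.+1).
Local Notation B := (@unit_ball R n.+1).
Local Notation m := (n.+1%:R * s).
Local Notation be := (q + m - n.+2%:R).
Implicit Types (z a : 'rV[C]_n.+1) (f : 'rV[C]_n.+1 -> C).

(** Insert [Phi_identity] and collect the powers of [delta z]. *)
Lemma weight_identity f a z : unit_ball a -> unit_ball z ->
  nc (f z) `^ p * (1 - sqnorm z) `^ q * (1 - sqnorm (Phi a z)) `^ m * lambda_density z =
  absf f z `^ p * weight be m a z.
Proof.
move=> ha hz; have da := delta_gt0 ha; have dz := delta_gt0 hz.
have gz : 0 < gap z a := nc_1sub_gt0 hz ha.
rewrite (absf_in f hz) (Phi_identity ha hz).
have -> : nc (1 - dotmx z a) = gap z a by [].
rewrite /lambda_density -(deltaE z) /weight.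
rewrite (powR_split dz (_ : be = q + (m + - n.+2%:R))) ?addrA//.
rewrite (powR_split dz (erefl (m + - n.+2%:R))).
rewrite (powRN (delta z)) powR_mulrn ?(ltW dz)//.
rewrite powRM ?mulr_ge0 ?invr_ge0 ?(ltW da) ?(ltW dz) ?exprn_ge0 ?(ltW gz)//.
rewrite powRM ?(ltW da) ?(ltW dz)//.
have -> : (gap z a ^+ 2)^-1 `^ m = gap z a `^ (- (m + m)).
  rewrite -powR_mulrn ?(ltW gz)// -powRN -powRrM; congr (_ `^ _).
  by move: (n.+1%:R * s) => t; ring.
by move: (nc (f z) `^ p) (delta z `^ q) (delta a `^ m) (delta z `^ m) (gap z a `^ _) ((_ ^+ _)^-1); clear; move=> *; ring.
Qed.

Lemma integral_dV_weight : exists2 r : R, 0 < r & forall f a, holo f -> unit_ball a ->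
  (\int[@dV R n.+1]_(z in B)
     (nc (f z) `^ p * (1 - sqnorm z) `^ q
      * (1 - sqnorm (Phi a z)) `^ m * lambda_density z)%:E)%E =
  (r%:E * \int[V]_z (absf f z `^ p * weight be m a z)%:E)%E.
Proof.
have [V0 Voo] := ball_volume_gt0_lty R n.+1.
have p0 : 0 < p := lt_le_trans ltr01 p1.
exists (fine (V B))^-1; first by rewrite invr_gt0 fine_gt0// V0.
move=> f a hf ha.
have mB := @measurable_unit_ball R n.+1.
have mF : measurable_fun setT (fun z : Cn => absf f z `^ p * weight be m a z).
  exact: (measurable_funM (measurableT_comp (@measurable_powR R p) (measurable_absf hf)) (measurable_weight _ _ _)).
have F0 (z : Cn) : 0 <= absf f z `^ p * weight be m a z.
  by apply: (@mulr_ge0 R); [exact: powR_ge0|exact: weight_ge0].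
transitivity (\int[@dV R n.+1]_(z in B) (absf f z `^ p * weight be m a z)%:E)%E.
  by apply: eq_integral => z; rewrite inE => hz; rewrite weight_identity.
rewrite ge0_integral_mscale//; first last.
- by move=> x _; rewrite lee_fin.
- by apply: measurable_funTS; exact/measurable_EFinP.
congr (_ * _)%E; rewrite (integral_restrict V _ mB); apply: eq_integral => z _.
case: (asboolP (B z)) => hz.
  by rewrite [X in _ * X](_ : _ = 1) ?mulr1//; exact: indic_in.
by rewrite (absf_out f hz) (powR0 (lt0r_neq0 p0)) !mul0r.
Qed.
End weights.

Section operators.
Variables (R : realType) (n : nat) (p q s : R) (b : 'rV[R[i]]_n.+1).
Hypotheses (p1 : 1 <= p) (q0 : 0 < q) (s0 : 0 < s) (sq : 1 - q / n.+1%:R < s).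
Hypothesis hb : unit_ball b.
Local Notation C := R[i].
Local Notation B := (@unit_ball R n.+1).
Local Notation V := (@lebesgue_Cn R n.+1).
Local Notation Cn := (measCn R n.+1).
Local Notation m := (n.+1%:R * s).
Local Notation be := (q + m - n.+2%:R).
Implicit Types (z a : 'rV[C]_n.+1) (f : 'rV[C]_n.+1 -> C).

Let p0 : 0 < p := lt_le_trans ltr01 p1.

Let m0 : 0 < m. Proof. by rewrite mulr_gt0. Qed.

Let be1 : -1 < be.
Proof.
move: sq; rewrite -(@ltr_pM2l _ n.+1%:R) ?ltr0n// mulrBr mulr1 mulrCA mulfV ?pnatr_eq0// mulr1.
rewrite -[in n.+2%:R]addn1 natrD; move: m => t; move: (n.+1%:R) => N; lra.
Qed.

Lemma Npow_ge0 f : (0 <= Npow p q s f)%E.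
Proof.
have h0 : B 0 by apply/in_unit_ball; rewrite nrm0.
apply: ereal_sup_ge; eexists; first by exists 0; [exact: h0|reflexivity].
apply: integral_ge0 => z hz; have dz := delta_gt0 hz.
have d0 : 0 <= 1 - sqnorm z by rewrite -(deltaE z) ltW.
rewrite lee_fin; apply: mulr_ge0; last by rewrite invr_ge0 exprn_ge0.
by apply: mulr_ge0; [apply: mulr_ge0|]; exact: powR_ge0.
Qed.

Lemma gleason_Npow : exists2 K : R, 0 < K & forall f, Nspace p q s f -> bounded_inside f /\
  forall j, (Npow p q s (gleason b j f) <= K%:E * Npow p q s f)%E.
Proof.
have [K K0 HK] := gleason_norm p1 q0 m0 (erefl be) be1 hb.
have [r r0 Hr] := @integral_dV_weight R n p q s p1.
exists K => // f [/holoP hf Nf].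
have Nfin : Npow p q s f \is a fin_num by rewrite ge0_fin_numE// Npow_ge0.
pose N := fine (Npow p q s f); have N0 : 0 <= N by rewrite fine_ge0// Npow_ge0.
have NE : Npow p q s f = N%:E by rewrite fineK.
have hN a : unit_ball a -> (\int[V]_z (absf f z `^ p * weight be m a z)%:E <= (N / r)%:E)%E.
  move=> ha; apply: (lee_of_pmul2r r0); rewrite muleC -EFinM divfK ?gt_eqF// -(Hr f a hf ha) -NE.
  by apply: ereal_sup_ubound; exists a.
have [bf HA] := HK f (N / r) hf (divr_ge0 N0 (ltW r0)) hN.
split => // j; have hg := gleason_holo j hb hf bf.
apply: ge_ereal_sup => _ [a ha <-]; rewrite (Hr _ a hg ha) NE.
have rE : (0 <= r%:E)%E by rewrite lee_fin ltW.
apply: (le_trans (lee_wpmul2l rE (HA j a ha))); rewrite -!EFinM lee_fin.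
by rewrite mulrCA (mulrC r) divfK ?gt_eqF.
Qed.

Lemma gleason_bounded_operator j : bounded_linear_operator p q s (gleason b j).
Proof.
have [K K0 HK] := gleason_Npow.
split.
- move=> f Nf; have [bf HA] := HK f Nf; have [/holoP hf fN] := Nf.
  split; first by apply/holoP; exact: gleason_holo.
  apply: (le_lt_trans (HA j)).
  have Nfin : Npow p q s f \is a fin_num by rewrite ge0_fin_numE// Npow_ge0.
  by rewrite -(fineK Nfin) -EFinM ltry.
- by move=> f g [/holoP hf _] _ fg z hz; exact: gleason_congr.
- move=> c f g Nf Ng z hz.
  have [bf _] := HK f Nf; have [bg _] := HK g Ng.
  by move: Nf Ng => [/holoP hf _] [/holoP hg _]; exact: gleason_linear.
- exists (K `^ p^-1) => f Nf; have [bf HA] := HK f Nf.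
  have KE : (0 <= K%:E)%E by rewrite lee_fin ltW.
  have ip : 0 <= p^-1 by rewrite invr_ge0 ltW.
  have h0 := Npow_ge0 f; have h1 := Npow_ge0 (gleason b j f).
  have nn (x : \bar R) : (0 <= x)%E -> x \in `[0%E, +oo%E] by move=> x0; rewrite in_itv/= x0 leey.
  have le1 := gt0_ler_poweR ip (nn _ h1) (nn _ (mule_ge0 KE h0)) (HA j).
  by apply: (le_trans le1); rewrite (poweRM _ KE h0) poweR_EFin.
Qed.

Lemma gleason_representation f : Nspace p q s f -> f b = 0 -> forall z, unit_ball z ->
  f z = \sum_(k < n.+1) (z ord0 k - b ord0 k) * gleason b k f z.
Proof.
move=> Nf fb z hz; have [K K0 HK] := gleason_Npow; have [bf _] := HK f Nf.
have [/holoP hf _] := Nf.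
by have := gleason_identity hb hz hf bf; rewrite fb subr0.
Qed.
End operators.

Local Close Scope classical_set_scope.

Theorem corollary6p13 (R : realType) (n : nat) (p q s : R) (b : 'rV[R[i]]_n)
    (hn : (0 < n)%N) (hp : 1 <= p) (hq : 0 < q)
    (hs : Num.max 0 (1 - q / n%:R) < s) (hb : unit_ball b) :
  exists A : 'I_n -> ('rV[R[i]]_n -> R[i]) -> 'rV[R[i]]_n -> R[i],
    (forall k, bounded_linear_operator p q s (A k)) /\
    (forall f, Nspace p q s f -> f b = 0 ->
       forall z, unit_ball z ->
         f z = \sum_(k < n) (z ord0 k - b ord0 k) * A k f z).
Proof.
case: n b hn hs hb => // n b _; rewrite gt_max => /andP[s0 sq] hb.
exists (gleason b); split => [k|f Nf fb z hz].
  exact: gleason_bounded_operator.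
exact: (gleason_representation hp hq s0 sq).
Qed.
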